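(* Let $\mathcal{C}=\{B_1,\dots,B_m\}$ be a set of blocks (bipolar directed graphs) with north poles $N_i$, south poles $S_i$ and probabilities $p_i$, and let $\mathcal{B}_0,\mathcal{B}_1,\mathcal{B}_2,\dots$ be a sequence of bipolar networks grown from $\mathcal{C}$ using linear preferential attachment with parameters $\chi$ and $\rho$. Let $r$ be a positive integer (such that there are at least $r$ essential outdegrees) and let $k_1<k_2<\dots<k_r$ be the first (smallest) $r$ essential outdegrees. Let $\mathcal{Y}_n=(Y_{n,1},\dots,Y_{n,r})$, where $Y_{n,i}$ is the number of vertices of outdegree $k_i$ in $\mathcal{B}_n$. With $w_k=\chi k+\rho$, define $$f(k)=\sum_{i=1}^m p_i\,\bigl|\{v\in V(B_i)\setminus\{N_i,S_i\}:\deg^+(v)=k\}\bigr|\quad(k\ge1),\qquad g(k)=\sum_{i:\ \deg^+(N_i)=k+1}p_i\quad(k\ge0),$$ $$\lambda_1=\sum_{k\ge1}\bigl(w_kf(k)+\chi k\,g(k)\bigr),$$ and define $\psi=(\psi_1,\dots,\psi_r)$ by $\psi_1=f(k_1)/\bigl(\lambda_1+w_{k_1}(1-g(0))\bigr)$ and, recursively for $i=2,\dots,r$, $$\psi_i=\frac{1}{\lambda_1+w_{k_i}(1-g(0))}\Bigl(f(k_i)+\sum_{j=1}^{i-1}w_{k_j}\,g(k_i-k_j)\,\psi_j\Bigr).$$ Then, as $n\to\infty$, $$n^{-1/2}\bigl(\mathcal{Y}_n-n\lambda_1\psi\bigr)\xrightarrow{d}\mathcal{N}(0,\Sigma)$$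 for some covariance matrix $\Sigma$.
   Context: Parameters: $\chi\ge0$ and $\rho\in\mathbb{R}$ are real numbers with $\chi+\rho>0$; $w_k:=\chi k+\rho$ for positive integers $k$. Blocks: $\deg^-(v)$ and $\deg^+(v)$ denote the indegree and outdegree of a vertex $v$ of a directed graph; $v$ is a source if $\deg^-(v)=0$ and a sink if $\deg^+(v)=0$. A bipolar directed graph is a finite connected directed graph with exactly one source $N$ (the north pole) and exactly one sink $S$ (the south pole), $N\ne S$. $\mathcal{C}=\{B_1,\dots,B_m\}$ is a finite set of bipolar directed graphs, called blocks, with north poles $N_i$ and south poles $S_i$; each $B_i$ is assigned a probability $p_i>0$, with $p_1+\dots+p_m=1$. Bipolar networks: $\mathcal{B}_0$ is a copy of one of the blocks (chosen arbitrarily, deterministically or at random); the vertices of $\mathcal{B}_0$ corresponding to the north and south poles of that block are the master source $N$ and the master sink $S$ of all subsequent networks. For $n\ge1$, given $\mathcal{B}_{n-1}$, a vertex $v\ne S$ of $\mathcal{B}_{n-1}$ (the latch) is chosen with probability $\dfrac{\chi\deg^+(v)+\rho}{\sum_{u\in V(\mathcal{B}_{n-1})\setminus\{S\}}(\chi\deg^+(u)+\rho)}$; then one of the arcs $(v,u)$ leading out of $v$ is chosen uniformly at random among all arcs leading out of $v$; then, independently of these choices and of the past, a block is chosen, $B_i$ being chosen with probability $p_i$. $\mathcal{B}_n$ is obtained from $\mathcal{B}_{n-1}$ by deleting the arc $(v,u)$ and adding a new copy of $B_i$ with $N_i$ fused (identified) with $v$ and $S_i$ fused with $u$. Essential outdegrees: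 a positive integer $k$ is an essential outdegree if with positive probability there is some $n$ such that $\mathcal{B}_n$ has at least two vertices of outdegree $k$; otherwise $k$ is a nonessential outdegree. $\mathcal{N}(0,\Sigma)$ is the (possibly degenerate) multivariate normal distribution with mean $0$ and covariance matrix $\Sigma$. *)

(* Defs.v *)
From HB Require Import structures.
From mathcomp Require Import all_boot all_order all_algebra.
From mathcomp Require Import all_classical all_reals all_analysis.

Set Implicit Arguments.
Unset Strict Implicit.
Unset Printing Implicit Defensive.

Import Order.TTheory GRing.Theory Num.Theory.
Import numFieldNormedType.Exports.

Local Open Scope classical_set_scope.
Local Open Scope ring_scope.

(* Finite directed multigraphs with two marked vertices.  Arcs are pairs
   (tail, head); the list of arcs may contain repetitions (parallel arcs), and
   its positions identify the arcs. *)
Record digraph := Digraph {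
  nvert : nat;
  arcs : seq ('I_nvert * 'I_nvert);
  north : 'I_nvert;
  south : 'I_nvert
}.

Definition digraph_code (G : digraph) :
    {n : nat & (seq ('I_n * 'I_n) * 'I_n * 'I_n)%type} :=
  Tagged (fun n => (seq ('I_n * 'I_n) * 'I_n * 'I_n)%type)
    (arcs G, north G, south G).
Definition digraph_decode
    (c : {n : nat & (seq ('I_n * 'I_n) * 'I_n * 'I_n)%type}) : digraph :=
  Digraph (tagged c).1.1 (tagged c).1.2 (tagged c).2.
Lemma digraph_codeK : cancel digraph_code digraph_decode.
Proof. by case. Qed.
HB.instance Definition _ := Countable.copy digraph (can_type digraph_codeK).

Definition outdeg (G : digraph) (v : 'I_(nvert G)) : nat :=
  count (fun e => e.1 == v) (arcs G).

Definition indeg (G : digraph) (v : 'I_(nvert G)) : nat :=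
  count (fun e => e.2 == v) (arcs G).

Definition adj (G : digraph) : rel 'I_(nvert G) :=
  [rel u v | ((u, v) \in arcs G) || ((v, u) \in arcs G)].

Definition bipolar (G : digraph) : Prop :=
  [/\ north G != south G,
      forall v : 'I_(nvert G), indeg v = 0%N <-> v = north G,
      forall v : 'I_(nvert G), outdeg v = 0%N <-> v = south G
    & forall u v : 'I_(nvert G), connect (@adj G) u v].

Definition internal (G : digraph) : {set 'I_(nvert G)} :=
  [set v | (v != north G) && (v != south G)]%SET.

Definition arc_ends (G : digraph) (a : 'I_(size (arcs G))) :
    'I_(nvert G) * 'I_(nvert G) := tnth (in_tuple (arcs G)) a.

(* The network obtained from G by replacing its arc a = (v, u) with a copy of
   B.  The old vertices come first, followed by copies of the internal vertices
   of B; [fuse] sends a vertex of B to its copy, the north pole of B being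
   identified with v and the south pole with u. *)
Definition fuse (G B : digraph) (a : 'I_(size (arcs G))) (w : 'I_(nvert B)) :
    'I_(nvert G + #|internal B|) :=
  match [pick i : 'I_#|internal B| | enum_val i == w] with
  | Some i => rshift (nvert G) i
  | None => lshift #|internal B|
      (if w == north B then (arc_ends a).1 else (arc_ends a).2)
  end.

Definition grow (G B : digraph) (a : 'I_(size (arcs G))) : digraph :=
  @Digraph (nvert G + #|internal B|)
    ([seq (lshift _ e.1, lshift _ e.2) | e <- take a (arcs G) ++ drop a.+1 (arcs G)]
     ++ [seq (fuse a e.1, fuse a e.2) | e <- arcs B])
    (lshift _ (north G)) (lshift _ (south G)).

Definition outdeg_count (G : digraph) (k : nat) : nat :=
  #|[set v : 'I_(nvert G) | outdeg v == k]%SET|.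

Section Process.
Variables (R : realType) (chi rho : R).
Variables (m : nat) (C : 'I_m -> digraph) (p : 'I_m -> R).

Definition weight (k : nat) : R := chi * k%:R + rho.

Definition latch_prob (G : digraph) (v : 'I_(nvert G)) : R :=
  weight (outdeg v) / \sum_(u : 'I_(nvert G) | u != south G) weight (outdeg u).

(* Conditional probability that the next network is G' given that the current
   one is G: choose a latch v, then uniformly an arc a leading out of v, then a
   block. *)
Definition step_prob (G G' : digraph) : R :=
  \sum_(v : 'I_(nvert G) | v != south G) latch_prob v *
    \sum_(a : 'I_(size (arcs G)) | (arc_ends a).1 == v) (outdeg v)%:R^-1 *
      \sum_(i < m | grow (C i) a == G') p i.

Section Trajectory.
Variables (d : measure_display) (T : measurableType d) (P : probability T R).
Variable (B : nat -> T -> digraph).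

Definition bipolar_network_process : Prop :=
  [/\ forall n G, measurable [set w | B n w = G],
      P [set w | exists i : 'I_m, B 0%N w = C i] = 1%E
    & forall (n : nat) (G : nat -> digraph),
        P [set w | forall k, (k <= n.+1)%N -> B k w = G k] =
        (P [set w | forall k, (k <= n)%N -> B k w = G k] *
         (step_prob (G n) (G n.+1))%:E)%E].

Definition essential (k : nat) : Prop :=
  (0 < k)%N /\
  (0 < P [set w | exists n, (2 <= outdeg_count (B n w) k)%N])%E.

Definition first_essentials (r : nat) (k : 'I_r -> nat) : Prop :=
  [/\ forall i j : 'I_r, (i < j)%N -> (k i < k j)%N,
      forall i, essential (k i)
    & forall (i : 'I_r) (l : nat), essential l -> (l < k i)%N ->
        exists j, k j = l].

End Trajectory.

Definition f_coef (k : nat) : R :=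
  \sum_(i < m) p i * #|[set v in internal (C i) | outdeg v == k]%SET|%:R.

Definition g_coef (k : nat) : R :=
  \sum_(i < m | outdeg (north (C i)) == k.+1) p i.

(* The sum has finite support: f_coef k = g_coef k = 0 for k larger than every
   outdegree in the blocks. *)
Definition lambda1 : R :=
  \sum_(k \in [set k : nat | (1 <= k)%N])
    (weight k * f_coef k + chi * k%:R * g_coef k).

End Process.

(* R^r with its Borel sigma-algebra *)
Definition borel_rV (R : realType) (r : nat) :=
  g_sigma_algebraType (@open 'rV[R]_r).

(* The centred normal law on R with variance v.  The null variance is treated
   apart because [normal_prob m 0] is not the Dirac mass at m. *)
Definition centered_normal (R : realType) (v : R) (A : set R) : \bar R :=
  if v == 0 then (\d_(0%R : R) A)%E else normal_prob 0 (Num.sqrt v) A.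

Definition covariance_matrix (R : realType) (r : nat) (Sigma : 'M[R]_r) : Prop :=
  Sigma^T = Sigma /\ forall t : 'rV[R]_r, 0 <= (t *m Sigma *m t^T) 0 0.

(* mu is N(0, Sigma): every linear form t has law N(0, t Sigma t^T) under mu. *)
Definition centered_mvnormal (R : realType) (r : nat) (Sigma : 'M[R]_r)
    (mu : probability (borel_rV R r) R) : Prop :=
  covariance_matrix Sigma /\
  forall (t : 'rV[R]_r) (A : set R), measurable A ->
    mu [set x : 'rV[R]_r | A (\sum_(i < r) t 0 i * x 0 i)] =
    centered_normal ((t *m Sigma *m t^T) 0 0) A.

Definition cvg_in_law (R : realType) (d : measure_display)
    (T : measurableType d) (P : probability T R) (r : nat)
    (X : nat -> T -> 'rV[R]_r) (mu : probability (borel_rV R r) R) : Prop :=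
  forall h : 'rV[R]_r -> R, continuous h ->
    (exists M : R, forall x, `|h x| <= M) ->
    (fun n : nat => \int[P]_w (h (X n w))%:E)%E @ \oo -->
      (\int[mu]_x (h x)%:E)%E.

(* Main.v *)
Require Import Defs.
From HB Require Import structures.
From mathcomp Require Import all_boot all_order all_algebra.
From mathcomp Require Import all_classical all_reals all_analysis.
From mathcomp Require Import measurable_realfun ring lra.

Set Implicit Arguments.
Unset Strict Implicit.
Unset Printing Implicit Defensive.

Import Order.TTheory GRing.Theory Num.Theory.
Import numFieldNormedType.Exports.

Local Open Scope classical_set_scope.
Local Open Scope ring_scope.

(** The network at time [n] is a Markov chain with finitely many possible values at
each time.  Its total weight [W], the denominator of the latch probabilities, is a
random walk: a step adds to it an amount which depends on the block only, and whose
mean is [lambda1] ([total_weight_grow], [lambda1E]).  A step changes the number [Y l] of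
vertices of outdegree [k l] by an amount that depends on the block and on the
outdegree of the latch, and a latch has outdegree [k j] with probability proportional
to [Y j / W].  Nonessential outdegrees concern at most one vertex each, and those below
[k l] contribute [O(1/W)]; the outdegree of a latch never decreases, so that the exact
outdegree of a latch does not matter once it exceeds [k l].  Hence
([expect_step_expansion]) the mean increment of [Y l] is, up to [O(1/W)], an affine
function of the ratios [Y j / W] with [j <= l].  The equations for [psi] say that it
equals [lambda1 * psi l] when the ratios are [psi j].

Put [N = n + 1], [V = W - N * lambda1] and [Z l = Y l - N * lambda1 * psi l].
Linearizing the ratios ([ratio_linear]) gives the chain [U = (V, Z)] the mean
increment [D U / N] up to a small error, where the matrix [D] is lower triangular
with nonpositive diagonal, and a conditional covariance close to a constant matrix
[Gam].  For such chains [triangular_clt] shows that [U / sqrt N] is asymptotically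
normal.  The second moments of [U] are first bounded by [O(N)], one coordinate
after the other ([second_moment]).  A second-order Taylor expansion of
[cos (dot s U + a)] over one step then shows that the characteristic function of [U]
satisfies approximately the recursion satisfied by the characteristic functions of
normal laws whose covariance matrices evolve linearly ([cos_step],
[phi_gauss_step]).  The propagators of this recursion are close to contractions for
a suitable norm, so the local errors add up to a quantity that tends to zero
([phi_gauss_bound]); and the covariance matrices divided by [N] converge, entry after
entry ([is_cvg_cov]).

It remains to pass from characteristic functions to convergence in law.  A normal
law [mu] with the limiting covariance matrix is the image of independent standard
normal variables ([centered_mvnormal_exists]); its characteristic function follows
from that of the standard normal law, which is computed from its stability under
convolution ([normal_cfE]).  Bernstein operators in sines of the coordinates approximate a
bounded continuous function by trigonometric polynomials on cubes while keeping its
bound ([trig_poly_approx]), and the second moments control the mass outside the cubes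
([cvg_expect_continuous]).  The expectations computed along the chain are those of
the given process by [mean_network]. *)

(** * Bounds for trigonometric and exponential functions *)

Section TrigBounds.
Variable R : realType.
Implicit Types x h : R.

(** The mean value inequality between [0] and [h], on either side of [0].  Each
expansion below follows from it and the previous one, its derivative. *)
Lemma increment_le (f df : R -> R) (b M h : R) :
  (forall x, is_derive x 1 f (df x)) ->
  (forall x, `|x| <= b -> `|df x| <= M) -> `|h| <= b ->
  `|f h - f 0| <= M * `|h|.
Proof.
move=> fd dfM hb.
have fc (A : set R) : {within A, continuous f}.
  apply: continuous_subspaceT => x; apply: differentiable_continuous.
  by apply/derivable1_diffP; apply: ex_derive.
have [h0|h0] := leP 0 h.
  have [c /[!in_itv]/= /andP[c0 ch] ->] :=
    @MVT_segment _ f df 0 h h0 (fun x _ => fd x) (fc _).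
  by rewrite subr0 normrM ler_wpM2r// dfM// (le_trans _ hb)// !ger0_norm.
have [c /[!in_itv]/= /andP[c0 ch] E] :=
    @MVT_segment _ f df h 0 (ltW h0) (fun x _ => fd x) (fc _).
rewrite distrC E sub0r normrM normrN ler_wpM2r// dfM// (le_trans _ hb)//.
by rewrite ler0_norm// ltr0_norm// lerN2.
Qed.

Lemma normr_sin_le h : `|sin h| <= `|h|.
Proof.
have := @increment_le sin cos `|h| 1 h _ (fun x _ => cos_max x) (lexx _).
by rewrite sin0 subr0 mul1r; apply => x; exact: is_derive_sin.
Qed.

Lemma normr_cosB1_le h : `|cos h - 1| <= `|h|.
Proof.
have := @increment_le cos (fun x => - sin x) `|h| 1 h _ _ (lexx _).
rewrite cos0 mul1r; apply => x.
by rewrite normrN => _; exact: sin_max.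
Qed.

Lemma cosB1_le_sqr h : `|cos h - 1| <= h ^+ 2.
Proof.
have := @increment_le cos (fun x => - sin x) `|h| `|h| h _ _ (lexx _).
rewrite cos0 -real_normK ?num_real//; apply => x.
by rewrite normrN; apply: le_trans; exact: normr_sin_le.
Qed.

Lemma cos_lipschitz x h : `|cos (x + h) - cos x| <= `|h|.
Proof.
have := @increment_le (fun y => cos (x + y)) (fun y => - sin (x + y)) `|h| 1 h _ _ (lexx _).
rewrite addr0 mul1r; apply => y; last by rewrite normrN => _; exact: sin_max.
have h1 := @is_derive1_comp R cos (fun z => x + z) y (- sin (x + y)) 1.
by rewrite mulr1 in h1; apply: h1; apply: is_derive_eq; rewrite add0r mulr1.
Qed.

Lemma sin_sub_le_sqr h : `|sin h - h| <= h ^+ 2.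
Proof.
have := @increment_le (fun x => sin x - x) (fun x => cos x - 1) `|h| `|h| h _ _ (lexx _).
rewrite sin0 !subr0 -real_normK ?num_real//; apply => x.
by apply: le_trans; exact: normr_cosB1_le.
Qed.

Lemma sin_sub_le_cube h : `|sin h - h| <= `|h| ^+ 3.
Proof.
have := @increment_le (fun x => sin x - x) (fun x => cos x - 1) `|h| (`|h| ^+ 2) h _ _ (lexx _).
rewrite sin0 !subr0 -exprSr; apply => x.
move=> xh; apply: (le_trans (cosB1_le_sqr _)).
by rewrite -real_normK ?num_real// lerXn2r ?nnegrE.
Qed.

Lemma cos_quadratic_le_cube h : `|cos h - 1 + h ^+ 2 / 2| <= `|h| ^+ 3.
Proof.
have := @increment_le (fun x => cos x - 1 + x ^+ 2 / 2) (fun x => - sin x + x) `|h| (`|h| ^+ 2) h _ _ (lexx _).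
rewrite cos0 expr0n mul0r addr0 subrr subr0 -exprSr; apply => x; last first.
  move=> xh; rewrite addrC distrC; apply: (le_trans (sin_sub_le_sqr _)).
  by rewrite -real_normK ?num_real// lerXn2r ?nnegrE.
apply: is_derive_eq.
by rewrite !scaler1 /GRing.scale/=; field.
Qed.

Lemma cos_quadratic_le_fourth h : `|cos h - 1 + h ^+ 2 / 2| <= h ^+ 4.
Proof.
have := @increment_le (fun x => cos x - 1 + x ^+ 2 / 2) (fun x => - sin x + x) `|h| (`|h| ^+ 3) h _ _ (lexx _).
rewrite cos0 expr0n mul0r addr0 subrr subr0 -exprSr.
rewrite (_ : `|h| ^+ 4 = h ^+ 4); last by rewrite -normrX ger0_norm// (exprM h 2 2) sqr_ge0.
apply => x; last first.
  move=> xh; rewrite addrC distrC; apply: (le_trans (sin_sub_le_cube _)).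
  by rewrite lerXn2r ?nnegrE.
apply: is_derive_eq.
by rewrite !scaler1 /GRing.scale/=; field.
Qed.

(** The bound is uniform in the base point [x], which will be random. *)
Lemma cos_taylor2 x h :
  `|cos (x + h) - (cos x - h * sin x - h ^+ 2 / 2 * cos x)| <= 2 * `|h| ^+ 3.
Proof.
have -> : cos (x + h) - (cos x - h * sin x - h ^+ 2 / 2 * cos x) =
  cos x * (cos h - 1 + h ^+ 2 / 2) - sin x * (sin h - h).
  by rewrite cosD; ring.
apply: (le_trans (ler_normB _ _)); rewrite !normrM mulr2n mulrDl mul1r lerD//.
  by rewrite (le_trans _ (cos_quadratic_le_cube h))// ler_piMl// cos_max.
by rewrite (le_trans _ (sin_sub_le_cube h))// ler_piMl// sin_max.
Qed.

(** From below, [1 - x <= exp (- x)]; from above, [exp (- x) <= 1 / (1 + x)]. *)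
Lemma expRN_quadratic x : 0 <= x -> `|expR (- x) - (1 - x)| <= x ^+ 2.
Proof.
move=> x0; have l : 1 - x <= expR (- x) by exact: expR_ge1Dx.
rewrite ger0_norm ?subr_ge0// lerBlDr.
have l2 := expR_ge1Dx x.
have e0 := expR_gt0 (- x).
have E : expR (- x) * expR x = 1 by rewrite -expRD addNr expR0.
have h : expR (- x) * (1 + x) <= 1 by rewrite -[leRHS]E ler_pM2l.
have x1 : 0 < 1 + x by lra.
rewrite -(ler_pM2r x1) (le_trans h)//.
have -> : (x ^+ 2 + (1 - x)) * (1 + x) = 1 + x ^+ 3 by ring.
by rewrite lerDl exprn_ge0.
Qed.

End TrigBounds.

(** * Scalar recursions with coefficients close to one *)

Section Recursions.
Variable R : realType.

Local Notation inv n := ((n.+1%:R : R)^-1).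

Lemma cvg_near_le (f : nat -> R) (a b : R) :
  f n @[n --> \oo] --> b -> (\forall n \near \oo, a <= f n) -> a <= b.
Proof.
move=> fb af; rewrite -(cvg_lim (@Rhausdorff R) fb).
by apply: limr_ge => //; exact: cvgP fb.
Qed.

Lemma is_cvg_sum_seq (I : Type) (r : seq I) (P : pred I) (f : I -> nat -> R) :
  (forall i, P i -> cvg (f i n @[n --> \oo])) ->
  cvg ((\sum_(i <- r | P i) f i n) @[n --> \oo]).
Proof.
move=> fc; apply/cvg_ex; exists (\sum_(i <- r | P i) lim (f i n @[n --> \oo])).
by apply: cvg_big => //; exact: add_continuous.
Qed.

Lemma cvg_seq_le (f g : nat -> R) (a b : R) :
  f n @[n --> \oo] --> a -> g n @[n --> \oo] --> b ->
  (forall n, f n <= g n) -> a <= b.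
Proof.
move=> fa gb fg; rewrite -(cvg_lim (@Rhausdorff R) fa) -(cvg_lim (@Rhausdorff R) gb).
apply: ler_lim; [exact: cvgP fa|exact: cvgP gb|exact: nearW].
Qed.

Lemma cvg_invS : inv n @[n --> \oo] --> (0 : R).
Proof. exact: cvg_harmonic. Qed.

Lemma cvg_sqrt_div : (Num.sqrt n.+1%:R / n.+1%:R : R) @[n --> \oo] --> (0 : R).
Proof.
have -> : (fun n => Num.sqrt n.+1%:R / n.+1%:R : R) = (fun n => Num.sqrt (inv n)).
  apply/funext => n; rewrite sqrtrV// -{2}(sqr_sqrtr (ler0n R n.+1)).
  by rewrite expr2 invfM mulrA divff ?mul1r// gt_eqF// sqrtr_gt0.
rewrite -(@sqrtr0 R); apply: continuous_cvg; first exact: sqrt_continuous.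
exact: cvg_invS.
Qed.

(** A factor [1 + 1 / (4 (n + 1))] at every step makes a sequence grow no faster
than [sqrt (n + 1)], which the denominator [n + 1] of [recursion_small] beats. *)
Lemma sqrt_growth (n : nat) :
  (1 + 4^-1 / n.+1%:R) * Num.sqrt n.+1%:R <= Num.sqrt (n.+2%:R : R).
Proof.
have m0 : 0 < n.+1%:R :> R by [].
have v0 : 0 < inv n by rewrite invr_gt0.
have v1 : inv n <= 1 by rewrite invf_le1// ler1n.
have E : n.+1%:R * inv n = 1 by rewrite divff// gt_eqF.
have p0 : 0 <= 1 + 4^-1 * inv n by rewrite addr_ge0// mulr_ge0// ltW.
rewrite -(@ler_pXn2r _ 2)//; [|by rewrite nnegrE mulr_ge0 ?sqrtr_ge0
  |by rewrite nnegrE sqrtr_ge0].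
rewrite exprMn !sqr_sqrtr// (_ : n.+2%:R = n.+1%:R + 1 :> R); last first.
  by rewrite -natr1.
move: v0 v1 E; move: (inv n) => v v0 v1 E.
have -> : (1 + 4^-1 * v) ^+ 2 * n.+1%:R =
  n.+1%:R + (n.+1%:R * v) / 2 + (n.+1%:R * v) * v / 16 by field.
rewrite E; lra.
Qed.

(** If [b] is at most [d] from rank [N] on, then [y n] is at most
[y N * sqrt (n + 1) + 2 * d * (n + 1)]: the initial value grows like the square
root by [sqrt_growth], and the forcing term accumulates linearly. *)
Lemma recursion_small (c y b : nat -> R) :
  (forall n, 0 <= y n) -> (forall n, 0 <= c n) ->
  (forall n, y n.+1 <= c n * y n + b n) ->
  (\forall n \near \oo, c n <= 1 + 4^-1 / n.+1%:R) ->
  b n @[n --> \oo] --> (0 : R) ->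
  y n / n.+1%:R @[n --> \oo] --> (0 : R).
Proof.
move=> y0 c0 ybnd ccvg b0; apply/cvgrPdist_le => /= e e0.
pose d := e / 4; have d0 : 0 < d by rewrite /d; lra.
have [N _ HN] : \forall n \near \oo, c n <= 1 + 4^-1 / n.+1%:R /\ b n <= d.
  near=> n; split; first by near: n.
  apply: (le_trans (ler_norm _)); near: n.
  by move/cvgr0Pnorm_le : b0; apply.
have key n : y (N + n)%N <= y N * Num.sqrt (N + n).+1%:R + 2 * d * (N + n).+1%:R.
  elim: n => [|n IH].
    rewrite addn0 -[leLHS]addr0 lerD//; last by rewrite !mulr_ge0// ltW.
    by rewrite ler_peMr// -{1}(@sqrtr1 R) ler_sqrt ?ler1n.
  rewrite addnS; have [cn bn] := HN _ (leq_addr n N).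
  set m := (N + n)%N in IH cn bn *.
  apply: (le_trans (ybnd m)).
  have g := sqrt_growth m.
  have m0 : 0 < m.+1%:R :> R by [].
  have E : m.+1%:R * inv m = 1 by rewrite divff// gt_eqF.
  have v0 : 0 < inv m by rewrite invr_gt0.
  have s0 : 0 <= Num.sqrt m.+1%:R :> R by exact: sqrtr_ge0.
  apply: (@le_trans _ _ ((1 + 4^-1 / m.+1%:R) * (y N * Num.sqrt m.+1%:R + 2 * d * m.+1%:R) + d)).
    rewrite lerD//; apply: ler_pM => //.
  have yg := ler_wpM2l (y0 N) g.
  rewrite (_ : m.+2%:R = m.+1%:R + 1 :> R); last by rewrite -natr1.
  rewrite (_ : Num.sqrt (m.+1%:R + 1) = Num.sqrt m.+2%:R); last by rewrite natr1.
    move: yg v0 E; move: (inv m) => v yg v0 E.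
  have -> : (1 + 4^-1 * v) * (y N * Num.sqrt m.+1%:R + 2 * d * m.+1%:R) + d =
     y N * ((1 + 4^-1 * v) * Num.sqrt m.+1%:R) +
      2 * d * m.+1%:R + (m.+1%:R * v) * d / 2 + d by field.
  rewrite E; lra.
have sq : \forall n \near \oo, y N * (Num.sqrt n.+1%:R / n.+1%:R) <= 2 * d.
  have /cvgr0Pnorm_le h : (y N * (Num.sqrt n.+1%:R / n.+1%:R)) @[n --> \oo] --> (0:R).
    rewrite -(mulr0 (y N)); apply: cvgM; [exact: cvg_cst|exact: cvg_sqrt_div].
  near=> n; apply: (le_trans (ler_norm _)); near: n; apply: h; lra.
near=> n.
have Nn : (N <= n)%N by near: n; exists N.
have := key (n - N)%N; rewrite subnKC// => kn.
rewrite sub0r normrN ger0_norm; last by rewrite divr_ge0.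
rewrite ler_pdivrMr//; apply: (le_trans kn).
have s1 : y N * (Num.sqrt n.+1%:R / n.+1%:R) <= 2 * d by near: n.
have m0 : 0 < n.+1%:R :> R by [].
move: s1; rewrite mulrA ler_pdivrMr// => s1.
have -> : e * n.+1%:R = 2 * d * n.+1%:R + 2 * d * n.+1%:R by rewrite /d; field.
by rewrite lerD.
Unshelve. all: by end_near. Qed.

(** If [x n] behaves like [l * (n + 1)], the recursion forces [l * (1 + g) = s].
The difference of the two satisfies the hypotheses of [recursion_small], because
[g >= 0] keeps the factors [c n] below [1 + 1 / (4 (n + 1))] from some rank on. *)
Lemma recursion_limit (c x b : nat -> R) (g s : R) :
  0 <= g ->
  (forall n, x n.+1 = c n * x n + b n) ->
  n.+1%:R * (1 - c n) @[n --> \oo] --> g ->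
  b n @[n --> \oo] --> s ->
  x n / n.+1%:R @[n --> \oo] --> s / (1 + g).
Proof.
move=> g0 xrec ccvg bcvg.
pose l := s / (1 + g).
pose y n : R := `|x n - n.+1%:R * l|.
have gl : l + g * l = s by rewrite /l; field; lra.
have yc : y n / n.+1%:R @[n --> \oo] --> (0 : R).
  apply: (@recursion_small (fun n => `|c n|) y
     (fun n => `|b n - l - n.+1%:R * (1 - c n) * l|)) => //.
  - by move=> n; rewrite /y.
  - move=> n; rewrite /y xrec -normrM.
    have -> : c n * x n + b n - n.+2%:R * l =
       c n * (x n - n.+1%:R * l) + (b n - l - n.+1%:R * (1 - c n) * l).
      rewrite (_ : n.+2%:R = n.+1%:R + 1 :> R); last by rewrite -natr1.
      ring.
    exact: ler_normD.
  - have h1 : \forall n \near \oo, - 4^-1 <= n.+1%:R * (1 - c n).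
      move/cvgrPdist_le : ccvg => /(_ 4^-1) h; near=> n.
      have : `|g - n.+1%:R * (1 - c n)| <= 4^-1 by near: n; apply: h.
      rewrite ler_norml => /andP[_]; lra.
    have h2 : \forall n \near \oo, 0 <= c n.
      have : (n.+1%:R^-1 * (n.+1%:R * (1 - c n))) @[n --> \oo] --> (0 : R).
        rewrite -(mul0r g); apply: cvgM => //; exact: cvg_invS.
      move/cvgr0Pnorm_le => /(_ 1 ltr01) h; near=> n.
      have : `|n.+1%:R^-1 * (n.+1%:R * (1 - c n))| <= 1 by near: n; apply: h.
      rewrite mulKf ?gt_eqF// ler_norml => /andP[_]; lra.
    near=> n.
    have c0 : 0 <= c n by near: n.
    have c1 : - 4^-1 <= n.+1%:R * (1 - c n) by near: n.
    rewrite ger0_norm//.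
    have m0 : 0 < n.+1%:R :> R by [].
    rewrite -lerBlDl.
    by rewrite ler_pdivlMr// -lerN2 -mulNr opprB mulrC.
  - rewrite -(@normr0 _ R); apply: cvg_norm.
    have -> : (0 : R) = s - l - g * l by rewrite -gl; ring.
    apply: cvgB; first by apply: cvgB => //; exact: cvg_cst.
    by apply: cvgM => //; exact: cvg_cst.
apply/cvgrPdist_le => e e0.
move/cvgr0Pnorm_le : yc => /(_ e e0); apply: filterS => n.
by rewrite normrM normr_id normfV -normf_div mulrBl [_ * l]mulrC mulfK// distrC.
Unshelve. all: by end_near. Qed.

End Recursions.

(** * Expectations under finitely supported laws *)

Section Expectation.
Variables (R : realType) (S : eqType).
Implicit Types (l : seq (R * S)) (F G : S -> R).

(** A finitely supported law is encoded as a list of pairs (mass, point).  The same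
point may occur in several pairs, so that the law of the next state of a Markov
chain is a mere concatenation. *)
Definition expect l F : R := \sum_(z <- l) z.1 * F z.2.

Definition is_pmf l : Prop :=
  (forall z, z \in l -> 0 <= z.1) /\ \sum_(z <- l) z.1 = 1.

(** Hypotheses about a Markov chain are only required at the points which it reaches
with positive probability. *)
Definition charged l (x : S) : Prop := exists2 p : R, 0 < p & (p, x) \in l.

Definition bind l (k : S -> seq (R * S)) : seq (R * S) :=
  flatten [seq [seq (z.1 * y.1, y.2) | y <- k z.2] | z <- l].

Lemma expectD l F G : expect l (fun x => F x + G x) = expect l F + expect l G.
Proof. by rewrite /expect -big_split; apply: eq_bigr => z _; rewrite mulrDr. Qed.

Lemma expectZ l c F : expect l (fun x => c * F x) = c * expect l F.
Proof. by rewrite /expect mulr_sumr; apply: eq_bigr => z _; rewrite mulrCA. Qed.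

Lemma expectN l F : expect l (fun x => - F x) = - expect l F.
Proof. by rewrite /expect -sumrN; apply: eq_bigr => z _; rewrite mulrN. Qed.

Lemma expectB l F G : expect l (fun x => F x - G x) = expect l F - expect l G.
Proof. by rewrite expectD expectN. Qed.

Lemma expect_sum (I : Type) (r : seq I) (P : pred I) l (F : I -> S -> R) :
  expect l (fun x => \sum_(i <- r | P i) F i x) =
  \sum_(i <- r | P i) expect l (F i).
Proof.
by rewrite /expect exchange_big/=; apply: eq_bigr => z _; rewrite mulr_sumr.
Qed.

Lemma expect_cst l c : is_pmf l -> expect l (fun=> c) = c.
Proof. by move=> [_ l1]; rewrite /expect -mulr_suml l1 mul1r. Qed.

Lemma expect_affine3 l c a1 a2 a3 F1 F2 F3 : is_pmf l ->
  expect l (fun x => c + (a1 * F1 x + (a2 * F2 x + a3 * F3 x))) =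
  c + (a1 * expect l F1 + (a2 * expect l F2 + a3 * expect l F3)).
Proof. by move=> lp; rewrite !expectD !expectZ expect_cst. Qed.

Lemma eq_expect l F G : F =1 G -> expect l F = expect l G.
Proof. by move=> FG; apply: eq_bigr => z _; rewrite FG. Qed.

Lemma expect_le l F G : is_pmf l -> (forall x, charged l x -> F x <= G x) ->
  expect l F <= expect l G.
Proof.
move=> [l0 _] FG; rewrite /expect big_seq [leRHS]big_seq.
apply: ler_sum => z zl; have := l0 _ zl; rewrite le_eqVlt => /predU1P[<-|z0].
  by rewrite !mul0r.
by rewrite ler_pM2l// FG//; exists z.1 => //; case: (z) zl.
Qed.

Lemma expect_eq l F G : is_pmf l -> (forall x, charged l x -> F x = G x) ->
  expect l F = expect l G.
Proof.
by move=> lp FG; apply/eqP; rewrite eq_le !expect_le// => x /FG ->.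
Qed.

Lemma expect_ge0 l F : is_pmf l -> (forall x, charged l x -> 0 <= F x) ->
  0 <= expect l F.
Proof. by move=> lp F0; rewrite -(expect_cst 0 lp); exact: expect_le. Qed.

Lemma expect_norm l F : is_pmf l -> `|expect l F| <= expect l (fun x => `|F x|).
Proof.
move=> lp; rewrite ler_norml -expectN !expect_le// => x _ /=.
  by rewrite ler_norm.
by rewrite lerNl -normrN ler_norm.
Qed.

Lemma expect_norm_le l F G : is_pmf l -> (forall x, charged l x -> `|F x| <= G x) ->
  `|expect l F| <= expect l G.
Proof. by move=> lp FG; apply: (le_trans (expect_norm _ lp)); exact: expect_le. Qed.

Lemma expect_bind l k F :
  expect (bind l k) F = expect l (fun x => expect (k x) F).
Proof.
rewrite /expect /bind big_flatten big_map; apply: eq_bigr => z _.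
by rewrite big_map mulr_sumr; apply: eq_bigr => y _; rewrite mulrA.
Qed.

Lemma charged_bind l k y : is_pmf l -> charged (bind l k) y ->
  exists2 x, charged l x & charged (k x) y.
Proof.
move=> [l0 _] [p p0 /flatten_mapP[[a x] axl /mapP[[b y'] byk [pE yE]]]].
have a0 := l0 _ axl; rewrite /= in a0 byk pE yE.
have ap : 0 < a.
  by rewrite lt_def a0 andbT; apply: contraTneq p0 => a00; rewrite pE a00 mul0r ltxx.
exists x; first by exists a.
by exists b; [move: p0; rewrite pE pmulr_rgt0|rewrite yE].
Qed.

Lemma pmf_bind l k : is_pmf l -> (forall x, charged l x -> is_pmf (k x)) ->
  is_pmf (bind l k).
Proof.
move=> lp kp; have [l0 l1] := lp; split.
  move=> _ /flatten_mapP[[a x] axl /mapP[[b y] byk ->]] /=.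
  have := l0 _ axl; rewrite le_eqVlt => /predU1P[/= <-|/= a0].
    by rewrite mul0r.
  rewrite mulr_ge0 ?(ltW a0)//.
  have [|h _] := kp x; first by exists a.
  exact: (h (b, y)).
have := expect_bind l k (fun=> 1).
rewrite {1}/expect; under eq_bigr do rewrite mulr1.
move=> ->; rewrite -[RHS](expect_cst 1 lp).
by apply: expect_eq => // x /kp xp; rewrite expect_cst.
Qed.

End Expectation.

(** * Linear and quadratic forms *)

Section Forms.
Variables (R : realType) (q : nat).
Implicit Types (s u : 'rV[R]_q) (G : 'M[R]_q).

Definition dot s u : R := \sum_i s 0 i * u 0 i.
Definition quad G s : R := (s *m G *m s^T) 0 0.
Definition norm1 s : R := \sum_i `|s 0 i|.
Definition norm2sq s : R := \sum_i s 0 i ^+ 2.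
Definition mxnorm1 G : R := \sum_i \sum_j `|G i j|.

Lemma norm1_ge0 s : 0 <= norm1 s. Proof. exact: sumr_ge0. Qed.

Lemma mxnorm1_ge0 G : 0 <= mxnorm1 G.
Proof. by apply: sumr_ge0 => i _; exact: sumr_ge0. Qed.

Lemma norm1_ge s i : `|s 0 i| <= norm1 s.
Proof. by rewrite /norm1 (bigD1 i)//= lerDl sumr_ge0. Qed.

Lemma mxnorm1_ge G i j : `|G i j| <= mxnorm1 G.
Proof.
rewrite /mxnorm1 (bigD1 i)//= (bigD1 j)//= -addrA lerDl addr_ge0 ?sumr_ge0// => k _.
exact: sumr_ge0.
Qed.

Lemma dotDl s u v : dot (s + u) v = dot s v + dot u v.
Proof. by rewrite /dot -big_split; apply: eq_bigr => i _; rewrite mxE mulrDl. Qed.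

Lemma dotBr s u v : dot s (u - v) = dot s u - dot s v.
Proof.
rewrite /dot -sumrB; apply: eq_bigr => i _.
by rewrite !mxE mulrBr.
Qed.

Lemma dotZl c s u : dot (c *: s) u = c * dot s u.
Proof. by rewrite /dot mulr_sumr; apply: eq_bigr => i _; rewrite mxE mulrA. Qed.

Lemma dot_le s u b : (forall i, `|u 0 i| <= b) -> `|dot s u| <= norm1 s * b.
Proof.
move=> ub; apply: (le_trans (ler_norm_sum _ _ _)); rewrite /norm1 mulr_suml.
by apply: ler_sum => i _; rewrite normrM ler_wpM2l.
Qed.

Lemma norm1_mulmx s G : norm1 (s *m G) <= norm1 s * mxnorm1 G.
Proof.
rewrite /norm1 /mxnorm1.
apply: (@le_trans _ _ (\sum_j \sum_i `|s 0 i| * `|G i j|)).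
  apply: ler_sum => j _; rewrite mxE; apply: (le_trans (ler_norm_sum _ _ _)).
  by apply: ler_sum => i _; rewrite normrM.
rewrite exchange_big/= mulr_suml; apply: ler_sum => i _.
rewrite -mulr_sumr ler_wpM2l// [leRHS](bigD1 i)//= lerDl sumr_ge0// => k _.
exact: sumr_ge0.
Qed.

Lemma quadE G s : quad G s = \sum_i \sum_j s 0 i * s 0 j * G i j.
Proof.
rewrite /quad mxE exchange_big/=; apply: eq_bigr => j _.
by rewrite !mxE mulr_suml; apply: eq_bigr => i _; rewrite mulrAC.
Qed.

Lemma quad_le G s : `|quad G s| <= norm1 s ^+ 2 * mxnorm1 G.
Proof.
rewrite quadE mulr_sumr; apply: (le_trans (ler_norm_sum _ _ _)).
apply: ler_sum => i _; rewrite mulr_sumr; apply: (le_trans (ler_norm_sum _ _ _)).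
apply: ler_sum => j _; rewrite !normrM ler_wpM2r// expr2.
by apply: ler_pM => //; exact: norm1_ge.
Qed.

(** The Cauchy-Schwarz inequality, from [2 * a * b <= a ^ 2 + b ^ 2] for all pairs of
coordinates. *)
Lemma norm1_sqr_le s : norm1 s ^+ 2 <= q%:R * norm2sq s.
Proof.
have -> : q%:R * norm2sq s =
    \sum_(i < q) \sum_(j < q) (s 0 i ^+ 2 + s 0 j ^+ 2) / 2.
  under eq_bigr do rewrite -mulr_suml big_split/= sumr_const card_ord.
  rewrite -mulr_suml big_split/= sumr_const card_ord sumrMnl -/(norm2sq s).
  by rewrite -[norm2sq s *+ q]mulr_natl; field.
rewrite expr2 {1}/norm1 mulr_suml; apply: ler_sum => i _.
rewrite /norm1 mulr_sumr; apply: ler_sum => j _.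
rewrite -(real_normK (num_real (s 0 i))) -(real_normK (num_real (s 0 j))).
have := sqr_ge0 (`|s 0 i| - `|s 0 j|); nra.
Qed.

Lemma dot_le_norm1 s u : `|dot s u| <= norm1 s * norm1 u.
Proof. by apply: dot_le => i; exact: norm1_ge. Qed.

Lemma quad_mulmx (M G : 'M[R]_q) s : quad (M *m G *m M^T) s = quad G (s *m M).
Proof. by rewrite /quad trmx_mul !mulmxA. Qed.

Lemma quadD (G H : 'M[R]_q) s : quad (G + H) s = quad G s + quad H s.
Proof. by rewrite /quad mulmxDr mulmxDl mxE. Qed.

Lemma quadZ c G s : quad G (c *: s) = c ^+ 2 * quad G s.
Proof. by rewrite /quad linearZ/= -!scalemxAl -scalemxAr !mxE mulrA. Qed.

End Forms.

(** * A central limit theorem for chains with triangular drift *)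

Section TriangularMarkov.
Variables (R : realType) (S : eqType) (q : nat).
Variables (law : nat -> seq (R * S)) (step : S -> seq (R * S)).
Variables (U : nat -> S -> 'rV[R]_q) (D Gam : 'M[R]_q) (K C : R).

Definition drift n x i := expect (step x) (fun y => U n.+1 y 0 i - U n x 0 i).

Hypotheses (K_ge0 : 0 <= K) (C_ge0 : 0 <= C).
Hypotheses (law0_pmf : is_pmf (law 0)) (lawS : forall n, law n.+1 = bind (law n) step).
Hypothesis step_pmf : forall n x, charged (law n) x -> is_pmf (step x).
Hypothesis D_trig : forall i j : 'I_q, (i < j)%N -> D i j = 0.
Hypothesis D_diag : forall i, D i i <= 0.
Hypothesis Gam_sym : Gam^T = Gam.
Hypothesis increment_bound : forall n x y i, charged (law n) x ->
  charged (step x) y -> `|U n.+1 y 0 i - U n x 0 i| <= K.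
Hypothesis drift_stable : forall n x i, charged (law n) x ->
  U n x 0 i * drift n x i <=
  C * `|U n x 0 i| * (1 + \sum_(j < q | (j < i)%N) `|U n x 0 j|) / n.+1%:R.
Hypothesis drift_linear : forall n x i, charged (law n) x ->
  `|drift n x i - (\sum_j D i j * U n x 0 j) / n.+1%:R| <=
  C * (n.+1%:R + norm2sq (U n x)) / n.+1%:R ^+ 2.
Hypothesis covariance_limit : forall n x i j, charged (law n) x ->
  `|expect (step x) (fun y => (U n.+1 y 0 i - U n x 0 i) * (U n.+1 y 0 j - U n x 0 j))
    - Gam i j| <= C * (1 + norm1 (U n x)) / n.+1%:R.

Lemma law_pmf n : is_pmf (law n).
Proof.
elim: n => [//|n IH]; rewrite lawS; apply: pmf_bind => //.
exact: step_pmf.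
Qed.

Let E n F := expect (law n) F.

Let ES n F : E n.+1 F = E n (fun x => expect (step x) F).
Proof. by rewrite /E lawS expect_bind. Qed.

Let nS0 (n : nat) : 0 < n.+1%:R :> R. Proof. by []. Qed.

(** Young's inequality with the weight that turns the cross terms of the second
moment recursion into at most half of the diagonal term. *)
Let young (u v : R) : 2 * C * `|u| * `|v| <=
  u ^+ 2 / (2 * q.+1%:R) + C ^+ 2 * (2 * q.+1%:R) * v ^+ 2.
Proof.
have := nS0 q; move: (q.+1%:R : R) => m m0.
rewrite -(real_normK (num_real u)) -(real_normK (num_real v)).
move: `|u| `|v| => a b.
have -> : a ^+ 2 / (2 * m) + C ^+ 2 * (2 * m) * b ^+ 2 =
  2 * C * a * b + (a - C * (2 * m) * b) ^+ 2 / (2 * m).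
  by field; lra.
by rewrite lerDl divr_ge0 ?sqr_ge0//; lra.
Qed.

(** Expanding the square, the cross term is controlled by [drift_stable], where the
other coordinates involved precede [i]; [young] splits it between the second
moment of coordinate [i], with the small factor [1 / (2 (n + 1))], and theirs. *)
Lemma second_moment_step (i : 'I_q) n :
  E n.+1 (fun x => U n.+1 x 0 i ^+ 2) <=
  (1 + 2^-1 / n.+1%:R) * E n (fun x => U n x 0 i ^+ 2) +
  (C ^+ 2 * (2 * q.+1%:R) *
    (1 + \sum_(j < q | (j < i)%N) E n (fun x => U n x 0 j ^+ 2))) / n.+1%:R + K ^+ 2.
Proof.
rewrite ES /E -expect_sum -[X in _ <= _ + _ * (X + _) / _ + _](expect_cst 1 (law_pmf n)).
rewrite -expectD -!expectZ.
rewrite [X in _ <= _ + X + _]mulrC -expectZ -expectD.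
rewrite -[X in _ <= _ + X](expect_cst (K ^+ 2) (law_pmf n)) -expectD.
apply: expect_le; first exact: law_pmf.
move=> x cx; have sp := step_pmf cx.
pose d y := U n.+1 y 0 i - U n x 0 i.
have -> : expect (step x) (fun y => U n.+1 y 0 i ^+ 2) =
  U n x 0 i ^+ 2 + 2 * U n x 0 i * drift n x i + expect (step x) (fun y => d y ^+ 2).
  rewrite -[X in X + _ + _](expect_cst _ sp) /drift -expectZ -!expectD.
  by apply: eq_expect => y; rewrite /d; ring.
have dK : expect (step x) (fun y => d y ^+ 2) <= K ^+ 2.
  rewrite -[leRHS](expect_cst _ sp); apply: expect_le => // y cy.
  rewrite -real_normK ?num_real// lerXn2r ?nnegrE//.
  exact: (increment_bound _ cx cy).
apply: lerD => //.
rewrite [X in _ <= X + _]mulrDl mul1r -addrA lerD2l.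
rewrite -mulrA; apply: (le_trans (ler_wpM2l _ (drift_stable i cx))) => //.
set u := U n x 0 i; set s1 := \sum_(j < q | _) `|_|; set s2 := \sum_(j < q | _) _ ^+ 2.
have -> : 2 * (C * `|u| * (1 + s1) / n.+1%:R) =
  n.+1%:R^-1 * (2 * C * `|u| + 2 * C * `|u| * s1) by ring.
have -> : 2^-1 / n.+1%:R * u ^+ 2 + n.+1%:R^-1 * (C ^+ 2 * (2 * q.+1%:R) * (1 + s2)) =
  n.+1%:R^-1 * (2^-1 * u ^+ 2 + C ^+ 2 * (2 * q.+1%:R) * (1 + s2)) by ring.
rewrite ler_wpM2l ?invr_ge0//.
have y1 := young u 1; rewrite normr1 mulr1 expr1n mulr1 in y1.
have y2 : 2 * C * `|u| * (\sum_(j < q | (j < i)%N) `|U n x 0 j|) <=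
  q%:R * (u ^+ 2 / (2 * q.+1%:R)) +
    C ^+ 2 * (2 * q.+1%:R) * \sum_(j < q | (j < i)%N) U n x 0 j ^+ 2.
  rewrite !mulr_sumr.
  apply: (@le_trans _ _ (\sum_(j < q | (j < i)%N) (u ^+ 2 / (2 * q.+1%:R) +
    C ^+ 2 * (2 * q.+1%:R) * U n x 0 j ^+ 2))).
    by apply: ler_sum => j _; exact: young.
  rewrite big_split/= lerD2r big_mkcond/=.
  apply: (@le_trans _ _ (\sum_(j < q) u ^+ 2 / (2 * q.+1%:R))).
    apply: ler_sum => j _; case: ifP => // _.
    by rewrite divr_ge0 ?sqr_ge0// mulr_ge0.
  by rewrite sumr_const card_ord -[leLHS]mulr_natl.
apply: (le_trans (lerD y1 y2)).
rewrite mulrDr mulr1 -/s2.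
have -> : 2^-1 * u ^+ 2 = u ^+ 2 / (2 * q.+1%:R) + q%:R * (u ^+ 2 / (2 * q.+1%:R)).
  have := nS0 q; rewrite -natr1 => m0; field; rewrite gt_eqF//; lra.
by rewrite addrACA.
Qed.

(** Induction on the coordinate: once the second moments of the previous coordinates
are known to be of order [n], the recursion of [second_moment_step] is a growth by
the factor [1 + 1 / (2 (n + 1))] with bounded forcing, which stays linear. *)
Lemma second_moment : exists2 M : R, 0 <= M &
  forall n i, E n (fun x => U n x 0 i ^+ 2) <= M * n.+1%:R.
Proof.
suff H : forall k, (k <= q)%N -> exists2 M : R, 0 <= M &
  forall n (i : 'I_q), (i < k)%N -> E n (fun x => U n x 0 i ^+ 2) <= M * n.+1%:R.
  have [M M0 HM] := H q (leqnn q).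
  by exists M => // n i; apply: HM.
elim => [_|k IH kq]; first by exists 0.
have [M M0 HM] := IH (ltnW kq).
pose i := Ordinal kq.
pose B := C ^+ 2 * (2 * q.+1%:R) * (1 + q%:R * M) + K ^+ 2.
have B0 : 0 <= B.
  by rewrite addr_ge0 ?sqr_ge0// mulr_ge0 ?mulr_ge0 ?sqr_ge0// addr_ge0 ?mulr_ge0.
(* With [B] bounding the forcing, the slope [2 * B] is the one at which growth by
   the factor [1 + 1 / (2 (n + 1))] with forcing [B] stays linear. *)
pose M' := M + (E 0 (fun x => U 0 x 0 i ^+ 2) + 2 * B).
have e0 : 0 <= E 0 (fun x => U 0 x 0 i ^+ 2).
  by apply: expect_ge0 => [|x _]; [exact: law_pmf|exact: sqr_ge0].
exists M' => [|n j]; first by rewrite /M' !addr_ge0// mulr_ge0.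
rewrite ltnS leq_eqVlt => /orP[/eqP jk|jk]; last first.
  by apply: (le_trans (HM n j jk)); rewrite ler_wpM2r// /M'; lra.
have {j jk} -> : j = i by apply: val_inj.
elim: n => [|n IHn]; first by rewrite /M'; lra.
apply: (le_trans (second_moment_step i n)).
have sM : \sum_(j < q | (j < i)%N) E n (fun x => U n x 0 j ^+ 2) <= q%:R * M * n.+1%:R.
  apply: (@le_trans _ _ (\sum_(j < q | (j < i)%N) M * n.+1%:R)).
    by apply: ler_sum => j ji; apply: HM.
  rewrite big_mkcond/=; apply: (@le_trans _ _ (\sum_(j < q) M * n.+1%:R)).
    by apply: ler_sum => j _; case: ifP => // _; rewrite mulr_ge0.
  by rewrite sumr_const card_ord -[leLHS]mulr_natl mulrA.
have BB : (C ^+ 2 * (2 * q.+1%:R) *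
    (1 + \sum_(j < q | (j < i)%N) E n (fun x => U n x 0 j ^+ 2))) / n.+1%:R + K ^+ 2
    <= B.
  rewrite /B lerD2r ler_pdivrMr// -[leRHS]mulrA ler_wpM2l ?mulr_ge0 ?sqr_ge0//.
  rewrite mulrDl mul1r; apply: lerD => //.
  by rewrite ler1n.
rewrite -addrA; apply: (le_trans (lerD (ler_wpM2l _ IHn) BB)).
  by rewrite addr_ge0// divr_ge0.
have -> : (1 + 2^-1 / n.+1%:R) * (M' * n.+1%:R) + B = M' * n.+1%:R + M' / 2 + B.
  by field; rewrite gt_eqF.
rewrite (_ : n.+2%:R = n.+1%:R + 1 :> R); last by rewrite -natr1.
by rewrite mulrDr mulr1 -addrA lerD2l /M'; lra.
Qed.

(** The characteristic function of the chain in real form: the phase [a] gives access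
to both its real and its imaginary part. *)
Definition phi n (s : 'rV[R]_q) (a : R) := E n (fun x => cos (dot s (U n x) + a)).
(** The linearized mean evolution over one step; it acts on the test vectors [s] from
the right. *)
Definition propagator (n : nat) : 'M[R]_q := 1%:M + n.+1%:R^-1 *: D.

Let Dm := mxnorm1 D.
Let Gm := mxnorm1 Gam.

Lemma dot_propagator n s u :
  dot (s *m propagator n) u = dot s u + dot (s *m D) u / n.+1%:R.
Proof.
by rewrite mulmxDr mulmx1 -scalemxAr dotDl dotZl mulrC.
Qed.

(** Second-order expansion of the cosine over one step of the chain: the conditional
mean of the increment replaces [s] by [s *m propagator n], and its conditional
covariance produces the factor [1 - quad Gam s / 2].  The five terms of the bound
come from the third-order remainder, the errors in the drift and in the covariance,
and the two places where the drift is replaced by a shift of the argument. *)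
Lemma cos_step n x (s : 'rV[R]_q) a : charged (law n) x ->
  `|expect (step x) (fun y => cos (dot s (U n.+1 y) + a)) -
    (1 - quad Gam s / 2) * cos (dot (s *m propagator n) (U n x) + a)| <=
  2 * (norm1 s * K) ^+ 3 + norm1 s * (C * (n.+1%:R + norm2sq (U n x)) / n.+1%:R ^+ 2) +
  norm1 s ^+ 2 * (C * (1 + norm1 (U n x)) / n.+1%:R) +
  2 * (norm1 s * Dm * norm1 (U n x) / n.+1%:R) ^+ 2 +
  norm1 s ^+ 2 * Gm * (norm1 s * Dm * norm1 (U n x) / n.+1%:R).
Proof.
move=> cx; have sp := step_pmf cx.
pose t := dot s (U n x) + a.
pose dl y := dot s (U n.+1 y - U n x).
pose m1 := expect (step x) dl; pose m2 := expect (step x) (fun y => dl y ^+ 2).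
pose be := dot (s *m D) (U n x) / n.+1%:R.
have T1 : `|expect (step x) (fun y => cos (dot s (U n.+1 y) + a)) -
  (cos t - m1 * sin t - m2 / 2 * cos t)| <= 2 * (norm1 s * K) ^+ 3.
  have -> : cos t - m1 * sin t - m2 / 2 * cos t =
    expect (step x) (fun y => cos t - dl y * sin t - dl y ^+ 2 / 2 * cos t).
    have -> : expect (step x) (fun y => cos t - dl y * sin t - dl y ^+ 2 / 2 * cos t) =
      expect (step x) (fun y => cos t + (- sin t * dl y + - (cos t / 2) * dl y ^+ 2)).
      by apply: eq_expect => y; ring.
    by rewrite !expectD !expectZ (expect_cst _ sp) -/m1 -/m2; ring.
  rewrite -expectB -[leRHS](expect_cst _ sp); apply: expect_norm_le => // y cy.
  have -> : dot s (U n.+1 y) + a = t + dl y by rewrite /t /dl dotBr; ring.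
  apply: (le_trans (cos_taylor2 _ _)); rewrite ler_wpM2l// lerXn2r ?nnegrE//.
    by rewrite mulr_ge0// norm1_ge0.
  apply: dot_le => i; rewrite !mxE; exact: (increment_bound i cx cy).
have R1 : `|m1 - be| <= norm1 s * (C * (n.+1%:R + norm2sq (U n x)) / n.+1%:R ^+ 2).
  have -> : m1 - be = dot s (\row_i (drift n x i - (\sum_j D i j * U n x 0 j) / n.+1%:R)).
    rewrite /m1 /be /dl /dot expect_sum mulr_suml.
    have -> : \sum_(i < q) (s *m D) 0 i * U n x 0 i / n.+1%:R =
      \sum_i s 0 i * ((\sum_j D i j * U n x 0 j) / n.+1%:R).
      under eq_bigr do rewrite mxE mulr_suml mulr_suml.
      rewrite exchange_big/=; apply: eq_bigr => i _.
      by rewrite mulr_suml mulr_sumr; apply: eq_bigr => j _; rewrite !mulrA.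
    rewrite -sumrB; apply: eq_bigr => i _; rewrite mxE mulrBr expectZ.
    by congr (_ * _ - _); apply: eq_expect => y; rewrite !mxE.
  by apply: dot_le => i; rewrite mxE; exact: drift_linear.
have R2 : `|m2 - quad Gam s| <= norm1 s ^+ 2 * (C * (1 + norm1 (U n x)) / n.+1%:R).
  have -> : m2 - quad Gam s = \sum_i \sum_j s 0 i * s 0 j *
     (expect (step x) (fun y => (U n.+1 y 0 i - U n x 0 i) * (U n.+1 y 0 j - U n x 0 j)) - Gam i j).
    rewrite quadE /m2.
    have -> : expect (step x) (fun y => dl y ^+ 2) = expect (step x) (fun y =>
       \sum_i \sum_j s 0 i * s 0 j *
        ((U n.+1 y 0 i - U n x 0 i) * (U n.+1 y 0 j - U n x 0 j))).
      apply: eq_expect => y; rewrite /dl /dot expr2 mulr_suml; apply: eq_bigr => i _.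
      rewrite mulr_sumr; apply: eq_bigr => j _; rewrite !mxE; ring.
    rewrite expect_sum -sumrB; apply: eq_bigr => i _.
    rewrite expect_sum -sumrB; apply: eq_bigr => j _.
    by rewrite mulrBr expectZ.
  apply: (le_trans (ler_norm_sum _ _ _)).
  rewrite expr2 {1 3}/norm1 -mulrA mulr_suml; apply: ler_sum => i _.
  apply: (le_trans (ler_norm_sum _ _ _)); rewrite mulr_suml mulr_sumr.
  apply: ler_sum => j _; rewrite !normrM -mulrA; do 2 rewrite ler_wpM2l//.
  exact: covariance_limit.
have B1 : `|be| <= norm1 s * Dm * norm1 (U n x) / n.+1%:R.
  rewrite /be normrM [`|_^-1|]ger0_norm ?invr_ge0// ler_wpM2r ?invr_ge0//.
  apply: (le_trans (dot_le_norm1 _ _)); rewrite ler_wpM2r ?norm1_ge0//.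
  exact: norm1_mulmx.
have -> : dot (s *m propagator n) (U n x) + a = t + be.
  by rewrite dot_propagator /t /be; ring.
set X := expect _ _ in T1 *.
have -> : X - (1 - quad Gam s / 2) * cos (t + be) =
  (X - (cos t - m1 * sin t - m2 / 2 * cos t)) +
  (- sin t) * (m1 - be) + (- (cos t / 2)) * (m2 - quad Gam s) +
  (- (cos (t + be) - cos t + be * sin t)) +
  quad Gam s / 2 * (cos (t + be) - cos t) by field.
have T2 : `|- (cos (t + be) - cos t + be * sin t)| <=
    2 * (norm1 s * Dm * norm1 (U n x) / n.+1%:R) ^+ 2.
  rewrite normrN (_ : cos (t + be) - cos t + be * sin t =
    cos t * (cos be - 1) - sin t * (sin be - be)); last by rewrite cosD; ring.
  apply: (@le_trans _ _ (be ^+ 2 + be ^+ 2)).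
    apply: (le_trans (ler_normB _ _)); rewrite !normrM lerD//.
      by rewrite (le_trans _ (cosB1_le_sqr be))// ler_piMl// cos_max.
    by rewrite (le_trans _ (sin_sub_le_sqr be))// ler_piMl// sin_max.
  rewrite (_ : be ^+ 2 + be ^+ 2 = 2 * be ^+ 2); last by ring.
  rewrite ler_wpM2l// -real_normK ?num_real//.
  by rewrite lerXn2r ?nnegrE// (le_trans _ B1).
have T3 : `|quad Gam s / 2 * (cos (t + be) - cos t)| <=
  norm1 s ^+ 2 * Gm * (norm1 s * Dm * norm1 (U n x) / n.+1%:R).
  rewrite normrM; apply: ler_pM => //.
    rewrite normrM [`|2^-1|]ger0_norm//.
    apply: (@le_trans _ _ `|quad Gam s|); last exact: quad_le.
    by rewrite ler_piMr// invf_le1// ler1n.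
  exact: le_trans (cos_lipschitz _ _) B1.
have T4 : `|- sin t * (m1 - be)| <= norm1 s * (C * (n.+1%:R + norm2sq (U n x)) / n.+1%:R ^+ 2).
  by rewrite normrM normrN (le_trans _ R1)// ler_piMl// sin_max.
have T5 : `|- (cos t / 2) * (m2 - quad Gam s)| <= norm1 s ^+ 2 * (C * (1 + norm1 (U n x)) / n.+1%:R).
  rewrite normrM normrN (le_trans _ R2)// ler_piMl// normrM [`|2^-1|]ger0_norm//.
  have := cos_max t; lra.
by do 4 (apply: (le_trans (ler_normD _ _)); apply: lerD => //).
Qed.

Let E_le n F G : (forall x, F x <= G x) -> E n F <= E n G.
Proof. by move=> FG; apply: expect_le => //; exact: law_pmf. Qed.

Lemma moment_sums : exists2 k : R, 0 <= k & forall n,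
  [/\ E n (fun x => norm2sq (U n x)) <= k * n.+1%:R,
      E n (fun x => norm1 (U n x) ^+ 2) <= k * n.+1%:R &
      E n (fun x => norm1 (U n x)) <= k * Num.sqrt n.+1%:R].
Proof.
have [M M0 HM] := second_moment.
pose k0 := q%:R * M; have k00 : 0 <= k0 by rewrite mulr_ge0.
pose k1 := q%:R * k0; have k10 : 0 <= k1 by rewrite mulr_ge0.
exists (k0 + k1 + 1) => [|n]; first by rewrite !addr_ge0.
have H0 : E n (fun x => norm2sq (U n x)) <= k0 * n.+1%:R.
  rewrite /norm2sq /E expect_sum.
  apply: (@le_trans _ _ (\sum_(i < q) M * n.+1%:R)).
    by apply: ler_sum => i _; exact: HM.
  by rewrite sumr_const card_ord -[leLHS]mulr_natl mulrA.
have H1 : E n (fun x => norm1 (U n x) ^+ 2) <= k1 * n.+1%:R.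
  apply: (@le_trans _ _ (E n (fun x => q%:R * norm2sq (U n x)))).
    by apply: E_le => x; exact: norm1_sqr_le.
  by rewrite /E expectZ -mulrA ler_wpM2l.
have m0 := nS0 n.
split.
- by apply: (le_trans H0); rewrite ler_wpM2r//; lra.
- by apply: (le_trans H1); rewrite ler_wpM2r//; lra.
pose r : R := Num.sqrt n.+1%:R.
have r0 : 0 < r by rewrite sqrtr_gt0.
have rr : r ^+ 2 = n.+1%:R by rewrite sqr_sqrtr.
apply: (@le_trans _ _ (E n (fun x => r^-1 * norm1 (U n x) ^+ 2 + r))).
  apply: E_le => x; rewrite -(ler_pM2l r0) mulrDr mulrA divff ?gt_eqF// mul1r.
  move: (norm1 _) => p; have := sqr_ge0 (p - r); have := sqr_ge0 (p + r); nra.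
rewrite /E expectD expectZ (expect_cst _ (law_pmf n)).
have : r^-1 * E n (fun x => norm1 (U n x) ^+ 2) <= k1 * r.
  by rewrite mulrC ler_pdivrMr// -mulrA -expr2 rr.
rewrite /E -/r => h.
have : 0 <= k0 * r by rewrite mulr_ge0// ltW.
lra.
Qed.

Let w (n : nat) : R := Num.sqrt n.+1%:R / n.+1%:R.

Let w_ge0 n : 0 <= w n. Proof. by rewrite divr_ge0 ?sqrtr_ge0. Qed.

Let invS_le_w n : n.+1%:R^-1 <= w n.
Proof.
rewrite /w ler_pdivlMr// mulVf ?gt_eqF//.
by rewrite -[leLHS]sqrtr1 ler_sqrt// ler1n.
Qed.

Let w_le1 n : w n <= 1.
Proof.
rewrite ler_pdivrMr// mul1r -{2}(sqr_sqrtr (ltW (nS0 n))) expr2.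
rewrite ler_peMr ?sqrtr_ge0//.
by rewrite -[leLHS]sqrtr1 ler_sqrt// ler1n.
Qed.

(** For [z] of order [n ^ (-1/2)] this is of order [n ^ (-3/2)], so that [n] such
errors still add up to a quantity that tends to zero. *)
Definition step_error (n : nat) (z : R) : R :=
  z ^+ 3 + w n * z ^+ 2 + z / n.+1%:R.

Lemma step_error_ge0 n z : 0 <= z -> 0 <= step_error n z.
Proof.
by move=> z0; rewrite !addr_ge0 ?exprn_ge0 ?mulr_ge0 ?exprn_ge0 ?invr_ge0.
Qed.

Lemma phi_step : exists2 A : R, 0 <= A & forall n s a,
  `|phi n.+1 s a - (1 - quad Gam s / 2) * phi n (s *m propagator n) a| <=
  A * step_error n (norm1 s).
Proof.
have [k k0 Hk] := moment_sums.
have D0 : 0 <= Dm by exact: mxnorm1_ge0.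
have G0 : 0 <= Gm by exact: mxnorm1_ge0.
have a1 : 0 <= 2 * K ^+ 3 by rewrite mulr_ge0// exprn_ge0.
have a2 : 0 <= C * (1 + k) by rewrite mulr_ge0// addr_ge0.
have a3 : 0 <= 2 * Dm ^+ 2 * k by rewrite mulr_ge0// mulr_ge0// exprn_ge0.
have a4 : 0 <= Gm * Dm * k by rewrite !mulr_ge0.
exists (2 * K ^+ 3 + C * (1 + k) + 2 * Dm ^+ 2 * k + Gm * Dm * k).
  by rewrite !addr_ge0.
move=> n s a; have [H1 H2 H3] := Hk n.
have m0 := nS0 n; set m := (n.+1%:R : R) in H1 H2 H3 m0 *.
pose v := m^-1; have v0 : 0 < v by rewrite invr_gt0.
have mv : m * v = 1 by rewrite divff// gt_eqF.
rewrite /phi ES /E -expectZ -expectB.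
set N := norm1 s; have N0 : 0 <= N by exact: norm1_ge0.
pose B1 x := norm1 (U n x); pose B2 x := norm2sq (U n x).
apply: (@le_trans _ _ (expect (law n) (fun x =>
    (2 * K ^+ 3 * N ^+ 3 + N * C * v + N ^+ 2 * C * v) +
    (N * C * v ^+ 2 * B2 x + ((N ^+ 2 * C * v + N ^+ 3 * Gm * Dm * v) * B1 x +
     2 * N ^+ 2 * Dm ^+ 2 * v ^+ 2 * B1 x ^+ 2))))).
  apply: expect_norm_le; first exact: law_pmf.
  move=> x cx; apply: (le_trans (cos_step s a cx)).
  rewrite le_eqVlt; apply/orP; left; apply/eqP.
  rewrite -/N -/(B1 x) -/(B2 x) -/m -exprVn -/v.
  have -> : C * (m + B2 x) * v ^+ 2 = C * ((m * v) * v + B2 x * v ^+ 2) by ring.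
  by rewrite mv; ring.
rewrite (expect_affine3 _ _ _ _ B2 B1 (fun x => B1 x ^+ 2) (law_pmf n)).
have wn0 := w_ge0 n; have wn1 := w_le1 n; have wnv := invS_le_w n.
have rw : Num.sqrt m * v = w n by [].
rewrite -/m -/v in wnv.
have Q2 : v * expect (law n) B2 <= k.
  by rewrite mulrC ler_pdivrMr.
have Q3 : v * expect (law n) (fun x => B1 x ^+ 2) <= k.
  by rewrite mulrC ler_pdivrMr.
have Q1 : v * expect (law n) B1 <= k * w n.
  by rewrite /w mulrC -/m mulrA ler_wpM2r// ltW.
have c1 : N * C * v + N * C * v ^+ 2 * expect (law n) B2 <= C * (1 + k) * (N * v).
  have -> : N * C * v + N * C * v ^+ 2 * expect (law n) B2 =
    C * (1 + v * expect (law n) B2) * (N * v) by ring.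
  by rewrite ler_wpM2r ?mulr_ge0// ?(ltW v0)// ler_wpM2l// lerD2l.
have c2 : N ^+ 2 * C * v + N ^+ 2 * C * v * expect (law n) B1 <= C * (1 + k) * (w n * N ^+ 2).
  have -> : N ^+ 2 * C * v + N ^+ 2 * C * v * expect (law n) B1 =
    C * (v + v * expect (law n) B1) * N ^+ 2 by ring.
  rewrite [leRHS]mulrA ler_wpM2r ?sqr_ge0// -mulrA ler_wpM2l// mulrDl mul1r lerD//.
have c3 : N ^+ 3 * Gm * Dm * v * expect (law n) B1 <= Gm * Dm * k * N ^+ 3.
  have -> : N ^+ 3 * Gm * Dm * v * expect (law n) B1 =
    Gm * Dm * (v * expect (law n) B1) * N ^+ 3 by ring.
  rewrite ler_wpM2r ?exprn_ge0// ler_wpM2l ?mulr_ge0//.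
  by apply: (le_trans Q1); rewrite ler_piMr.
have c4 : 2 * N ^+ 2 * Dm ^+ 2 * v ^+ 2 * expect (law n) (fun x => B1 x ^+ 2) <=
    2 * Dm ^+ 2 * k * (w n * N ^+ 2).
  have -> : 2 * N ^+ 2 * Dm ^+ 2 * v ^+ 2 * expect (law n) (fun x => B1 x ^+ 2) =
     2 * Dm ^+ 2 * (v * expect (law n) (fun x => B1 x ^+ 2)) * (v * N ^+ 2) by ring.
  have h0 : 0 <= v * expect (law n) (fun x => B1 x ^+ 2).
    rewrite mulr_ge0 ?(ltW v0)//; apply: expect_ge0 => [|x _]; last exact: sqr_ge0.
    exact: law_pmf.
  apply: ler_pM.
  - by rewrite mulr_ge0// mulr_ge0 ?sqr_ge0.
  - by rewrite mulr_ge0 ?sqr_ge0 ?(ltW v0).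
  - by rewrite ler_wpM2l// mulr_ge0 ?sqr_ge0.
  - by rewrite ler_wpM2r ?sqr_ge0.
rewrite /step_error -/m -/v.
have e1 : 0 <= N ^+ 3 by rewrite exprn_ge0.
have e2 : 0 <= w n * N ^+ 2 by rewrite mulr_ge0 ?sqr_ge0.
have e3 : 0 <= N * v by rewrite mulr_ge0 ?(ltW v0).
rewrite [(N ^+ 2 * C * v + N ^+ 3 * Gm * Dm * v) * _]mulrDl.
move: (expect (law n) B1) (expect (law n) B2) (expect (law n) (fun x => B1 x ^+ 2))
  c1 c2 c3 c4 => x1 x2 x3 c1 c2 c3 c4.
have f1 := mulr_ge0 a1 e2; have f2 := mulr_ge0 a1 e3.
have f3 := mulr_ge0 a2 e1.
have f5 := mulr_ge0 a3 e1; have f6 := mulr_ge0 a3 e3.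
have f7 := mulr_ge0 a4 e2; have f8 := mulr_ge0 a4 e3.
move: f1 f2 f3 f5 f6 f7 f8 c1 c2 c3 c4.
move: (2 * K ^+ 3) (C * (1 + k)) (2 * Dm ^+ 2 * k) (Gm * Dm * k) (N ^+ 3) (w n * N ^+ 2) (N * v) => z1 z2 z3 z4 y1 y2 y3.
lra.
Qed.

(** Along the chain [Gam] differs from a conditional matrix of second moments by an
error that vanishes on average. *)
Lemma quad_Gam_ge0 s : 0 <= quad Gam s.
Proof.
have [k k0 Hk] := moment_sums.
pose B := norm1 s ^+ 2 * C * (1 + k).
have B0 : 0 <= B by rewrite mulr_ge0 ?addr_ge0// mulr_ge0 ?sqr_ge0.
suff H n : - (B * w n) <= quad Gam s.
  apply: (@cvg_seq_le _ (fun n => - (B * w n)) (fun=> quad Gam s) 0 (quad Gam s)).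
  - rewrite -(@oppr0 R) -(mulr0 B); apply: cvgN; apply: cvgM; first exact: cvg_cst.
    exact: cvg_sqrt_div.
  - exact: cvg_cst.
  - exact: H.
have [_ _ H3] := Hk n.
have pmfn := law_pmf n.
rewrite -(expect_cst (quad Gam s) pmfn).
apply: (@le_trans _ _ (E n (fun x => - (norm1 s ^+ 2 * C / n.+1%:R) * (1 + norm1 (U n x))))).
  rewrite /E expectZ expectD (expect_cst _ pmfn) mulNr lerN2 /B /w.
  set X := expect _ _ in H3 *; set r := Num.sqrt _ in H3 *.
  have -> : norm1 s ^+ 2 * C / n.+1%:R * (1 + X) =
    norm1 s ^+ 2 * C * ((1 + X) / n.+1%:R) by ring.
  have -> : norm1 s ^+ 2 * C * (1 + k) * (r / n.+1%:R) =
    norm1 s ^+ 2 * C * ((1 + k) * r / n.+1%:R) by ring.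
  rewrite ler_wpM2l ?(mulr_ge0 (sqr_ge0 _))// ler_wpM2r ?invr_ge0//.
  rewrite mulrDl mul1r lerD//.
  by rewrite -[leLHS]sqrtr1 ler_sqrt// ler1n.
apply: expect_le => // x cx.
have sp := step_pmf cx.
pose cc i j := expect (step x) (fun y => (U n.+1 y 0 i - U n x 0 i) * (U n.+1 y 0 j - U n x 0 j)).
have h1 : 0 <= \sum_i \sum_j s 0 i * s 0 j * cc i j.
  have -> : \sum_i \sum_j s 0 i * s 0 j * cc i j =
    expect (step x) (fun y => (\sum_i s 0 i * (U n.+1 y 0 i - U n x 0 i)) ^+ 2).
    have -> : expect (step x) (fun y => (\sum_i s 0 i * (U n.+1 y 0 i - U n x 0 i)) ^+ 2) =
      expect (step x) (fun y => \sum_i \sum_j s 0 i * s 0 j *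
        ((U n.+1 y 0 i - U n x 0 i) * (U n.+1 y 0 j - U n x 0 j))).
      apply: eq_expect => y; rewrite expr2 mulr_suml; apply: eq_bigr => i _.
      rewrite mulr_sumr; apply: eq_bigr => j _; ring.
    rewrite expect_sum; apply: eq_bigr => i _.
    by rewrite expect_sum; apply: eq_bigr => j _; rewrite expectZ.
  by apply: expect_ge0 => // y _; exact: sqr_ge0.
rewrite quadE mulNr lerNl.
set z := _ * (1 + _); set g := \sum_i _.
suff h2 : \sum_i \sum_j s 0 i * s 0 j * cc i j - g <= z by lra.
rewrite /z /g; apply: (le_trans (ler_norm _)).
rewrite -sumrB; apply: (le_trans (ler_norm_sum _ _ _)).
rewrite expr2 -!mulrA {1}/norm1 mulr_suml; apply: ler_sum => i _.
rewrite -sumrB; apply: (le_trans (ler_norm_sum _ _ _)).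
rewrite [in leRHS]/norm1 mulr_suml mulr_sumr; apply: ler_sum => j _.
rewrite -mulrBr !normrM -mulrA; do 2 rewrite ler_wpM2l//.
by rewrite [_^-1 * _]mulrC mulrA; exact: covariance_limit.
Qed.

(** The covariance matrix of the linear recursion that multiplies by the propagator
and adds an independent noise of covariance [Gam]. *)
Fixpoint cov (n : nat) : 'M[R]_q :=
  if n is n'.+1 then propagator n' *m cov n' *m (propagator n')^T + Gam else 0.

Lemma quad_cov_ge0 n s : 0 <= quad (cov n) s.
Proof.
elim: n s => [|n IH] s /=; first by rewrite /quad mulmx0 mul0mx mxE.
by rewrite quadD quad_mulmx addr_ge0// quad_Gam_ge0.
Qed.

Lemma cov_sym n : (cov n)^T = cov n.
Proof.
elim: n => [|n IH] /=; first by rewrite trmx0.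
by rewrite linearD/= Gam_sym !trmx_mul trmxK IH mulmxA.
Qed.

(** The characteristic function, in the same real form as [phi], of the normal law of
covariance [cov n]. *)
Definition gauss n (s : 'rV[R]_q) a := cos a * expR (- (quad (cov n) s / 2)).

Lemma phi_le1 n s a : `|phi n s a| <= 1.
Proof.
have pmfn := law_pmf n.
rewrite /phi /E -(expect_cst 1 pmfn); apply: expect_norm_le => // x _.
exact: cos_max.
Qed.

Lemma gauss_le1 n s a : `|gauss n s a| <= 1.
Proof.
rewrite /gauss normrM [`|expR _|]ger0_norm ?expR_ge0//.
rewrite mulr_ile1// ?cos_max ?expR_ge0// -expR0 ler_expR oppr_le0.
by rewrite divr_ge0// quad_cov_ge0.
Qed.

(** [gauss] satisfies the recursion of [phi_step] with [exp (- x)] instead of [1 - x],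
where [x = quad Gam s / 2].  When [norm1 s > 1] the error term is at
least [2] and there is nothing to prove. *)
Lemma phi_gauss_step : exists2 A : R, 0 <= A & forall n s a,
  `|phi n.+1 s a - gauss n.+1 s a| <=
  `|phi n (s *m propagator n) a - gauss n (s *m propagator n) a| +
  A * step_error n (norm1 s).
Proof.
have [A A0 HA] := phi_step.
have G0 : 0 <= Gm by exact: mxnorm1_ge0.
exists (A + Gm ^+ 2 + 2) => [|n s a]; first by rewrite !addr_ge0 ?sqr_ge0.
have N0 : 0 <= norm1 s := norm1_ge0 s.
set e := step_error n (norm1 s); have e0 : 0 <= e by exact: step_error_ge0.
have e3 : norm1 s ^+ 3 <= e.
  rewrite /e /step_error -addrA lerDl addr_ge0 ?mulr_ge0 ?sqr_ge0 ?invr_ge0//.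
have [N1|N1] := leP (norm1 s) 1; last first.
  have h : 1 <= norm1 s ^+ 3 by rewrite exprn_ege1// ltW.
  have p1 := phi_le1 n.+1 s a; have p2 := gauss_le1 n.+1 s a.
  apply: (le_trans (ler_normB _ _)).
  have : 0 <= (A + Gm ^+ 2) * e := mulr_ge0 (addr_ge0 A0 (sqr_ge0 _)) e0.
  have := normr_ge0 (phi n (s *m propagator n) a - gauss n (s *m propagator n) a).
  nra.
set p' := phi n.+1 s a; set p := phi n _ a; set g := gauss n _ a.
have Gq := quad_Gam_ge0 s.
pose x := quad Gam s / 2; have x0 : 0 <= x by rewrite divr_ge0.
have gE : gauss n.+1 s a = expR (- x) * g.
  rewrite /g /gauss /= quadD quad_mulmx mulrCA -expRD.
  by congr (_ * expR _); rewrite /x; field.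
have x1 : expR (- x) <= 1 by rewrite -expR0 ler_expR oppr_le0.
rewrite gE.
have -> : p' - expR (- x) * g = (p' - (1 - x) * p) - (expR (- x) - (1 - x)) * p +
  expR (- x) * (p - g) by ring.
have t1 : `|p' - (1 - x) * p| <= A * e by exact: HA.
have t2 : `|(expR (- x) - (1 - x)) * p| <= Gm ^+ 2 * e.
  rewrite normrM; apply: (le_trans (ler_piMr (normr_ge0 _) (phi_le1 _ _ _))).
  apply: (le_trans (expRN_quadratic x0)).
  have xle : x <= norm1 s ^+ 2 * Gm.
    apply: (le_trans _ (quad_le Gam s)); rewrite ger0_norm// /x; lra.
  apply: (@le_trans _ _ ((norm1 s ^+ 2 * Gm) ^+ 2)).
    by rewrite lerXn2r ?nnegrE// mulr_ge0 ?sqr_ge0.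
  rewrite exprMn mulrC ler_wpM2l ?sqr_ge0//.
  apply: (le_trans _ e3); rewrite -exprM.
  by rewrite (exprSr (norm1 s) 3) ler_piMr// exprn_ge0.
have t3 : `|expR (- x) * (p - g)| <= `|p - g|.
  by rewrite normrM [`|expR _|]ger0_norm ?expR_ge0// ler_piMl.
apply: (le_trans (ler_normD _ _)); rewrite addrC; apply: lerD => //.
apply: (le_trans (ler_normB _ _)); apply: (le_trans (lerD t1 t2)).
by rewrite -mulrDl [leRHS]mulrDl lerDl mulr_ge0.
Qed.

Let cw : R := 1 + 20 * Dm.
Let cw_ge1 : 1 <= cw.
Proof. by rewrite lerDl mulr_ge0// mxnorm1_ge0. Qed.

(** Weighting the coordinates geometrically makes the off-diagonal part of the
triangular propagator as small as desired. *)
Definition wnorm (s : 'rV[R]_q) : R := \sum_(i < q) cw ^+ i * `|s 0 i|.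

Lemma wnorm_ge0 s : 0 <= wnorm s.
Proof.
apply: sumr_ge0 => i _; rewrite mulr_ge0// exprn_ge0//.
exact: le_trans cw_ge1.
Qed.

Lemma norm1_le_wnorm s : norm1 s <= wnorm s.
Proof. by apply: ler_sum => i _; rewrite ler_peMl// exprn_ege1. Qed.

Lemma wnormZ c s : wnorm (c *: s) = `|c| * wnorm s.
Proof.
rewrite /wnorm mulr_sumr; apply: eq_bigr => i _.
by rewrite mxE normrM mulrCA.
Qed.

(** A bound for the norm of [propagator n] relative to [wnorm].  Its first case, which
is the case of all large [n], is when the diagonal entries of the propagator are
between [-1] and [1].  The number [20] is large enough for the cube of the bound to
meet the requirement of [recursion_small]. *)
Definition propagator_bound (n : nat) : R :=
  (if Dm <= n.+1%:R then 1 else 1 + Dm) + 20^-1 / n.+1%:R.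

Lemma propagator_bound_ge0 n : 0 <= propagator_bound n.
Proof.
rewrite addr_ge0 ?divr_ge0//; case: ifP => // _.
by rewrite addr_ge0// mxnorm1_ge0.
Qed.

Lemma diag_propagator_le n (j : 'I_q) :
  `|1 + D j j / n.+1%:R| <= if Dm <= n.+1%:R then 1 else 1 + Dm.
Proof.
have m0 := nS0 n; have D0 := D_diag j.
have Dj : `|D j j| <= Dm by exact: mxnorm1_ge.
have dm : D j j / n.+1%:R <= 0 by rewrite pmulr_lle0// invr_gt0.
case: ifPn => [Dn|_].
  have : -1 <= D j j / n.+1%:R.
    rewrite ler_pdivlMr// mulN1r lerNl; apply: le_trans Dn.
    by apply: le_trans Dj; rewrite ler0_norm.
  move: dm; move: (D j j / _) => d d0 d1.
  by rewrite ler_norml; lra.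
apply: (le_trans (ler_normD _ _)); rewrite normr1 lerD2l.
apply: le_trans Dj; rewrite normrM ler_piMr// ger0_norm ?invr_ge0//.
by rewrite invf_le1// ler1n.
Qed.

(** The diagonal contracts because [D i i <= 0], and the weights reduce the
off-diagonal part by the factor [cw >= 20 * Dm]. *)
Lemma wnorm_propagator n s : wnorm (s *m propagator n) <= propagator_bound n * wnorm s.
Proof.
set l0 : R := if Dm <= n.+1%:R then 1 else 1 + Dm.
have m0 := nS0 n; have D0 : 0 <= Dm := mxnorm1_ge0 D.
have c0 : 0 < cw by exact: lt_le_trans cw_ge1.
have coord j : `|(s *m propagator n) 0 j| <=
    l0 * `|s 0 j| + n.+1%:R^-1 * \sum_(i < q | (j < i)%N) `|s 0 i| * `|D i j|.
  have -> : (s *m propagator n) 0 j = (1 + D j j / n.+1%:R) * s 0 j +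
      n.+1%:R^-1 * \sum_(i < q | (j < i)%N) s 0 i * D i j.
    rewrite mulmxDr mulmx1 -scalemxAr !mxE (bigD1 j)//=.
    rewrite (bigID (fun i : 'I_q => (j < i)%N))/= [X in _ + (_ + X)]big1 => [|i /andP[ij]].
      rewrite addr0 (eq_bigl (fun i : 'I_q => (j < i)%N)) => [|i].
        by ring.
      by apply: andb_idl => ji; rewrite -val_eqE/= neq_ltn ji orbT.
    rewrite -leqNgt => ij'; rewrite D_trig ?mulr0// ltn_neqAle ij' andbT.
    by rewrite val_eqE.
  apply: (le_trans (ler_normD _ _)); rewrite !normrM lerD//.
    by rewrite ler_wpM2r// diag_propagator_le.
  rewrite ger0_norm ?invr_ge0// ler_wpM2l ?invr_ge0//.
  by apply: (le_trans (ler_norm_sum _ _ _)); apply: ler_sum => i _; rewrite normrM.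
rewrite /propagator_bound -/l0 mulrDl {1 2}/wnorm.
apply: (@le_trans _ _ (\sum_(j < q) (l0 * (cw ^+ j * `|s 0 j|) + n.+1%:R^-1 *
   \sum_(i < q | (j < i)%N) cw ^+ j * (`|s 0 i| * `|D i j|)))).
  apply: ler_sum => j _; rewrite -mulr_sumr.
  have -> : l0 * (cw ^+ j * `|s 0 j|) + n.+1%:R^-1 * (cw ^+ j *
     \sum_(i < q | (j < i)%N) `|s 0 i| * `|D i j|) =
     cw ^+ j * (l0 * `|s 0 j| + n.+1%:R^-1 * \sum_(i < q | (j < i)%N) `|s 0 i| * `|D i j|).
    by ring.
  by rewrite ler_wpM2l// exprn_ge0// ltW.
rewrite big_split/= -mulr_sumr lerD2l -mulr_sumr mulrAC [leRHS]mulrC ler_wpM2l ?invr_ge0//.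
rewrite (exchange_big_dep xpredT)//= /wnorm mulr_sumr; apply: ler_sum => i _.
apply: (@le_trans _ _ (\sum_(j < q | (j < i)%N) (cw ^+ i / cw * `|s 0 i|) * `|D i j|)).
  apply: ler_sum => j ji; rewrite mulrA ler_wpM2r// ler_wpM2r//.
  by rewrite ler_pdivlMr// -exprSr ler_weXn2l.
rewrite -mulr_sumr.
have sD : \sum_(j < q | (j < i)%N) `|D i j| <= Dm.
  rewrite /Dm /mxnorm1 [leRHS](bigD1 i)//= ler_wpDr//.
    by apply: sumr_ge0 => k _; exact: sumr_ge0.
  by rewrite big_mkcond/=; apply: ler_sum => j _; case: ifP.
have w0 : 0 <= cw ^+ i * `|s 0 i| by rewrite mulr_ge0// exprn_ge0// ltW.
have -> : cw ^+ i / cw * `|s 0 i| * \sum_(j < q | (j < i)%N) `|D i j| =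
  (cw ^+ i * `|s 0 i|) * ((\sum_(j < q | (j < i)%N) `|D i j|) / cw) by ring.
rewrite [leRHS]mulrC ler_wpM2l// ler_pdivrMr// /cw; lra.
Qed.

Fixpoint affine_rec (x0 : R) (c b : nat -> R) (n : nat) : R :=
  if n is n'.+1 then c n' * affine_rec x0 c b n' + b n' else x0.

Lemma affine_rec_ge0 x0 c b n : 0 <= x0 -> (forall n, 0 <= c n) ->
  (forall n, 0 <= b n) -> 0 <= affine_rec x0 c b n.
Proof. by move=> x00 c0 b0; elim: n => //= n IH; rewrite addr_ge0// mulr_ge0. Qed.

(** [phi_gauss_step] iterated down to time [0].  The powers of [wnorm s] that make up
the local error are propagated separately, each by a power of
[propagator_bound]. *)
Lemma phi_gauss_bound : exists A B : R, [/\ 0 <= A, 0 <= B & forall n s a,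
  `|phi n s a - gauss n s a| <=
  affine_rec 0 (fun k => propagator_bound k ^+ 3) (fun=> A) n * wnorm s ^+ 3 +
  affine_rec 0 (fun k => propagator_bound k ^+ 2) (fun k => A * w k) n * wnorm s ^+ 2 +
  affine_rec B propagator_bound (fun k => A / k.+1%:R) n * wnorm s].
Proof.
have [A A0 HA] := phi_gauss_step.
exists A, (E 0 (fun x => norm1 (U 0 x))).
have B0 : 0 <= E 0 (fun x => norm1 (U 0 x)).
  by apply: expect_ge0 => [|x _]; [exact: law_pmf|exact: norm1_ge0].
split => //; elim => [|n IH] s a.
  rewrite /= !mul0r !add0r /gauss /= /quad mulmx0 mul0mx mxE mul0r oppr0 expR0 mulr1.
  rewrite /phi -[X in _ - X](expect_cst _ (law_pmf 0)) /E -expectB mulrC.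
  rewrite -expectZ; apply: expect_norm_le => [|x _]; first exact: law_pmf.
  have := cos_lipschitz a (dot s (U 0 x)); rewrite [a + _]addrC => cl.
  apply: (le_trans cl).
  apply: (le_trans (dot_le_norm1 _ _)).
  by rewrite ler_wpM2r ?norm1_ge0// norm1_le_wnorm.
apply: (le_trans (HA n s a)).
have g0 := propagator_bound_ge0 n; have w0 := wnorm_ge0 s.
apply: (le_trans (lerD (IH _ a) (lexx _))).
set r3 := affine_rec _ _ _; set r2 := affine_rec _ _ _; set r1 := affine_rec _ _ _.
have r30 : 0 <= r3 n by apply: affine_rec_ge0 => // k; rewrite exprn_ge0// propagator_bound_ge0.
have r20 : 0 <= r2 n.
  by apply: affine_rec_ge0 => // k; [exact/exprn_ge0/propagator_bound_ge0|exact: mulr_ge0].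
have r10 : 0 <= r1 n.
  by apply: affine_rec_ge0 => // k; rewrite ?propagator_bound_ge0// divr_ge0.
have sw := wnorm_propagator n s; have sw0 := wnorm_ge0 (s *m propagator n).
have gw0 : 0 <= propagator_bound n * wnorm s by rewrite mulr_ge0.
have p3 : wnorm (s *m propagator n) ^+ 3 <= (propagator_bound n * wnorm s) ^+ 3.
  by rewrite lerXn2r ?nnegrE.
have p2 : wnorm (s *m propagator n) ^+ 2 <= (propagator_bound n * wnorm s) ^+ 2.
  by rewrite lerXn2r ?nnegrE.
have er : A * step_error n (norm1 s) <= A * step_error n (wnorm s).
  rewrite ler_wpM2l// /step_error !lerD//.
  - by rewrite lerXn2r ?nnegrE ?norm1_ge0// norm1_le_wnorm.
  - by rewrite ler_wpM2l// lerXn2r ?nnegrE ?norm1_ge0// norm1_le_wnorm.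
  - by rewrite ler_wpM2r ?invr_ge0// norm1_le_wnorm.
apply: (le_trans (lerD (lerD (lerD (ler_wpM2l r30 p3) (ler_wpM2l r20 p2)) (ler_wpM2l r10 sw)) er)).
rewrite -/(r3 n) -/(r2 n) -/(r1 n) /step_error le_eqVlt; apply/orP; left; apply/eqP.
have -> : r3 n.+1 = propagator_bound n ^+ 3 * r3 n + A by [].
have -> : r2 n.+1 = propagator_bound n ^+ 2 * r2 n + A * w n by [].
have -> : r1 n.+1 = propagator_bound n * r1 n + A / n.+1%:R by [].
ring.
Qed.

Let v (n : nat) : R := n.+1%:R^-1.
Let v_ge0 n : 0 <= v n. Proof. by rewrite invr_ge0. Qed.
Let v_le1 n : v n <= 1. Proof. by rewrite invf_le1// ler1n. Qed.
Let cvg_v : v n @[n --> \oo] --> (0 : R). Proof. exact: cvg_invS. Qed.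

Let propagator_bound_le n : propagator_bound n <= 2 + Dm.
Proof.
have D0 : 0 <= Dm := mxnorm1_ge0 D.
rewrite /propagator_bound -/(v n); have := v_le1 n; have := v_ge0 n; case: ifP => _; lra.
Qed.

Let propagator_bound_near : \forall n \near \oo, propagator_bound n = 1 + 20^-1 * v n.
Proof.
have : \forall n \near \oo, Dm <= n.+1%:R.
  have [N HN] : exists N : nat, Dm <= N%:R.
    by exists (Num.bound Dm); exact/ltW/archi_boundP/mxnorm1_ge0.
  exists N => // n /= Nn; apply: (le_trans HN).
  by rewrite ler_nat (leq_trans Nn).
by apply: filterS => n Dn; rewrite /propagator_bound Dn.
Qed.

Let r3 := affine_rec 0 (fun k => propagator_bound k ^+ 3).
Let r2 := affine_rec 0 (fun k => propagator_bound k ^+ 2).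
Let r1 B := affine_rec B propagator_bound.

Lemma cvg_quadratic_error A : 0 <= A ->
  r2 (fun k => A * w k) n / n.+1%:R @[n --> \oo] --> (0 : R).
Proof.
move=> A0; apply: (@recursion_small _ (fun k => propagator_bound k ^+ 2) _ (fun k => A * w k)).
- move=> n; apply: affine_rec_ge0 => // k; first exact/exprn_ge0/propagator_bound_ge0.
  exact: mulr_ge0.
- by move=> n; exact/exprn_ge0/propagator_bound_ge0.
- by move=> n /=.
- apply: filterS propagator_bound_near => n ->; rewrite -/(v n).
  have := v_le1 n; have := v_ge0 n; nra.
- rewrite -(mulr0 A); apply: cvgM; [exact: cvg_cst|exact: cvg_sqrt_div].
Qed.

(** Dividing by [sqrt (n + 1)] beforehand turns the constant forcing into one that
tends to zero. *)
Lemma cvg_cubic_error A : 0 <= A ->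
  r3 (fun=> A) n / Num.sqrt n.+1%:R / n.+1%:R @[n --> \oo] --> (0 : R).
Proof.
move=> A0.
have r30 n : 0 <= r3 (fun=> A) n.
  by apply: affine_rec_ge0 => // k; exact/exprn_ge0/propagator_bound_ge0.
apply: (@recursion_small _ (fun k => propagator_bound k ^+ 3)
  (fun n => r3 (fun=> A) n / Num.sqrt n.+1%:R) (fun k => A * Num.sqrt (v k.+1))).
- by move=> n; rewrite divr_ge0 ?sqrtr_ge0.
- by move=> n; exact/exprn_ge0/propagator_bound_ge0.
- move=> n /=; rewrite mulrDl; apply: lerD; last by rewrite /v sqrtrV.
  rewrite -mulrA ler_wpM2l ?exprn_ge0 ?propagator_bound_ge0// ler_wpM2l//.
  by rewrite lef_pV2 ?posrE ?sqrtr_gt0// ler_sqrt// ler_nat.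
- apply: filterS propagator_bound_near => n ->; rewrite -/(v n).
  have v1 := v_le1 n; have v0 := v_ge0 n.
  have v2 : v n ^+ 2 <= v n by rewrite expr2 ler_piMr.
  have v3 : v n ^+ 3 <= v n by rewrite exprSr ler_piMl// exprn_ile1.
  have -> : (1 + 20^-1 * v n) ^+ 3 =
    1 + 3 / 20 * v n + 3 / 400 * v n ^+ 2 + v n ^+ 3 / 8000 by field.
  lra.
- rewrite -(mulr0 A); apply: cvgM; first exact: cvg_cst.
  rewrite -(@sqrtr0 R); apply: continuous_cvg; first exact: sqrt_continuous.
  by rewrite (cvg_shiftS v).
Qed.

(** The square of the sequence satisfies a recursion normalized by [n + 1]; its cross
term is absorbed by [2 * x * y <= x ^ 2 / 20 + 20 * y ^ 2]. *)
Lemma cvg_linear_error A B : 0 <= A -> 0 <= B ->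
  r1 B (fun k => A / k.+1%:R) n / Num.sqrt n.+1%:R @[n --> \oo] --> (0 : R).
Proof.
move=> A0 B0; set r := r1 B _.
have r0 n : 0 <= r n.
  by apply: affine_rec_ge0 => // k; [exact: propagator_bound_ge0|rewrite divr_ge0].
have h : r n ^+ 2 / n.+1%:R @[n --> \oo] --> (0 : R).
  pose G := 2 + Dm.
  apply: (@recursion_small _ (fun k => propagator_bound k ^+ 2 + 20^-1 * v k)
    (fun n => r n ^+ 2) (fun k => (A ^+ 2 + 20 * A ^+ 2 * G ^+ 2) * v k)).
  - by move=> n; exact: sqr_ge0.
  - by move=> n; rewrite addr_ge0 ?sqr_ge0// mulr_ge0.
  - move=> n; rewrite [r n.+1]/= -/(r n) -/(v n).
    have g0 := propagator_bound_ge0 n; have gG : propagator_bound n <= G := propagator_bound_le n.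
    have v0 := v_ge0 n; have v1 := v_le1 n.
    have e1 : (A * v n) ^+ 2 <= A ^+ 2 * v n.
      by rewrite exprMn ler_wpM2l ?sqr_ge0// expr2 ler_piMr.
    have e2 : 2 * (propagator_bound n * r n) * A <= 20^-1 * r n ^+ 2 + 20 * A ^+ 2 * G ^+ 2.
      apply: (@le_trans _ _ (20^-1 * r n ^+ 2 + 20 * A ^+ 2 * propagator_bound n ^+ 2)).
        have := sqr_ge0 (r n - 20 * propagator_bound n * A); lra.
      rewrite lerD2l ler_wpM2l ?mulr_ge0 ?sqr_ge0// lerXn2r ?nnegrE//.
      exact: le_trans gG.
    have := ler_wpM2r v0 e2.
    rewrite (_ : (propagator_bound n * r n + A * v n) ^+ 2 = propagator_bound n ^+ 2 * r n ^+ 2 +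
       2 * (propagator_bound n * r n) * A * v n + (A * v n) ^+ 2); last by ring.
    lra.
  - apply: filterS propagator_bound_near => n ->; rewrite -/(v n).
    have := v_le1 n; have := v_ge0 n; nra.
  - rewrite -(mulr0 (A ^+ 2 + 20 * A ^+ 2 * G ^+ 2)).
    by apply: cvgM => //; exact: cvg_cst.
have -> : (fun n => r n / Num.sqrt n.+1%:R) = (fun n => Num.sqrt (r n ^+ 2 / n.+1%:R)).
  by apply/funext => n; rewrite sqrtrM ?sqr_ge0// sqrtr_sqr ger0_norm// sqrtrV.
rewrite -(@sqrtr0 R); apply: continuous_cvg => //; exact: sqrt_continuous.
Qed.

(** Induction on [i + j].  As [D] is triangular, entry [(i, j)] satisfies a scalar
recursion forced by the entries [(x, y)] other than [(i, j)] with [x <= i] and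
[y <= j], to which [recursion_limit] applies with [g = - (D i i + D j j)]. *)
Lemma is_cvg_cov (i j : 'I_q) : cvg (cov n i j / n.+1%:R @[n --> \oo]).
Proof.
move: {2}(i + j).+1 (ltnSn (i + j)) => k; elim: k i j => // k IH i j ijk.
pose P n (a b : 'I_q) := propagator n a b.
have PE n a b : P n a b = (a == b)%:R + v n * D a b by rewrite /P /propagator !mxE.
have Pc a b : P n a b @[n --> \oo] --> ((a == b)%:R : R).
  rewrite -[X in _ --> X]addr0 -(mul0r (D a b)).
  under eq_fun do rewrite PE.
  apply: cvgD; first exact: cvg_cst.
  by apply: cvgM => //; exact: cvg_cst.
have P0 n (a b : 'I_q) : (a < b)%N -> P n a b = 0.
  move=> ab; rewrite PE D_trig// mulr0 addr0.
  by rewrite -val_eqE/= (ltn_eqF ab).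
pose T (z : 'I_q * 'I_q) n := P n i z.1 * cov n z.1 z.2 * P n j z.2.
pose b n := \sum_(z | z != (i, j)) T z n + Gam i j.
have step_cov n : cov n.+1 i j = P n i i * P n j j * cov n i j + b n.
  rewrite /= mxE addrA; congr (_ + _); rewrite mxE.
  transitivity (\sum_z T z n).
    rewrite -(pair_bigA _ (fun x y => T (x, y) n))/= exchange_big/=.
    by apply: eq_bigr => y _; rewrite mxE mulr_suml; apply: eq_bigr => x _; rewrite /T/= [_^T _ _]mxE.
  by rewrite (bigD1 (i, j))//= /T /=; congr (_ + _); ring.
have bc : cvg (b n @[n --> \oo]).
  apply: is_cvgD; last exact: is_cvg_cst.
  apply: is_cvg_sum_seq => -[x y] /= xy.
  have zero : (forall n, T (x, y) n = 0) -> cvg (T (x, y) n @[n --> \oo]).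
    by move=> T0; under eq_fun do rewrite T0; exact: is_cvg_cst.
  have [ix|xi] := ltnP i x; first by apply: zero => n; rewrite /T /= P0// !mul0r.
  have [jy|yj] := ltnP j y; first by apply: zero => n; rewrite /T /= (P0 _ j)// mulr0.
  have xyk : (x + y < k)%N.
    rewrite ltnS in ijk; apply: leq_trans ijk.
    move: xy; rewrite xpair_eqE negb_and => /orP[nx|ny].
      by rewrite -addSn leq_add// ltn_neqAle xi andbT.
    by rewrite -addnS leq_add// ltn_neqAle yj andbT.
  have c1 := IH _ _ xyk.
  have Pv (a c : 'I_q) : a != c -> forall n, P n a c = D a c * v n.
    by move=> /negbTE ac n; rewrite PE ac add0r mulrC.
  have [nx|ex] := boolP (x != i).
    have -> : T (x, y) = (fun n => D i x * (cov n x y / n.+1%:R) * P n j y).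
      apply/funext => n; rewrite /T /= Pv 1?eq_sym// -/(v n); ring.
    apply: is_cvgM; last exact: cvgP (Pc _ _).
    by apply: is_cvgM => //; exact: is_cvg_cst.
  have ny : j != y.
    by move: xy; move/negPn/eqP: ex => ->; rewrite xpair_eqE eqxx/= eq_sym.
  have -> : T (x, y) = (fun n => P n i x * (cov n x y / n.+1%:R) * D j y).
    apply/funext => n; rewrite /T /= (Pv j)// -/(v n); ring.
  apply: is_cvgM; last exact: is_cvg_cst.
  by apply: is_cvgM => //; exact: cvgP (Pc _ _).
apply: (cvgP (lim (b n @[n --> \oo]) / (1 + - (D i i + D j j)))).
apply: (@recursion_limit _ (fun n => P n i i * P n j j) (fun n => cov n i j) b) => //.
  by rewrite oppr_ge0; have := D_diag i; have := D_diag j; lra.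
have -> : (fun n => n.+1%:R * (1 - P n i i * P n j j)) =
  (fun n => - (D i i + D j j) - v n * (D i i * D j j)).
  apply/funext => n; rewrite !PE !eqxx mulr1n /v; field.
  by rewrite gt_eqF.
rewrite -[X in _ --> X]subr0 -(mul0r (D i i * D j j)).
apply: cvgB; first exact: cvg_cst.
by apply: cvgM => //; exact: cvg_cst.
Qed.

Lemma cvg_quad_cov : exists Sigma : 'M[R]_q, [/\ Sigma^T = Sigma,
  forall s, 0 <= quad Sigma s &
  forall s, quad (cov n) s / n.+1%:R @[n --> \oo] --> quad Sigma s].
Proof.
pose Sigma : 'M[R]_q := \matrix_(i, j) lim (cov n i j / n.+1%:R @[n --> \oo]).
have cvgS s : quad (cov n) s / n.+1%:R @[n --> \oo] --> quad Sigma s.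
  have -> : (fun n => quad (cov n) s / n.+1%:R) =
    (fun n => \sum_i \sum_j s 0 i * s 0 j * (cov n i j / n.+1%:R)).
    apply/funext => n; rewrite quadE mulr_suml; apply: eq_bigr => i _.
    by rewrite mulr_suml; apply: eq_bigr => j _; rewrite mulrA.
  rewrite quadE; apply: cvg_big => [|i _]; first exact: add_continuous.
  apply: cvg_big => [|j _]; first exact: add_continuous.
  apply: cvgM; first exact: cvg_cst.
  by rewrite mxE; exact: is_cvg_cov.
exists Sigma; split => //.
  apply/matrixP => i j; rewrite !mxE; congr (lim _).
  by under eq_fun do rewrite -cov_sym mxE.
move=> s; apply: (@cvg_seq_le _ (fun=> 0) (fun n => quad (cov n) s / n.+1%:R)) => //.
  exact: cvg_cst.
by move=> n; rewrite divr_ge0// quad_cov_ge0.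
Qed.

(** At [s / sqrt (n + 1)] the bound of [phi_gauss_bound] tends to zero, and [gauss]
converges because [cov n / (n + 1)] does. *)
Lemma triangular_clt : exists Sigma : 'M[R]_q, [/\ Sigma^T = Sigma,
  forall s, 0 <= quad Sigma s &
  forall s a, expect (law n) (fun x => cos (dot s (U n x) / Num.sqrt n.+1%:R + a))
    @[n --> \oo] --> cos a * expR (- (quad Sigma s / 2))].
Proof.
have [Sigma [Ssym Spos Scvg]] := cvg_quad_cov.
exists Sigma; split => // s a.
have [A [B [A0 B0 HAB]]] := phi_gauss_bound.
pose sn n := (Num.sqrt (n.+1%:R : R))^-1 *: s.
have phiE n : expect (law n) (fun x => cos (dot s (U n x) / Num.sqrt n.+1%:R + a)) =
    phi n (sn n) a.
  by apply: eq_expect => x; rewrite dotZl mulrC.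
under eq_fun do rewrite phiE.
have gc : gauss n (sn n) a @[n --> \oo] --> cos a * expR (- (quad Sigma s / 2)).
  apply: cvgM; first exact: cvg_cst.
  apply: continuous_cvg; first exact: continuous_expR.
  apply: cvgN; apply: cvgM; last exact: cvg_cst.
  have -> : (fun n => quad (cov n) (sn n)) = (fun n => quad (cov n) s / n.+1%:R) => //.
  by apply/funext => n; rewrite quadZ exprVn sqr_sqrtr// mulrC.
suff dc : phi n (sn n) a - gauss n (sn n) a @[n --> \oo] --> (0 : R).
  have h := cvgD dc gc; rewrite add0r in h.
  apply: cvg_trans; last exact: h.
  by apply: near_eq_cvg; apply: nearW => n; rewrite /= subrK.
apply/norm_cvg0P.
pose W := wnorm s.
apply: (@squeeze_cvgr _ _ _ _ (fun=> 0) (fun n =>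
  W ^+ 3 * (r3 (fun=> A) n / Num.sqrt n.+1%:R / n.+1%:R) +
  W ^+ 2 * (r2 (fun k => A * w k) n / n.+1%:R) +
  W * (r1 B (fun k => A / k.+1%:R) n / Num.sqrt n.+1%:R))).
- apply: nearW => n; rewrite normr_ge0/=; apply: (le_trans (HAB _ _ _)).
  have m0 := nS0 n; have s0 : 0 < Num.sqrt n.+1%:R :> R by rewrite sqrtr_gt0.
  rewrite wnormZ -/W ger0_norm ?invr_ge0 ?sqrtr_ge0//.
  rewrite -/r3 -/r2 -/(r1 B).
  have E1 : (Num.sqrt n.+1%:R)^-1 ^+ 2 = n.+1%:R^-1 :> R by rewrite exprVn sqr_sqrtr.
  rewrite !exprMn [_ ^-1 ^+ 3]exprS E1 le_eqVlt; apply/orP; left; apply/eqP.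
  ring.
- exact: cvg_cst.
- rewrite -[X in _ --> X]addr0 -[X in _ --> X + _]addr0.
  rewrite -[X in _ --> X + _ + _](mulr0 (W ^+ 3)).
  rewrite -[X in _ --> _ + X + _](mulr0 (W ^+ 2)) -[X in _ --> _ + _ + X](mulr0 W).
  apply: cvgD; first apply: cvgD.
  + by apply: cvgM; [exact: cvg_cst|exact: cvg_cubic_error].
  + by apply: cvgM; [exact: cvg_cst|exact: cvg_quadratic_error].
  + by apply: cvgM; [exact: cvg_cst|exact: cvg_linear_error].
Qed.
End TriangularMarkov.

(** * Means of bounded measurable functions *)

Section BoundedMean.
Context d (Om : measurableType d) (R : realType).
Implicit Types (Q : probability Om R) (f g : Om -> R).

Definition bounded_measurable f :=
  measurable_fun [set: Om] f /\ exists M : R, forall w, `|f w| <= M.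

Definition mean Q f : R := \int[Q]_w f w.

Lemma bounded_measurable_integrable Q f : bounded_measurable f ->
  Q.-integrable [set: Om] (EFin \o f).
Proof.
move=> [mf [M fM]]; apply: measurable_bounded_integrable => //.
  by rewrite [X in (X < _)%E](_ : _ = 1%E) ?ltry//; exact: probability_setT.
exists M; split; first exact: num_real.
by move=> x Mx w _; exact: le_trans (fM w) (ltW Mx).
Qed.

Lemma integral_mean Q f : bounded_measurable f ->
  (\int[Q]_w (f w)%:E = (mean Q f)%:E)%E.
Proof.
move=> bf; rewrite /mean /Rintegral fineK//.
apply: integrable_fin_num => //; exact: bounded_measurable_integrable.
Qed.

Lemma bounded_measurable_cst c : bounded_measurable (fun=> c).
Proof. by split => //; exists `|c|. Qed.

Lemma bounded_measurableD f g : bounded_measurable f -> bounded_measurable g ->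
  bounded_measurable (fun w => f w + g w).
Proof.
move=> [mf [M fM]] [mg [N gN]]; split; first exact: measurable_funD.
by exists (M + N) => w; apply: (le_trans (ler_normD _ _)); rewrite lerD.
Qed.

Lemma bounded_measurableM f g : bounded_measurable f -> bounded_measurable g ->
  bounded_measurable (fun w => f w * g w).
Proof.
move=> [mf [M fM]] [mg [N gN]]; split; first exact: measurable_funM.
exists (`|M| * `|N|) => w; rewrite normrM ler_pM//.
  exact: le_trans (fM w) (ler_norm _).
exact: le_trans (gN w) (ler_norm _).
Qed.

Lemma bounded_measurableZ c f : bounded_measurable f ->
  bounded_measurable (fun w => c * f w).
Proof. by move=> bf; apply: bounded_measurableM => //; exact: bounded_measurable_cst. Qed.

Lemma bounded_measurable_sum (I : Type) (r : seq I) (F : I -> Om -> R) :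
  (forall i, bounded_measurable (F i)) ->
  bounded_measurable (fun w => \sum_(i <- r) F i w).
Proof.
move=> bF; elim: r => [|i r IH].
  by under eq_fun do rewrite big_nil; exact: bounded_measurable_cst.
by under eq_fun do rewrite big_cons; exact: bounded_measurableD.
Qed.

Lemma mean_cst Q c : mean Q (fun=> c) = c.
Proof.
rewrite /mean Rintegral_cst//.
by rewrite [X in fine X](_ : _ = 1%E) ?mulr1//; exact: probability_setT.
Qed.

Lemma meanD Q f g : bounded_measurable f -> bounded_measurable g ->
  mean Q (fun w => f w + g w) = mean Q f + mean Q g.
Proof. by move=> bf bg; apply: RintegralD => //; exact: bounded_measurable_integrable. Qed.

Lemma meanZ Q c f : bounded_measurable f ->
  mean Q (fun w => c * f w) = c * mean Q f.
Proof. by move=> bf; apply: RintegralZl => //; exact: bounded_measurable_integrable. Qed.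

Lemma mean_sum Q (I : Type) (r : seq I) (F : I -> Om -> R) :
  (forall i, bounded_measurable (F i)) ->
  mean Q (fun w => \sum_(i <- r) F i w) = \sum_(i <- r) mean Q (F i).
Proof.
move=> bF; elim: r => [|i r IH].
  by under [X in mean _ X]eq_fun do rewrite big_nil; rewrite big_nil mean_cst.
under [X in mean _ X]eq_fun do rewrite big_cons.
by rewrite big_cons meanD// ?IH//; exact: bounded_measurable_sum.
Qed.

Lemma mean_le Q f g : bounded_measurable f -> bounded_measurable g ->
  (forall w, f w <= g w) -> mean Q f <= mean Q g.
Proof.
by move=> bf bg fg; apply: le_Rintegral => //; exact: bounded_measurable_integrable.
Qed.

Lemma mean_norm_le Q f g : bounded_measurable f -> bounded_measurable g ->
  (forall w, `|f w| <= g w) -> `|mean Q f| <= mean Q g.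
Proof.
move=> bf bg fg; rewrite ler_norml -[- mean Q g]mulN1r -meanZ//.
apply/andP; split; apply: mean_le => //.
- exact: bounded_measurableZ.
- by move=> w; rewrite mulN1r; have := fg w; rewrite ler_norml => /andP[].
- by move=> w; exact: le_trans (ler_norm _) (fg w).
Qed.

Lemma mean_indic Q A : measurable A -> mean Q \1_A = fine (Q A).
Proof. by move=> mA; rewrite /mean /Rintegral integral_indic// setIT. Qed.

Lemma bounded_measurable_indic A : measurable A ->
  bounded_measurable (\1_A : Om -> R).
Proof.
move=> mA; split; first exact: measurable_indic.
by exists 1 => w; rewrite indicE; case: (_ \in _); rewrite ?normr1// normr0.
Qed.

End BoundedMean.

Section MeanTransfer.
Context d1 d2 (T1 : measurableType d1) (T2 : measurableType d2) (R : realType).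

Lemma bounded_measurable_comp (X : T1 -> T2) (f : T2 -> R) :
  measurable_fun [set: T1] X -> bounded_measurable f ->
  bounded_measurable (f \o X).
Proof.
by move=> mX [mf [M fM]]; split; [exact: measurableT_comp|exists M => w; exact: fM].
Qed.

Lemma mean_law (Q : probability T1 R) (nu : probability T2 R) (X : T1 -> T2)
    (f : T2 -> R) : measurable_fun [set: T1] X -> bounded_measurable f ->
  (forall A, measurable A -> Q (X @^-1` A) = nu A) -> mean Q (f \o X) = mean nu f.
Proof.
move=> mX bf law; rewrite /mean /Rintegral; congr fine.
transitivity (\int[pushforward Q X]_y (f y)%:E)%E.
  rewrite integral_pushforward//; first by apply/measurable_EFinP; exact: bf.1.
  by apply: bounded_measurable_integrable; exact: bounded_measurable_comp.
by apply: eq_measure_integral => A mA _; exact: law.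
Qed.

Lemma product_measure_setT (Q : probability T1 R) (N : probability T2 R) :
  (Q \x N)%E setT = 1%E.
Proof.
transitivity (Q setT * N setT)%E; last by rewrite !probability_setT mule1.
by rewrite -setXTT; exact: product_measure1E.
Qed.

Lemma mean_product (Q : probability T1 R) (N : probability T2 R)
    (f : T1 * T2 -> R) : bounded_measurable f ->
  fine (\int[Q \x N]_z (f z)%:E)%E = mean Q (fun x => mean N (fun y => f (x, y))).
Proof.
move=> bf; rewrite /mean /Rintegral; congr fine.
rewrite -(@integral12_prod_meas1 _ _ T1 T2 R Q N (EFin \o f)); last first.
  have [mf [M fM]] := bf.
  apply: measurable_bounded_integrable => //.
    by rewrite [X in (X < _)%E](_ : _ = 1%E) ?ltry//; exact: product_measure_setT.
  exists M; split; first exact: num_real.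
  by move=> x Mx w _; exact: le_trans (fM w) (ltW Mx).
apply: eq_integral => x _; rewrite /fubini_F.
have bx : bounded_measurable (fun y => f (x, y)).
  have [mf [M fM]] := bf; split; last by exists M.
  exact: measurableT_comp.
by rewrite -[RHS]integral_mean.
Qed.

End MeanTransfer.

Section ProductProbability.
Context d1 d2 (T1 : measurableType d1) (T2 : measurableType d2) (R : realType).
Variables (Q : probability T1 R) (N : probability T2 R).

Definition product_prob : set (T1 * T2) -> \bar R := (Q \x N)%E.

HB.instance Definition _ := Measure.on product_prob.

Let product_prob_setT : product_prob setT = 1%E.
Proof. exact: product_measure_setT. Qed.

HB.instance Definition _ :=
  Measure_isProbability.Build _ _ _ product_prob product_prob_setT.

End ProductProbability.

Lemma exists_law d1 d2 (T1 : measurableType d1) (T2 : measurableType d2)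
  (R : realType) (Q : probability T1 R) (X : T1 -> T2) :
  measurable_fun [set: T1] X ->
  exists nu : probability T2 R, forall A, nu A = Q (X @^-1` A).
Proof.
move=> mX; pose Xm : {mfun T1 >-> T2} := HB.pack X (isMeasurableFun.Build _ _ _ _ X mX).
by exists (distribution Q Xm).
Qed.

(** * Affine images and sums of normal variables *)

Section NormalLaw.
Variable R : realType.
Local Notation mu := (@lebesgue_measure R).
Local Open Scope ereal_scope.

(** The density of the normal law is its Radon-Nikodym derivative. *)
Lemma ge0_integral_normal (m s : R) (f : R -> \bar R) : s != 0%R ->
  (forall x, 0 <= f x) -> measurable_fun [set: R] f ->
  \int[normal_prob m s]_x f x = \int[mu]_x (f x * (normal_pdf m s x)%:E).
Proof.
move=> s0 f0 mf.
have dom := normal_prob_dominates m s.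
rewrite -(Radon_Nikodym_SigmaFinite.change_of_variables dom)//.
apply: ae_eq_integral => //.
- apply: emeasurable_funM => //.
  exact: measurable_int (Radon_Nikodym_SigmaFinite.f_integrable dom).
- apply: emeasurable_funM => //; apply/measurable_EFinP.
  exact: measurable_normal_pdf.
- apply: ae_eqe_mul2l => /=.
  apply: integral_ae_eq => //=.
  + exact: Radon_Nikodym_SigmaFinite.f_integrable.
  + by apply/measurable_EFinP; exact: measurable_normal_pdf.
  + move=> E _ mE; rewrite -Radon_Nikodym_SigmaFinite.f_integral//.
Qed.

(** The image of the Lebesgue measure under [z -> x + c * z], multiplied by [|c|],
gives intervals their length, hence is the Lebesgue measure. *)
Lemma ge0_integral_affine (x c : R) (f : R -> \bar R) : c != 0%R ->
  (forall y, 0 <= f y) -> measurable_fun [set: R] f ->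
  `|c|%:E * \int[mu]_z f (x + c * z)%R = \int[mu]_y f y.
Proof.
move=> c0 f0 mf.
pose phi : R -> measurableTypeR R := fun z => (x + c * z)%R.
have mphi : measurable_fun setT phi.
  by apply: measurable_funD => //; exact: measurable_funM.
have nc0 : (0 < `|c|)%R by rewrite normr_gt0.
have E A : measurable A -> mu A = mscale (NngNum (ltW nc0)) (pushforward mu phi) A.
  apply: lebesgue_measure_unique => _ [[a b]] _ <-.
  transitivity (`|c|%:E * mu (phi @^-1` `]a, b]%classic)); last by [].
  rewrite lebesgue_measure_itv/= lte_fin.
  have [cp|cn] := ltP 0%R c.
    have -> : phi @^-1` `]a, b]%classic = `]((a - x) / c)%R, ((b - x) / c)%R]%classic.
      apply/seteqP; split => z /=; rewrite !in_itv/= /phi ltr_pdivrMr// ler_pdivlMr//.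
        by rewrite ltrBlDl lerBrDl [(z * c)%R]mulrC.
      by rewrite ltrBlDl lerBrDl [(z * c)%R]mulrC.
    rewrite lebesgue_measure_itv/= lte_fin ltr_pM2r ?invr_gt0// ltrD2r.
    case: ifP => _; last by rewrite mule0.
    rewrite gtr0_norm// -!EFinD -EFinM; congr _%:E; field; exact: lt0r_neq0.
  have {}cn : (c < 0)%R by rewrite lt_neqAle c0.
  have -> : phi @^-1` `]a, b]%classic = `[((b - x) / c)%R, ((a - x) / c)%R[%classic.
    apply/seteqP; split => z /=; rewrite !in_itv/= /phi ler_ndivrMr// ltr_ndivlMr//.
      by rewrite ltrBlDl lerBrDl [(z * c)%R]mulrC andbC.
    by rewrite ltrBlDl lerBrDl [(z * c)%R]mulrC andbC.
  rewrite lebesgue_measure_itv/= lte_fin ltr_nM2r ?invr_lt0// ltrD2r.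
  case: ifP => _; last by rewrite mule0.
  by rewrite ltr0_norm// -!EFinD -EFinM; congr _%:E; field.
have mphi' : measurable_fun setT (f \o phi) by exact: measurableT_comp.
rewrite [RHS](eq_measure_integral (mscale (NngNum (ltW nc0)) (pushforward mu phi))) => [|A mA _].
  by rewrite ge0_integral_mscale// ge0_integral_pushforward.
exact: E.
Qed.

Lemma normal_pdf_affine (m s c x z : R) : s != 0%R -> c != 0%R ->
  (`|c| * normal_pdf (x + c * m) (c * s) (x + c * z) = normal_pdf m s z)%R.
Proof.
move=> s0 c0; have cs0 : (c * s != 0)%R by rewrite mulf_neq0.
rewrite !normal_pdfE// /normal_peak /normal_fun mulrA; congr (_ * expR _)%R.
  rewrite exprMn -mulrA -mulrnAr sqrtrM ?sqr_ge0// sqrtr_sqr invfM mulrA divff ?mul1r//.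
  by rewrite normr_eq0.
by field; rewrite s0.
Qed.

Lemma normal_prob_affine (x c : R) (A : set R) : c != 0%R -> measurable A ->
  normal_prob 0 1 ((fun z => (x + c * z)%R) @^-1` A) = normal_prob x c A.
Proof.
move=> c0 mA.
have mphi : measurable_fun setT (fun z : R => (x + c * z)%R).
  by apply: measurable_funD => //; exact: measurable_funM.
rewrite /normal_prob integral_mkcond [RHS]integral_mkcond.
rewrite -[RHS](@ge0_integral_affine x c)//; last 2 first.
- by move=> y; rewrite patchE; case: ifP => // _; rewrite lee_fin normal_pdf_ge0.
- apply/(measurable_restrictT _ mA); apply: measurable_funTS.
  by apply/measurable_EFinP; exact: measurable_normal_pdf.
rewrite -[RHS]ge0_integralZl//; last 2 first.
- apply: (@measurableT_comp _ _ _ _ _ _ ((fun y => (normal_pdf x c y)%:E) \_ A)) => //.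
  apply/(measurable_restrictT _ mA); apply: measurable_funTS.
  by apply/measurable_EFinP; exact: measurable_normal_pdf.
- by move=> y _; rewrite patchE; case: ifP => // _; rewrite lee_fin normal_pdf_ge0.
apply: eq_integral => z _; rewrite !patchE /=.
have -> : (z \in (fun z => (x + c * z)%R) @^-1` A) = ((x + c * z)%R \in A).
  by apply/idP/idP; rewrite !inE.
case: ifP => _; last by rewrite mule0.
rewrite -EFinM; congr _%:E.
have := @normal_pdf_affine 0 1 c x z (oner_neq0 _) c0.
by rewrite mulr0 addr0 mulr1.
Qed.

(** Completing the square: as a function of [x], the product of the two densities is
a multiple of a normal density. *)
Lemma normal_pdf_mix (s c x y : R) : s != 0%R -> c != 0%R ->
  let t := Num.sqrt (s ^+ 2 + c ^+ 2)%R in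
  (normal_pdf x c y * normal_pdf 0 s x =
   normal_pdf 0 t y * normal_pdf (s ^+ 2 * y / t ^+ 2) (s * c / t) x)%R.
Proof.
move=> s0 c0 t.
have s2 : (0 < s ^+ 2)%R by rewrite exprn_even_gt0.
have c2 : (0 < c ^+ 2)%R by rewrite exprn_even_gt0.
have tt : (t ^+ 2 = s ^+ 2 + c ^+ 2)%R by rewrite sqr_sqrtr// addr_ge0// ltW.
have t0 : (t != 0)%R.
  by rewrite -(sqrf_eq0 t) tt gt_eqF// addr_gt0.
have tau0 : (s * c / t != 0)%R by rewrite !mulf_neq0// invr_eq0.
rewrite !normal_pdfE// /normal_peak /normal_fun mulrACA [RHS]mulrACA -!expRD.
congr (_ * expR _)%R.
  rewrite -!invfM; congr (_^-1)%R.
  have p0 : (0 <= pi :> R)%R by exact: pi_ge0.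
  have pp (u : R) : (0 <= u ^+ 2 * pi *+ 2)%R by rewrite mulrn_wge0// mulr_ge0// sqr_ge0.
  rewrite -!sqrtrM ?pp//; congr Num.sqrt.
  by field.
have st0 : (s ^+ 2 + c ^+ 2 != 0)%R by rewrite gt_eqF// addr_gt0.
rewrite [((s * c / t) ^+ 2)%R]expr_div_n tt.
by field; rewrite s0 c0 st0.
Qed.

(** Given [X], the sum is normal of mean [X] and variance [c ^ 2].  By Tonelli its
density is the mean of those densities over the law of [X], which
[normal_pdf_mix] evaluates. *)
Lemma law_add_normal d (Om : measurableType d) (Q : probability Om R)
    (X : Om -> R) (v c : R) (A : set R) :
  measurable_fun [set: Om] X -> (0 <= v)%R ->
  (forall A, measurable A -> Q (X @^-1` A) = centered_normal v A) ->
  measurable A ->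
  (Q \x normal_prob 0 1) [set p | A (X p.1 + c * p.2)%R] =
  centered_normal (v + c ^+ 2) A.
Proof.
move=> mX v0 lawX mA.
have mS : measurable [set p : Om * R | A (X p.1 + c * p.2)%R].
  have : measurable_fun [set: Om * R] (fun p : Om * R => X p.1 + c * p.2)%R.
    apply: measurable_funD; first exact: measurableT_comp.
    exact: measurable_funM.
  by move=> /(_ measurableT _ mA); rewrite setTI.
rewrite /product_measure1.
have [->|c0] := eqVneq c 0%R.
  rewrite expr0n/= addr0 -lawX//.
  have mXA : measurable (X @^-1` A) by rewrite -[X in measurable X]setTI; exact: mX.
  rewrite -[X in _ = Q X]setIT -integral_indic//; apply: eq_integral => w _ /=.
  rewrite indicE; have [wA|wA] := boolP (w \in X @^-1` A).
    rewrite (_ : xsection _ _ = setT) ?probability_setT//.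
    apply/seteqP; split => // z _; rewrite /xsection/= inE/= mul0r addr0.
    by rewrite inE in wA.
  rewrite (_ : xsection _ _ = set0) ?measure0//.
  apply/seteqP; split => // z; rewrite /xsection/= inE/= mul0r addr0.
  by move=> Aw; rewrite notin_setE in wA; apply: wA.
have vc : (0 < v + c ^+ 2)%R by rewrite ltr_wpDl// exprn_even_gt0.
pose t := Num.sqrt (v + c ^+ 2)%R.
have t0 : (t != 0)%R by rewrite gt_eqF// sqrtr_gt0.
rewrite {1}/centered_normal gt_eqF//= -/t.
transitivity (\int[Q]_w \int[mu]_(y in A) (normal_pdf (X w) c y)%:E).
  apply: eq_integral => w _; rewrite -[RHS]/(normal_prob (X w) c A).
  rewrite -[RHS]normal_prob_affine//=; congr (normal_prob 0 1 _).
  by apply/seteqP; split => z; rewrite /xsection/= inE.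
pose F (p : Om * R) := (normal_pdf (X p.1) c p.2)%:E.
have mF : measurable_fun setT F.
  apply/measurable_EFinP; rewrite /F /normal_pdf (negbTE c0)/=.
  rewrite /normal_fun; apply: measurable_funM => //.
  apply: measurableT_comp => //; apply: measurable_funM => //.
  apply: measurableT_comp => //; apply: measurable_funX.
  apply: measurable_funB => //; exact: measurableT_comp.
under eq_integral do rewrite integral_mkcond.
pose G (p : Om * R) := ((fun y => F (p.1, y)) \_ A) p.2.
have mG : measurable_fun setT G.
  rewrite (_ : G = F \_ (snd @^-1` A)).
    apply/(measurable_restrictT F); last exact: measurable_funTS.
    by rewrite -[X in measurable X]setTI; exact: measurable_snd.
  apply/funext => -[w y]; rewrite /G !patchE/=.
  by have -> : ((w, y) \in snd @^-1` A) = (y \in A) by apply/idP/idP; rewrite !inE.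
have G0 p : 0 <= G p.
  by rewrite /G patchE; case: ifP => // _; rewrite lee_fin normal_pdf_ge0.
transitivity (\int[mu]_y \int[Q]_w G (w, y)).
  exact: (@fubini_tonelli _ _ _ _ _ Q mu G mG G0).
rewrite /normal_prob [RHS]integral_mkcond; apply: eq_integral => y _ /=.
rewrite /G /= patchE; have [yA|yA] := boolP (y \in A); last first.
  by under eq_integral do rewrite patchE (negbTE yA); rewrite integral0.
under eq_integral do rewrite patchE yA.
pose g (x : R) := (normal_pdf x c y)%:E.
have mg : measurable_fun [set: R] g.
  apply/measurable_EFinP; rewrite /g /normal_pdf (negbTE c0)/=.
  rewrite /normal_fun; apply: measurable_funM => //.
  apply: measurableT_comp => //; apply: measurable_funM => //.
  apply: measurableT_comp => //; apply: measurable_funX.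
  exact: measurable_funB.
have g0 x : 0 <= g x by rewrite lee_fin normal_pdf_ge0.
transitivity (\int[pushforward Q (X : Om -> measurableTypeR R)]_x g x).
  by rewrite ge0_integral_pushforward.
have [v00|vn0] := eqVneq v 0%R.
  rewrite (eq_measure_integral \d_(0%R : measurableTypeR R)) => [|B mB _].
    rewrite integral_dirac// diracT mul1e /g /t v00 add0r sqrtr_sqr.
    by rewrite /normal_pdf normr_eq0 (negbTE c0) /normal_peak /normal_fun real_normK ?num_real.
  by rewrite -[LHS]/(Q (X @^-1` B)) lawX// /centered_normal v00 eqxx.
have vp : (0 < v)%R by rewrite lt_neqAle eq_sym vn0.
pose s := Num.sqrt v; have s0 : s != 0%R by rewrite gt_eqF// sqrtr_gt0.
transitivity (\int[normal_prob 0 s]_x g x).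
  apply: eq_measure_integral => B mB _.
  by rewrite -[LHS]/(Q (X @^-1` B)) lawX// /centered_normal gt_eqF.
rewrite ge0_integral_normal//.
have ss : (s ^+ 2 = v)%R by rewrite sqr_sqrtr.
under eq_integral do rewrite -EFinM normal_pdf_mix// ss -/t EFinM.
rewrite ge0_integralZl//; last 3 first.
- by apply/measurable_EFinP; exact: measurable_normal_pdf.
- by move=> x _; rewrite lee_fin normal_pdf_ge0.
- by rewrite lee_fin normal_pdf_ge0.
by rewrite integral_normal_pdf mule1.
Qed.

End NormalLaw.

(** * The characteristic function of the normal law *)

Section NormalCharacteristicFunction.
Variable R : realType.
Local Notation N01 := (normal_prob (0 : R) (1 : R)).
Local Notation RR := (measurableTypeR R).

Lemma bounded_measurable_cos d (Om : measurableType d) (X : Om -> R) :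
  measurable_fun [set: Om] X -> bounded_measurable (fun w => cos (X w)).
Proof.
move=> mX; split; last by exists 1 => w; exact: cos_max.
apply: (@measurableT_comp _ _ _ _ _ _ (@cos R)) => //.
by apply: continuous_measurable_fun; exact: continuous_cos.
Qed.

Lemma bounded_measurable_sin d (Om : measurableType d) (X : Om -> R) :
  measurable_fun [set: Om] X -> bounded_measurable (fun w => sin (X w)).
Proof.
move=> mX; split; last by exists 1 => w; exact: sin_max.
apply: (@measurableT_comp _ _ _ _ _ _ (@sin R)) => //.
by apply: continuous_measurable_fun; exact: continuous_sin.
Qed.

Lemma normal_prob_sqr (m s t : R) (A : set R) : s ^+ 2 = t ^+ 2 ->
  normal_prob m s A = normal_prob m t A.
Proof.
move=> st; congr (\int[_]_(x in _) _)%E; apply/funext => x.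
rewrite /normal_pdf /normal_peak /normal_fun st.
by rewrite -(sqrf_eq0 s) st sqrf_eq0.
Qed.

Lemma centered_normal_scale (c : R) (A : set R) : measurable A ->
  N01 ((fun z => c * z) @^-1` A) = centered_normal (c ^+ 2) A.
Proof.
move=> mA; rewrite /centered_normal sqrf_eq0; have [->|c0] := eqVneq c 0.
  have [A0|A0] := boolP ((0 : R) \in A).
    rewrite diracE A0 (_ : _ @^-1` A = setT) ?probability_setT//.
    by apply/seteqP; split => // z _; rewrite /= mul0r; rewrite inE in A0.
  rewrite diracE (negbTE A0) (_ : _ @^-1` A = set0) ?measure0//.
  by apply/seteqP; split => // z; rewrite /= mul0r => Az; rewrite notin_setE in A0.
rewrite sqrtr_sqr.
transitivity (normal_prob 0 c A); last by apply: normal_prob_sqr; rewrite real_normK ?num_real.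
rewrite -[RHS]normal_prob_affine//; congr (normal_prob 0 1 _).
by apply/funext => z; rewrite /= add0r.
Qed.

(** The characteristic function of the standard normal law, which is real because
that law is symmetric. *)
Definition normal_cf (c : R) : R := mean N01 (fun z : RR => cos (c * z)).

Let mscale (c : R) : measurable_fun [set: RR] (fun z : RR => c * z : RR).
Proof. exact: measurable_funM. Qed.

Lemma mean_sin_normal (c : R) : mean N01 (fun z : RR => sin (c * z)) = 0.
Proof.
have bs : bounded_measurable (fun z : RR => sin (c * z)).
  exact: bounded_measurable_sin.
have h : mean N01 (fun z : RR => sin (c * z)) = - mean N01 (fun z : RR => sin (c * z)).
  rewrite -[RHS]mulN1r -meanZ//.
  have := @mean_law _ _ RR RR R N01 N01 (fun z => -1 * z) (fun z => sin (c * z)) (mscale _) bs.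
  move=> <-.
    by congr mean; apply/funext => z; rewrite /= [-1 * z]mulN1r mulrN sinN mulN1r.
  move=> A mA; have := @centered_normal_scale (-1) A mA.
  by rewrite sqrrN expr1n /centered_normal oner_eq0 sqrtr1.
by apply/eqP; move/eqP: h; rewrite -subr_eq0 opprK -mulr2n mulrn_eq0.
Qed.

Lemma mean_cos_law d (Om : measurableType d) (Q : probability Om R)
    (X : Om -> R) (v : R) : measurable_fun [set: Om] X -> 0 <= v ->
  (forall A, measurable A -> Q (X @^-1` A) = centered_normal v A) ->
  mean Q (fun w => cos (X w)) = normal_cf (Num.sqrt v).
Proof.
move=> mX v0 lawX.
have [nu Hnu] := exists_law Q (mX : measurable_fun _ (X : Om -> RR)).
have bc : bounded_measurable (@cos R : RR -> R) by exact: bounded_measurable_cos.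
transitivity (mean nu (@cos R)).
  by apply: (@mean_law _ _ Om RR R Q nu X).
symmetry; apply: (@mean_law _ _ RR RR R N01 nu (fun z => Num.sqrt v * z) (@cos R)) => //.
move=> A mA; rewrite Hnu lawX//; have := @centered_normal_scale (Num.sqrt v) A mA.
by rewrite sqr_sqrtr.
Qed.

(** The sum of independent normal variables of variances [a ^ 2] and [b ^ 2] is normal
of variance [a ^ 2 + b ^ 2], and the sine part of the addition formula has mean
zero. *)
Lemma normal_cf_add (a b : R) : normal_cf (Num.sqrt (a ^+ 2 + b ^+ 2)) = normal_cf a * normal_cf b.
Proof.
have mX : measurable_fun [set: RR] (fun z : RR => a * z : R) by exact: mscale.
have mS : measurable_fun [set: RR * RR] (fun p : RR * RR => a * p.1 + b * p.2 : R).
  by apply: measurable_funD; exact: measurable_funM.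
rewrite -(@mean_cos_law _ _ (product_prob N01 N01) (fun p : RR * RR => a * p.1 + b * p.2))//.
- rewrite /mean /Rintegral mean_product; last exact: bounded_measurable_cos.
  rewrite /normal_cf mulrC -meanZ; last exact: bounded_measurable_cos.
  congr mean; apply/funext => x /=.
  have -> : (fun y : RR => cos (a * x + b * y)) =
    (fun y : RR => cos (a * x) * cos (b * y) + (- sin (a * x)) * sin (b * y)).
    by apply/funext => y; rewrite cosD mulNr.
  rewrite meanD ?meanZ ?mean_sin_normal ?mulr0 ?addr0 1?mulrC//.
  + exact: bounded_measurable_sin.
  + exact: bounded_measurable_cos.
  + by apply: bounded_measurableZ; exact: bounded_measurable_cos.
  + by apply: bounded_measurableZ; exact: bounded_measurable_sin.
- by rewrite addr_ge0 ?sqr_ge0.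
- move=> A mA; apply: law_add_normal => //; first exact: sqr_ge0.
  by move=> B mB; exact: centered_normal_scale.
Qed.

Lemma normal_cf_pow (b : R) (n : nat) : normal_cf (Num.sqrt n%:R * b) = normal_cf b ^+ n.
Proof.
elim: n => [|n IH].
  rewrite sqrtr0 mul0r expr0 /normal_cf.
  by under [X in mean _ X]eq_fun do rewrite mul0r cos0; rewrite mean_cst.
rewrite exprSr -IH -normal_cf_add.
have -> : (Num.sqrt n%:R * b) ^+ 2 + b ^+ 2 = n.+1%:R * b ^+ 2.
  by rewrite exprMn sqr_sqrtr// -natr1 mulrDl mul1r.
have gN x : normal_cf `|x| = normal_cf x.
  rewrite /normal_cf; congr mean; apply/funext => z.
  by case: (ger0P x) => // _; rewrite mulNr cosN.
by rewrite sqrtrM// sqrtr_sqr -gN normrM ger0_norm ?sqrtr_ge0// -[in RHS]gN normrM ger0_norm ?sqrtr_ge0.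
Qed.

(** Tilting the standard normal density by [exp (h * z ^ 2 / 2)] only changes its
variance. *)
Lemma integral_exp_sqr (h s : R) : 0 < s -> s ^+ 2 * (1 - h) = 1 ->
  (\int[N01]_z (expR (h * z ^+ 2 / 2))%:E = s%:E)%E.
Proof.
move=> s0 sh; have sn0 : s != 0 by rewrite gt_eqF.
have mexp : measurable_fun [set: R] (fun z : R => expR (h * z ^+ 2 / 2)).
  apply: measurableT_comp => //; apply: measurable_funM => //.
  by apply: measurable_funM => //; exact: measurable_funX.
rewrite ge0_integral_normal//; last first.
  exact/measurable_EFinP.
transitivity (\int[@lebesgue_measure R]_z (s%:E * (normal_pdf 0 s z)%:E))%E; last first.
  rewrite ge0_integralZl//=; last 3 first.
  - by apply/measurable_EFinP; exact: measurable_normal_pdf.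
  - by move=> z _; rewrite lee_fin normal_pdf_ge0.
  - by rewrite lee_fin ltW.
  by rewrite integral_normal_pdf mule1.
apply: eq_integral => z _; rewrite -!EFinM; congr (_%:E).
rewrite !normal_pdfE ?oner_neq0// /normal_peak /normal_fun !subr0.
rewrite mulrCA -expRD [RHS]mulrA; congr (_ * expR _).
  have pk (u : R) : Num.sqrt (u ^+ 2 * pi *+ 2) = `|u| * Num.sqrt (pi *+ 2).
    by rewrite -mulrnAr sqrtrM ?sqr_ge0// sqrtr_sqr.
  rewrite !pk normr1 mul1r gtr0_norm//.
  by rewrite invfM mulrA divff// mul1r.
have -> : h = 1 - (s ^+ 2)^-1.
  apply: (mulfI (expf_neq0 2 sn0)); rewrite mulrBr mulr1 divff ?expf_neq0//.
  by rewrite -[in RHS]sh; ring.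
by field.
Qed.

(** Here [s = (1 - h) ^ (-1/2)], whose expansion starts with [1 + h / 2]. *)
Lemma inv_sqrt_le (h s : R) : 0 < s -> `|h| <= 2^-1 -> s ^+ 2 * (1 - h) = 1 ->
  s <= 1 + h / 2 + h ^+ 2.
Proof.
rewrite ler_norml => s0 /andP[h1 h2] sh.
have p0 : 0 <= 1 + h / 2 + h ^+ 2 by have := sqr_ge0 h; lra.
rewrite -(@ler_pXn2r _ 2) ?nnegrE//; last exact: ltW.
have h0 : 0 < 1 - h by lra.
rewrite -(ler_pM2r h0) sh.
have -> : (1 + h / 2 + h ^+ 2) ^+ 2 * (1 - h) =
   1 + h ^+ 2 * (5 / 4 - 5 / 4 * h - h ^+ 3) by field.
rewrite lerDl mulr_ge0 ?sqr_ge0//.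
have : h ^+ 3 <= 2^-1.
  have : h ^+ 2 <= 4^-1.
    by have := @mulr_ge0 R (2^-1 - h) (2^-1 + h) ltac:(lra) ltac:(lra); lra.
  rewrite exprS; have := sqr_ge0 h; nra.
lra.
Qed.

Let cos_ge (y : R) : 1 - y ^+ 2 / 2 - y ^+ 4 <= cos y.
Proof. have := cos_quadratic_le_fourth y; rewrite ler_norml => /andP[]; lra. Qed.

Let cos_le (y : R) : cos y <= 1 - y ^+ 2 / 2 + y ^+ 4.
Proof. have := cos_quadratic_le_fourth y; rewrite ler_norml => /andP[_]; lra. Qed.

Let fourth_le (z : R) : z ^+ 4 <= 32 * expR (2^-1 * z ^+ 2 / 2).
Proof.
have q0 : 0 <= 2^-1 * z ^+ 2 / 2 by have := sqr_ge0 z; lra.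
have := @expR_ge1Dxn R (2^-1 * z ^+ 2 / 2) 1 q0.
have -> : (2`!)%:R = 2 :> R by [].
have -> : (2^-1 * z ^+ 2 / 2) ^+ 2 / 2 = z ^+ 4 / 32 by field.
lra.
Qed.

(** The integrals of [exp (h * z ^ 2 / 2)] serve as a substitute for the moments of the
normal law: [1 + u <= exp u] at [u = b ^ 2 * z ^ 2 / 2] and at its opposite bounds
[1 - (b * z) ^ 2 / 2] from both sides, and a multiple of [exp (z ^ 2 / 4)] dominates
the remainder of the cosine. *)
Lemma normal_cf_quadratic (b : R) : b ^+ 2 <= 2^-1 ->
  `|normal_cf b - (1 - b ^+ 2 / 2)| <= 65 * b ^+ 4.
Proof.
move=> b2.
have b20 := sqr_ge0 b; have b40 : 0 <= b ^+ 4 by rewrite (_ : 4 = 2 * 2)%N// exprM sqr_ge0.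
have sig h : `|h| <= 2^-1 -> exists s : R, [/\ 0 < s, s ^+ 2 * (1 - h) = 1 &
    s <= 1 + h / 2 + h ^+ 2].
  rewrite ler_norml => /andP[h1 h2]; have h0 : 0 < 1 - h by lra.
  exists (Num.sqrt (1 - h)^-1).
  have s0 : 0 < Num.sqrt (1 - h)^-1 by rewrite sqrtr_gt0 invr_gt0.
  have sh : Num.sqrt (1 - h)^-1 ^+ 2 * (1 - h) = 1.
    by rewrite sqr_sqrtr ?invr_ge0 1?ltW// mulVf// gt_eqF.
  by split => //; apply: inv_sqrt_le => //; rewrite ler_norml h1 h2.
have [s1 [s10 s1E s1b]] : exists s : R, [/\ 0 < s, s ^+ 2 * (1 - b ^+ 2) = 1 &
    s <= 1 + b ^+ 2 / 2 + b ^+ 2 ^+ 2] by apply: sig; rewrite ger0_norm.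
have [s2 [s20 s2E s2b]] : exists s : R, [/\ 0 < s, s ^+ 2 * (1 - - b ^+ 2) = 1 &
    s <= 1 + - b ^+ 2 / 2 + (- b ^+ 2) ^+ 2] by apply: sig; rewrite normrN ger0_norm.
have [s3 [s30 s3E s3b]] : exists s : R, [/\ 0 < s, s ^+ 2 * (1 - 2^-1) = 1 &
    s <= 1 + 2^-1 / 2 + 2^-1 ^+ 2] by apply: sig; rewrite ger0_norm.
(* The constant 65 is [1 + 32 * 2]: one from [inv_sqrt_le], and the factor 32 of
   [fourth_le] times the integral [s3 <= 2] of [exp (z ^ 2 / 4)]. *)
have s32 : s3 <= 2 by apply: (le_trans s3b); lra.
have I1 := integral_exp_sqr s10 s1E.
have I2 := integral_exp_sqr s20 s2E.
have I3 := integral_exp_sqr s30 s3E.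
have mE (h : R) : measurable_fun [set: RR] (fun z : RR => (expR (h * z ^+ 2 / 2))%:E).
  apply/measurable_EFinP; apply: measurableT_comp => //; apply: measurable_funM => //.
  by apply: measurable_funM => //; exact: measurable_funX.
have bc1 : bounded_measurable (fun z : RR => 1 + cos (b * z)).
  apply: bounded_measurableD; first exact: bounded_measurable_cst.
  exact: bounded_measurable_cos.
have Ic : (\int[N01]_z (1 + cos (b * z))%:E = (1 + normal_cf b)%:E)%E.
  rewrite integral_mean// meanD ?mean_cst//; first exact: bounded_measurable_cst.
  exact: bounded_measurable_cos.
have c0 (z : RR) : (0 <= (1 + cos (b * z))%:E)%E.
  by rewrite lee_fin -lerBlDl sub0r cos_geN1.
have e0 (h z : R) : (0 <= (expR (h * z ^+ 2 / 2))%:E)%E by rewrite lee_fin expR_ge0.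
have I3' : (\int[N01]_z (32 * b ^+ 4 * expR (2^-1 * z ^+ 2 / 2))%:E = (32 * b ^+ 4 * s3)%:E)%E.
  under eq_integral do rewrite EFinM.
  rewrite ge0_integralZl//; first by rewrite I3.
  by rewrite lee_fin mulr_ge0.
have m3 : measurable_fun [set: RR] (fun z : RR => (32 * b ^+ 4 * expR (2^-1 * z ^+ 2 / 2))%:E).
  apply/measurable_EFinP; apply: measurable_funM => //.
  by have /measurable_EFinP := mE 2^-1.
have e3 (z : R) : (0 <= (32 * b ^+ 4 * expR (2^-1 * z ^+ 2 / 2))%:E)%E.
  by rewrite lee_fin mulr_ge0 ?expR_ge0// mulr_ge0.
have mc : measurable_fun [set: RR] (fun z : RR => (1 + cos (b * z))%:E).
  by apply/measurable_EFinP; exact: bc1.1.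
have y4 (z : R) : (b * z) ^+ 4 <= 32 * b ^+ 4 * expR (2^-1 * z ^+ 2 / 2).
  by rewrite exprMn [32 * _]mulrC -[leRHS]mulrA ler_wpM2l// fourth_le.
have lower : 3 <= s1 + (32 * b ^+ 4 * s3 + (1 + normal_cf b)).
  rewrite -lee_fin (EFinD s1) (EFinD (32 * b ^+ 4 * s3)) -Ic -I1.
  have -> : (3%:E = \int[N01]_z (3%:E))%E.
    by rewrite integral_cst//= probability_setT mule1.
  rewrite -I3' -ge0_integralD// -ge0_integralD//; last 2 first.
  - by move=> z _; rewrite adde_ge0.
  - exact: emeasurable_funD.
  apply: ge0_le_integral => //.
  - by apply: emeasurable_funD => //; exact: emeasurable_funD.
  move=> z _; rewrite -!EFinD lee_fin.
  have := expR_ge1Dx (b ^+ 2 * z ^+ 2 / 2); have := cos_ge (b * z); have := y4 z.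
  rewrite exprMn; lra.
have upper : 1 + normal_cf b <= 1 + (s2 + 32 * b ^+ 4 * s3).
  rewrite -lee_fin -Ic (EFinD 1) (EFinD s2) -I2 -I3'.
  have -> : (1%:E = \int[N01]_z (1%:E))%E.
    by rewrite integral_cst//= probability_setT mule1.
  rewrite -ge0_integralD// -ge0_integralD//; last 2 first.
  - by move=> z _; rewrite adde_ge0.
  - exact: emeasurable_funD.
  apply: ge0_le_integral => //.
  - by apply: emeasurable_funD => //; exact: emeasurable_funD.
  move=> z _; rewrite -!EFinD lee_fin.
  have := expR_ge1Dx (- b ^+ 2 * z ^+ 2 / 2); have := cos_le (b * z); have := y4 z.
  rewrite exprMn; lra.
have b44 : b ^+ 2 ^+ 2 = b ^+ 4 by rewrite -exprM.
rewrite sqrrN b44 in s2b; rewrite b44 in s1b.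
have s3' : 32 * b ^+ 4 * s3 <= 64 * b ^+ 4 by nra.
clear -lower upper s1b s2b s3'.
by rewrite ler_norml; apply/andP; split; lra.
Qed.

Lemma exprn_sub_le (x y : R) n : `|x| <= 1 -> `|y| <= 1 ->
  `|x ^+ n - y ^+ n| <= n%:R * `|x - y|.
Proof.
move=> x1 y1; elim: n => [|n IH]; first by rewrite !expr0 subrr normr0 mul0r.
have -> : x ^+ n.+1 - y ^+ n.+1 = x * (x ^+ n - y ^+ n) + (x - y) * y ^+ n.
  by rewrite !exprS; ring.
apply: (le_trans (ler_normD _ _)); rewrite -natr1 [leRHS]mulrDl mul1r !normrM lerD//.
  by rewrite (le_trans _ IH)// ler_piMl.
by rewrite ler_piMr// normrX exprn_ile1.
Qed.

(** With [b = c / sqrt n], both sides are [n]-th powers of quantities that agree with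
[1 - b ^ 2 / 2] up to a multiple of [b ^ 4], hence of [n ^ (-2)]; so the sides differ
by at most a multiple of [1 / n], for every large [n]. *)
Lemma normal_cfE (c : R) : normal_cf c = expR (- (c ^+ 2 / 2)).
Proof.
apply/eqP; rewrite -subr_eq0 -normr_eq0 eq_le normr_ge0 andbT.
have key n : 2 * c ^+ 2 <= n.+1%:R ->
   `|normal_cf c - expR (- (c ^+ 2 / 2))| <= 66 * c ^+ 4 / n.+1%:R.
  move=> cn; have m0 : 0 < n.+1%:R :> R by [].
  pose r : R := Num.sqrt n.+1%:R; have r0 : 0 < r by rewrite sqrtr_gt0.
  have rr : r ^+ 2 = n.+1%:R by rewrite sqr_sqrtr.
  pose b := c / r.
  have gE : normal_cf c = normal_cf b ^+ n.+1.
    by rewrite -normal_cf_pow -/r /b mulrCA divff ?mulr1// gt_eqF.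
  have b2 : b ^+ 2 = c ^+ 2 / n.+1%:R by rewrite expr_div_n rr.
  have eE : expR (- (c ^+ 2 / 2)) = expR (- (b ^+ 2 / 2)) ^+ n.+1.
    rewrite -expRM_natl b2; congr expR; field.
    by rewrite gt_eqF.
  have g1 : `|normal_cf b| <= 1.
    apply: (@le_trans _ _ (mean N01 (fun _ : RR => 1))); last by rewrite mean_cst.
    apply: mean_norm_le.
    - exact: bounded_measurable_cos.
    - exact: bounded_measurable_cst.
    - by move=> z; exact: cos_max.
  have b20 : 0 <= b ^+ 2 / 2 by rewrite divr_ge0 ?sqr_ge0.
  have e1 : `|expR (- (b ^+ 2 / 2))| <= 1.
    by rewrite ger0_norm ?expR_ge0// -[leRHS]expR0 ler_expR oppr_le0.
  rewrite gE eE; apply: (le_trans (exprn_sub_le _ g1 e1)).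
  have b2h : b ^+ 2 <= 2^-1 by rewrite b2 ler_pdivrMr//; lra.
  have q1 := normal_cf_quadratic b2h; have q2 := expRN_quadratic b20.
  have q3 : `|normal_cf b - expR (- (b ^+ 2 / 2))| <= 66 * b ^+ 4.
    have -> : normal_cf b - expR (- (b ^+ 2 / 2)) = (normal_cf b - (1 - b ^+ 2 / 2)) -
      (expR (- (b ^+ 2 / 2)) - (1 - b ^+ 2 / 2)) by ring.
    apply: (le_trans (ler_normB _ _)); apply: (le_trans (lerD q1 q2)).
    have b4 : (b ^+ 2 / 2) ^+ 2 = b ^+ 4 / 4 by field.
    rewrite b4; have : 0 <= b ^+ 4 by rewrite (_ : 4 = 2 * 2)%N// exprM sqr_ge0.
    clear; lra.
  have -> : 66 * c ^+ 4 / n.+1%:R = n.+1%:R * (66 * b ^+ 4).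
    have -> : b ^+ 4 = c ^+ 4 / n.+1%:R ^+ 2.
      by rewrite (_ : 4 = 2 * 2)%N// !exprM b2 expr_div_n.
    by field; rewrite gt_eqF.
  by rewrite ler_wpM2l.
apply: (@cvg_near_le _ (fun n => 66 * c ^+ 4 / n.+1%:R)).
  by rewrite -(mulr0 (66 * c ^+ 4)); apply: cvgM; [exact: cvg_cst|exact: cvg_invS].
have [N HN] : exists N : nat, 2 * c ^+ 2 <= N%:R.
  by exists (Num.bound (2 * c ^+ 2)); apply/ltW/archi_boundP; rewrite mulr_ge0 ?sqr_ge0.
exists N => // n /= Nn; apply: key; apply: (le_trans HN).
by rewrite ler_nat (leq_trans Nn).
Qed.

End NormalCharacteristicFunction.

(** * Centred multivariate normal laws *)

Section IidNormals.
Variable R : realType.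
Local Notation N01 := (normal_prob (0 : R) (1 : R)).
Local Notation RR := (measurableTypeR R).

(** Induction on [s]: the product with one more standard normal law adds one variable,
and [law_add_normal] gives the laws of the linear combinations. *)
Lemma iid_normals (s : nat) : exists (d : measure_display)
  (Om : measurableType d) (Q : probability Om R) (g : 'I_s -> Om -> R),
  (forall i, measurable_fun [set: Om] (g i)) /\
  forall (c : 'I_s -> R) A, measurable A ->
    Q ((fun w => \sum_i c i * g i w) @^-1` A) = centered_normal (\sum_i c i ^+ 2) A.
Proof.
elim: s => [|s [d [Om [Q [g [mg lawg]]]]]].
  exists _, RR, (dirac (0 : RR)), (fun _ _ => 0); split => [|c A mA].
    by move=> [].
  have -> : \sum_(i < 0) c i ^+ 2 = 0 by rewrite big_ord0.
  rewrite /centered_normal eqxx diracE [LHS]diracE.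
  suff -> : ((0 : RR) \in (fun=> \sum_(i < 0) c i * 0) @^-1` A) = ((0 : R) \in A) by [].
  by apply/idP/idP; rewrite !inE /= big_ord0.
exists _, (Om * RR)%type, (product_prob Q N01).
pose g' (i : 'I_s.+1) (p : Om * RR) : R := if unlift ord_max i is Some j then g j p.1 else p.2.
exists g'; split => [i|c A mA].
  rewrite /g'; case: unliftP => [j _|_]; last exact: measurable_snd.
  by apply: measurableT_comp => //; exact: mg.
pose X w := \sum_(i < s) c (widen_ord (leqnSn s) i) * g i w.
have mX : measurable_fun [set: Om] X.
  by apply: measurable_sum => i; exact: measurable_funM.
rewrite [RHS](_ : _ = centered_normal (\sum_(i < s) c (widen_ord (leqnSn s) i) ^+ 2 + c ord_max ^+ 2) A); last by rewrite big_ord_recr.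
rewrite -(@law_add_normal _ _ _ Q X _ (c ord_max) A)//; last 2 first.
- by apply: sumr_ge0 => i _; exact: sqr_ge0.
- by move=> B mB; exact: lawg.
congr product_prob; apply/funext => p /=; congr A.
rewrite big_ord_recr/= /X /g' unlift_none; congr (_ + _).
apply: eq_bigr => i _; rewrite (_ : widen_ord _ i = lift ord_max i) ?liftK//.
by apply: val_inj; rewrite /= /bump leqNgt ltn_ord.
Qed.

End IidNormals.

Section Gram.
Variables (R : realType) (r : nat).

Local Notation ee k := (delta_mx 0 k : 'rV[R]_r).

Lemma delta_mulmx (G : 'M[R]_r) (k j : 'I_r) :
  (ee k *m G) 0 j = G k j.
Proof.
rewrite mxE (bigD1 k)//= !mxE !eqxx mul1r big1 ?addr0// => i /negbTE ik.
by rewrite !mxE ik andbF mul0r.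
Qed.

Lemma quad_add (G : 'M[R]_r) (t : 'rV[R]_r) (k : 'I_r) (x : R) : G^T = G ->
  quad G (t + x *: (ee k)) =
  quad G t + 2 * x * (t *m G) 0 k + x ^+ 2 * G k k.
Proof.
move=> Gs.
have e1 (u : 'rV[R]_r) : (u *m ((ee k))^T) 0 0 = u 0 k.
  rewrite mxE (bigD1 k)//= !mxE !eqxx mulr1 big1 ?addr0// => i /negbTE ik.
  by rewrite !mxE ik andbF mulr0.
have e2 : ((ee k) *m G *m t^T) 0 0 = (t *m G) 0 k.
  rewrite mxE [RHS]mxE; apply: eq_bigr => j _.
  by rewrite delta_mulmx [_^T _ _]mxE mulrC; congr (_ * _); rewrite -{1}Gs mxE.
have e3 : ((ee k) *m G *m ((ee k))^T) 0 0 = G k k.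
  by rewrite e1 delta_mulmx.
rewrite /quad linearD/= linearZ/= mulmxDl -scalemxAl mulmxDl !mulmxDr.
have aD (A B : 'M[R]_1) : (A + B) 0 0 = A 0 0 + B 0 0 by rewrite mxE.
have aZ z (A : 'M[R]_1) : (z *: A) 0 0 = z * A 0 0 by rewrite mxE.
rewrite -!scalemxAl -!scalemxAr !aD !aZ e1 e2 e3; ring.
Qed.

(** Cholesky factorization without pivoting: subtracting the rank one matrix of a row
with positive pivot clears that row, and a row with zero pivot vanishes. *)
Lemma gram_factorization (Sigma : 'M[R]_r) : Sigma^T = Sigma ->
  (forall t, 0 <= quad Sigma t) -> exists s (L : 'M[R]_(s, r)), Sigma = L^T *m L.
Proof.
suff H : forall n (S : 'M[R]_r), S^T = S -> (forall t, 0 <= quad S t) ->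
    (forall i j : 'I_r, (i + n < r)%N -> S i j = 0) ->
    exists s (L : 'M[R]_(s, r)), S = L^T *m L.
  move=> Ss Sp; apply: (H r) => // i j; by rewrite ltnNge leq_addl.
elim=> [|n IH] S Ss Sp S0.
  exists 0%N, 0; rewrite mulmx0; apply/matrixP => i j.
  by rewrite S0 ?addn0// mxE.
have [rn|nr] := leqP r n.
  by apply: IH => // i j; rewrite ltnNge (leq_trans rn) ?leq_addl.
have kr : (r - n.+1 < r)%N by rewrite ltn_subrL /= (leq_trans _ nr).
pose k := Ordinal kr.
have Skk : 0 <= S k k.
  have := Sp (0 + 1 *: (ee k)); rewrite quad_add// mul0mx mxE mulr0 addr0.
  by rewrite /quad mul0mx mul0mx mxE add0r expr1n mul1r.
have split_k (i : 'I_r) : (i + n < r)%N -> (i + n.+1 < r)%N \/ i = k.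
  move=> h; have [->|ne] := eqVneq i k; first by right.
  left; rewrite addnS ltn_neqAle h andbT; apply: contra ne => /eqP e.
  by apply/eqP/val_inj/(@addIn n.+1); rewrite /= subnK// addnS.
have [S00|Sn0] := eqVneq (S k k) 0.
  apply: IH => // i j /split_k[|->]; first exact: S0.
  apply/eqP/contraT => Skj.
  pose b := ((ee j) *m S) 0 k.
  have bE : b = S k j by rewrite /b delta_mulmx -{1}Ss mxE.
  have := Sp ((ee j) + (- (quad S ((ee j)) + 1) / (2 * b)) *: (ee k)).
  rewrite quad_add// -/b S00 mulr0 addr0.
  have -> : 2 * (- (quad S ((ee j)) + 1) / (2 * b)) * b =
     - (quad S ((ee j)) + 1) by field; rewrite bE.
  lra.
have a0 : 0 < S k k by rewrite lt_neqAle eq_sym Sn0.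
pose a := Num.sqrt (S k k).
have ap : 0 < a by rewrite sqrtr_gt0.
have aa : a ^+ 2 = S k k by rewrite sqr_sqrtr.
pose v : 'rV[R]_r := a^-1 *: row k S.
have vE j : v 0 j = S k j / a by rewrite !mxE mulrC.
have vv i j : (v^T *m v) i j = S k i * S k j / S k k.
  rewrite mxE big_ord1 !mxE -!/(v _ _) -aa; field; exact: lt0r_neq0.
pose S' := S - v^T *m v.
have S'E i j : S' i j = S i j - S k i * S k j / S k k.
  by rewrite mxE; congr (_ + _); rewrite mxE vv.
have [||i j /split_k[ik|->]|s [L SL]] := IH S'.
- by rewrite linearB/= trmx_mul trmxK Ss.
- move=> t; pose b := (t *m S) 0 k.
  have qE : quad S' t = quad S t - b ^+ 2 / S k k.
    have tv : (t *m v^T) 0 0 = b / a.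
      rewrite mxE /b mxE mulr_suml; apply: eq_bigr => j _.
      by rewrite [v^T _ _]mxE vE -{1}Ss mxE mulrA.
    have -> : quad S' t = quad S t - quad (v^T *m v) t.
      have aB (A B : 'M[R]_1) : (A - B) 0 0 = A 0 0 - B 0 0 by rewrite mxE [(- B) _ _]mxE.
      by rewrite /quad mulmxBr mulmxBl aB.
    congr (_ - _); rewrite /quad mulmxA -mulmxA mxE big_ord1 tv.
    rewrite -[v *m _]trmxK trmx_mul trmxK [(_^T) _ _]mxE tv -aa; field.
    exact: lt0r_neq0.
  rewrite qE; have := Sp (t + (- b / S k k) *: (ee k)).
  rewrite quad_add// -/b.
  have -> : quad S t + 2 * (- b / S k k) * b + (- b / S k k) ^+ 2 * S k k =
    quad S t - b ^+ 2 / S k k by field.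
  by [].
- by rewrite S'E S0// (_ : S k i = 0) ?mul0r ?subrr// -Ss mxE S0.
- by rewrite S'E mulrAC divff// mul1r subrr.
exists (s + 1)%N, (col_mx L v).
by rewrite tr_col_mx mul_row_col -SL subrK.
Qed.

End Gram.

Section BorelRowVectors.
Variables (R : realType) (r : nat).
Local Notation V := (borel_rV R r).

Let box (c : {ffun 'I_r -> rat} * nat) : set 'rV[R]_r :=
  [set x | forall i, `|x 0 i - ratr (c.1 i)| < c.2.+1%:R^-1].

(** Rational boxes form a countable base of the topology, so that measurability into
the Borel sets can be checked coordinatewise. *)
Lemma measurable_rV d (Om : measurableType d) (X : Om -> 'rV[R]_r) :
  (forall i, measurable_fun [set: Om] (fun w => X w 0 i)) ->
  measurable_fun [set: Om] (X : Om -> V).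
Proof.
move=> mX; apply: (@measurability _ _ Om V setT X (@open 'rV[R]_r) erefl).
move=> _ [U oU <-]; rewrite setTI.
have -> : U = \bigcup_(c in [set: {ffun 'I_r -> rat} * nat])
    (if asbool (box c `<=` U) then box c else set0).
  apply/seteqP; split => [x Ux|x [c _]]; last by case: ifP => // /asboolP h; exact: h.
  have /nbhs_ballP[e /= e0 eU] : nbhs x U by exact: open_nbhs_nbhs.
  have [n n2] : exists n : nat, n.+1%:R^-1 < e / 2.
    have e20 : 0 < e / 2 by rewrite divr_gt0.
    have /cvgrPdist_lt /(_ _ e20) [N _ HN] := @cvg_invS R.
    exists N; have := HN N (leqnn N).
    by rewrite sub0r normrN ger0_norm ?invr_ge0.
  have n0 : 0 < n.+1%:R^-1 :> R by rewrite invr_gt0.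
  have /choice[p Hp] : forall i : 'I_r, exists q : rat, `|x 0 i - ratr q| < n.+1%:R^-1.
    move=> i; have : x 0 i < x 0 i + n.+1%:R^-1 by rewrite ltrDl.
    move=> /rat_in_itvoo[q]; rewrite in_itv/= => /andP[q1 q2]; exists q.
    by rewrite distrC gtr0_norm ?subr_gt0// ltrBlDl.
  have bx : box ([ffun i => p i], n) x by move=> i /=; rewrite ffunE.
  exists ([ffun i => p i], n) => //; rewrite asboolT// => y yb.
  apply: eU; split => // i j; rewrite (ord1 i) /ball/=.
  have := bx j; have := yb j; rewrite /= ffunE => b1 b2.
  have -> : x 0 j - y 0 j = (x 0 j - ratr (p j)) - (y 0 j - ratr (p j)) by ring.
  apply: (le_lt_trans (ler_normB _ _)); apply: (lt_trans (ltrD b2 b1)).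
  have -> : e = e / 2 + e / 2 by field.
  exact: ltrD.
rewrite preimage_bigcup; apply: countable_bigcupT_measurable => [|c].
  exact: countableP.
case: ifP => _; last by rewrite preimage_set0.
have -> : X @^-1` box c = \bigcap_(i in [set: 'I_r])
    ((fun w => X w 0 i - ratr (c.1 i)) @^-1` [set y | `|y| < c.2.+1%:R^-1]).
  apply/seteqP; split => w /=; first by move=> h i _; exact: h.
  by move=> h i; exact: h.
apply: fin_bigcap_measurable => // i _.
have mf : measurable_fun [set: Om] (fun w => X w 0 i - ratr (c.1 i)).
  exact: measurable_funB.
rewrite -[X in measurable X]setTI; apply: mf => //.
have -> : [set y : R | `|y| < c.2.+1%:R^-1] = `](- c.2.+1%:R^-1), (c.2.+1%:R^-1)[%classic.
  by apply/seteqP; split => y /=; rewrite in_itv/= ltr_norml.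
exact: measurable_itv.
Qed.

Lemma continuous_measurable_rV (f : 'rV[R]_r -> R) : continuous f ->
  measurable_fun [set: V] (f : V -> R).
Proof.
move=> cf; apply: (measurability _ (RGenOpens.measurableE R)).
move=> _ [_ [a [b ->] <-]]; rewrite setTI; apply: sub_sigma_algebra.
by move/continuousP : cf; apply; exact: interval_open.
Qed.

Lemma dot_continuous (t : 'rV[R]_r) : continuous (dot t).
Proof.
move=> x; have Fx : Filter (nbhs x) by exact: nbhs_filter.
rewrite /dot; apply: cvg_big => [|i _]; first exact: add_continuous.
by apply: cvgM; [exact: cvg_cst|exact: coord_continuous].
Qed.

Lemma measurable_dot (t : 'rV[R]_r) : measurable_fun [set: V] (dot t : V -> R).
Proof. by apply: continuous_measurable_rV; exact: dot_continuous. Qed.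

Lemma bounded_measurable_continuous (f : 'rV[R]_r -> R) : continuous f ->
  (exists M, forall x, `|f x| <= M) -> bounded_measurable (f : V -> R).
Proof. by move=> cf bf; split => //; exact: continuous_measurable_rV. Qed.

(** For [Sigma = L^T *m L], a vector of independent standard normal variables
multiplied by [L] has covariance [Sigma]. *)
Lemma centered_mvnormal_exists (Sigma : 'M[R]_r) : Sigma^T = Sigma ->
  (forall t, 0 <= quad Sigma t) ->
  exists mu : probability V R, centered_mvnormal Sigma mu.
Proof.
move=> Ss Sp; have [s [L SL]] := gram_factorization Ss Sp.
have [d [Om [Q [g [mg lawg]]]]] := iid_normals R s.
pose X w : 'rV[R]_r := \row_j \sum_(k < s) L k j * g k w.
have mX : measurable_fun [set: Om] (X : Om -> V).
  apply: measurable_rV => j; rewrite /X; under eq_fun do rewrite mxE.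
  by apply: measurable_sum => k; exact: measurable_funM.
have [mu Hmu] := exists_law Q mX.
exists mu; split; first by split => //; exact: Sp.
move=> t A mA; rewrite Hmu.
pose c k := (t *m L^T) 0 k.
have -> : (t *m Sigma *m t^T) 0 0 = \sum_k c k ^+ 2.
  rewrite SL mulmxA -mulmxA -[L *m t^T]trmxK trmx_mul trmxK mxE.
  by apply: eq_bigr => k _; rewrite [_^T _ _]mxE expr2.
rewrite -lawg//; congr (Q _); apply/funext => w /=; congr A.
rewrite /X /c; under eq_bigr do rewrite mxE mulr_sumr.
rewrite exchange_big/=; apply: eq_bigr => k _.
by rewrite mxE mulr_suml; apply: eq_bigr => j _; rewrite [_^T _ _]mxE mulrA.
Qed.

(** The form [dot t] is normal of variance [quad Sigma t], and the sine part of the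
addition formula has mean zero by symmetry. *)
Lemma mvnormal_cos (Sigma : 'M[R]_r) (mu : probability V R) :
  centered_mvnormal Sigma mu -> forall t a,
  mean mu (fun x : V => cos (dot t x + a)) = cos a * expR (- (quad Sigma t / 2)).
Proof.
move=> [[_ Sp] lawmu] t a; pose v := quad Sigma t.
have v0 : 0 <= v by exact: Sp.
have law B : measurable B -> mu (dot t @^-1` B) = centered_normal v B.
  by move=> mB; exact: lawmu.
pose N := normal_prob (0 : R) 1; pose RR := measurableTypeR R.
have [nu Hnu] := exists_law mu (measurable_dot t : measurable_fun _ (_ : _ -> RR)).
have bf : bounded_measurable (fun y : RR => cos (y + a)).
  by apply: bounded_measurable_cos; exact: measurable_funD.
transitivity (mean nu (fun y : RR => cos (y + a))).
  by apply: (@mean_law _ _ V RR R mu nu (dot t)) => //; exact: measurable_dot.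
have ms : measurable_fun [set: RR] (fun z : RR => Num.sqrt v * z : RR) by exact: measurable_funM.
rewrite -(@mean_law _ _ RR RR R N nu (fun z => Num.sqrt v * z) _ ms bf); last first.
  move=> B mB; rewrite Hnu law//; have := @centered_normal_scale R (Num.sqrt v) B mB.
  by rewrite sqr_sqrtr.
have -> : (fun y : RR => cos (y + a)) \o (fun z : RR => Num.sqrt v * z) =
    (fun z : RR => cos a * cos (Num.sqrt v * z) + (- sin a) * sin (Num.sqrt v * z)).
  by apply/funext => z /=; rewrite cosD; ring.
have bcz : bounded_measurable (fun z : RR => cos (Num.sqrt v * z)) by exact: bounded_measurable_cos.
have bsz : bounded_measurable (fun z : RR => sin (Num.sqrt v * z)) by exact: bounded_measurable_sin.
rewrite meanD ?meanZ//; [|exact: bounded_measurableZ..].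
by rewrite mean_sin_normal mulr0 addr0 -/(normal_cf _) normal_cfE sqr_sqrtr.
Qed.

End BorelRowVectors.

(** * From characteristic functions to convergence in law *)

Section Bernstein.
Variable R : realType.

(** The mean of [phi] under the binomial law of parameters [n] and [u], computed one
Bernoulli trial at a time. *)
Fixpoint bern (n : nat) (phi : nat -> R) (u : R) : R :=
  if n is n'.+1 then u * bern n' (phi \o S) u + (1 - u) * bern n' phi u
  else phi 0%N.

Lemma bern_le n phi psi u : 0 <= u <= 1 -> (forall k, phi k <= psi k) ->
  bern n phi u <= bern n psi u.
Proof.
move=> /andP[u0 u1]; elim: n phi psi => //= n IH phi psi pp.
by rewrite lerD// ler_wpM2l ?subr_ge0// IH// => k; exact: pp.
Qed.

Lemma bern_lin n a phi psi u :
  bern n (fun k => a * phi k + psi k) u = a * bern n phi u + bern n psi u.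
Proof. by elim: n phi psi => //= n IH phi psi; rewrite !IH; ring. Qed.

Lemma bern_cst n a u : bern n (fun=> a) u = a.
Proof. by elim: n => //= n IH; rewrite (_ : (fun=> a) \o S = fun=> a)// IH; ring. Qed.

(** Squared bias plus variance of the binomial law. *)
Lemma bern_sqr n c u :
  bern n (fun k => (k%:R - c) ^+ 2) u = (n%:R * u - c) ^+ 2 + n%:R * u * (1 - u).
Proof.
elim: n c => [|n IH] c /=; first by rewrite !mul0r addr0.
have -> : (fun k => (k%:R - c) ^+ 2) \o S = (fun k => (k%:R - (c - 1)) ^+ 2).
  by apply/funext => k /=; rewrite -natr1; ring.
by rewrite !IH -natr1; ring.
Qed.

Section Multivariate.
Variable r : nat.
Local Notation point := {ffun 'I_r -> nat}.

Definition upd (kap : point) (i : 'I_r) (k : nat) : point :=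
  [ffun j => if j == i then k else kap j].

(** The mean of [phi] at a point whose coordinates in [l] are independent binomial
variables of parameters [n] and [u i]. *)
Fixpoint mbern (n : nat) (l : seq 'I_r) (phi : point -> R) (u : 'I_r -> R) : R :=
  if l is i :: l' then bern n (fun k => mbern n l' (fun kap => phi (upd kap i k)) u) (u i)
  else phi [ffun=> 0%N].

Lemma mbern_le n l phi psi u : (forall i, 0 <= u i <= 1) ->
  (forall k, phi k <= psi k) -> mbern n l phi u <= mbern n l psi u.
Proof.
move=> u01; elim: l phi psi => //= i l IH phi psi pp.
by apply: bern_le => // k; apply: IH => kap; exact: pp.
Qed.

Lemma mbern_lin n l a phi psi u :
  mbern n l (fun k => a * phi k + psi k) u = a * mbern n l phi u + mbern n l psi u.
Proof.
elim: l phi psi => //= i l IH phi psi; rewrite -bern_lin.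
by congr bern; apply/funext => k; rewrite IH.
Qed.

Lemma mbern_cst n l a u : mbern n l (fun=> a) u = a.
Proof.
elim: l => //= i l IH; rewrite -[RHS](bern_cst n a (u i)).
by congr bern; apply/funext => k; rewrite IH.
Qed.

Lemma mbern_coord n l (psi : nat -> R) u i : i \in l ->
  mbern n l (fun kap => psi (kap i)) u = bern n psi (u i).
Proof.
elim: l => //= j l IH; rewrite inE; have [->|ij /= il] := eqVneq i j.
  move=> _; congr bern; apply/funext => k; rewrite -[RHS](mbern_cst n l (psi k) u).
  by congr mbern; apply/funext => kap; rewrite ffunE eqxx.
rewrite -[RHS](bern_cst n (bern n psi (u i)) (u j)); congr bern.
apply/funext => k; rewrite -IH//; congr mbern.
by apply/funext => kap; rewrite ffunE (negbTE ij).
Qed.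

Lemma mbern_sum n l u (I : Type) (s : seq I) (F : I -> point -> R) :
  mbern n l (fun kap => \sum_(i <- s) F i kap) u = \sum_(i <- s) mbern n l (F i) u.
Proof.
elim: s => [|i s IH].
  rewrite big_nil; under [X in mbern _ _ X]eq_fun do rewrite big_nil.
  exact: mbern_cst.
rewrite big_cons -IH; under [X in mbern _ _ X]eq_fun do rewrite big_cons -[F i _]mul1r.
by rewrite mbern_lin mul1r.
Qed.

End Multivariate.
End Bernstein.

Section TrigonometricPolynomials.
Variables (R : realType) (r : nat).
Implicit Types (f g : 'rV[R]_r -> R).

Definition trig_poly (f : 'rV[R]_r -> R) : Prop :=
  exists s : seq (R * ('rV[R]_r * R)),
    forall x, f x = \sum_(c <- s) c.1 * cos (dot c.2.1 x + c.2.2).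

Lemma trig_poly_cos t a : trig_poly (fun x => cos (dot t x + a)).
Proof. by exists [:: (1, (t, a))] => x; rewrite big_seq1 mul1r. Qed.

Lemma trig_poly_cst c : trig_poly (fun=> c).
Proof.
exists [:: (c, (0, 0))] => x; rewrite big_seq1/= /dot big1 ?addr0 ?cos0 ?mulr1// => i _.
by rewrite mxE mul0r.
Qed.

Lemma trig_polyD f g : trig_poly f -> trig_poly g -> trig_poly (fun x => f x + g x).
Proof. by move=> [s fs] [s' gs]; exists (s ++ s') => x; rewrite fs gs big_cat. Qed.

Lemma trig_polyM f g : trig_poly f -> trig_poly g -> trig_poly (fun x => f x * g x).
Proof.
move=> [s fs] [s' gs].
pose pr (c c' : R * ('rV[R]_r * R)) := [::
  (c.1 * c'.1 / 2, (c.2.1 + c'.2.1, c.2.2 + c'.2.2));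
  (c.1 * c'.1 / 2, (c.2.1 - c'.2.1, c.2.2 - c'.2.2))].
exists (flatten [seq flatten [seq pr c c' | c' <- s'] | c <- s]) => x.
rewrite fs gs big_flatten big_map mulr_suml; apply: eq_bigr => c _.
rewrite big_flatten big_map mulr_sumr; apply: eq_bigr => c' _.
rewrite /pr big_cons big_seq1 /= dotDl.
have -> : dot (c.2.1 - c'.2.1) x = dot c.2.1 x - dot c'.2.1 x.
  by rewrite dotDl -scaleN1r dotZl mulN1r.
have -> : dot c.2.1 x + dot c'.2.1 x + (c.2.2 + c'.2.2) =
  (dot c.2.1 x + c.2.2) + (dot c'.2.1 x + c'.2.2) by ring.
have -> : dot c.2.1 x - dot c'.2.1 x + (c.2.2 - c'.2.2) =
  (dot c.2.1 x + c.2.2) - (dot c'.2.1 x + c'.2.2) by ring.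
move: (dot c.2.1 x + _) (dot c'.2.1 x + _) => A B.
by rewrite cosD cosB; field.
Qed.

Lemma trig_poly_bern n (phi : nat -> 'rV[R]_r -> R) (u : 'rV[R]_r -> R) :
  (forall k, trig_poly (phi k)) -> trig_poly u ->
  trig_poly (fun x => bern n (fun k => phi k x) (u x)).
Proof.
move=> tp tu; elim: n phi tp => [|n IH] phi tp /=; first exact: tp.
apply: trig_polyD; apply: trig_polyM => //.
- by apply: (IH (phi \o S)) => k; exact: tp.
- apply: trig_polyD; first exact: trig_poly_cst.
  have := trig_polyM (trig_poly_cst (-1)) tu.
  by under eq_fun do rewrite mulN1r.
- exact: IH.
Qed.

Lemma trig_poly_mbern n l (phi : {ffun 'I_r -> nat} -> R) (u : 'I_r -> 'rV[R]_r -> R) :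
  (forall i, trig_poly (u i)) ->
  trig_poly (fun x => mbern n l phi (fun i => u i x)).
Proof.
move=> tu; elim: l phi => [|i l IH] phi /=; first exact: trig_poly_cst.
exact: (@trig_poly_bern n (fun k x => mbern n l (fun kap => phi (upd kap i k)) (fun i => u i x))).
Qed.

Lemma bounded_measurable_trig_poly f : trig_poly f ->
  bounded_measurable (f : borel_rV R r -> R).
Proof.
move=> [s fs]; rewrite (_ : f = fun x => \sum_(c <- s) c.1 * cos (dot c.2.1 x + c.2.2)).
  apply: bounded_measurable_sum => c; apply: bounded_measurableZ.
  apply: bounded_measurable_cos; apply: measurable_funD => //; exact: measurable_dot.
by apply/funext.
Qed.

End TrigonometricPolynomials.

Section TrigonometricApproximation.
Variables (R : realType) (r : nat) (h : 'rV[R]_r -> R) (M K : R).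
Hypotheses (h_cont : continuous h) (h_bound : forall x, `|h x| <= M) (K_gt0 : 0 < K).

Definition cube : set 'rV[R]_r := [set x | forall i, x 0 i \in `[- K, K]].

Let L : R := 2 * K / pi.
Let L_gt0 : 0 < L. Proof. by rewrite divr_gt0 ?pi_gt0// mulr_gt0. Qed.
Let KL : K / L = pi / 2.
Proof.
have p0 : pi != 0 :> R by rewrite gt_eqF// pi_gt0.
have K0 : K != 0 by rewrite gt_eqF.
by rewrite /L; move: p0; move: (pi : R) => p p0; field; rewrite K0 p0.
Qed.

(** These functions are trigonometric polynomials with values between [0] and [1], and
they separate the points of the cube since [L] maps its sides to the interval on
which the sine is injective. *)
Definition sine_coord (i : 'I_r) (x : 'rV[R]_r) : R := (1 + sin (x 0 i / L)) / 2.

Let u := sine_coord.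

Let u01 i x : 0 <= u i x <= 1.
Proof.
by rewrite /u /sine_coord; have := sin_le1 (x 0 i / L); have := sin_geN1 (x 0 i / L); lra.
Qed.

Let M_ge0 : 0 <= M. Proof. exact: le_trans (normr_ge0 _) (h_bound 0). Qed.

Lemma trig_poly_sine_coord i : trig_poly (u i).
Proof.
have -> : u i = fun x => 2^-1 + 2^-1 * cos (dot (L^-1 *: delta_mx 0 i) x + - (pi / 2)).
  apply/funext => x; rewrite cosBpihalf /u /sine_coord dotZl.
  have -> : dot (delta_mx 0 i) x = x 0 i.
    rewrite /dot (bigD1 i)//= mxE !eqxx mul1r big1 ?addr0// => j /negbTE ji.
    by rewrite mxE ji andbF mul0r.
  by rewrite [L^-1 * _]mulrC; field.
apply: trig_polyD; first exact: trig_poly_cst.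
by apply: trig_polyM; [exact: trig_poly_cst|exact: trig_poly_cos].
Qed.

Let scaled (x : 'rV[R]_r) i : cube x -> x 0 i / L \in `[- (pi / 2), pi / 2].
Proof.
move=> /(_ i); rewrite !in_itv/= => /andP[a b]; rewrite -KL -mulNr.
by rewrite !ler_pM2r ?invr_gt0// a b.
Qed.

Let u_inj x y : cube x -> cube y -> (forall i, u i x = u i y) -> x = y.
Proof.
move=> cx cy uxy; apply/rowP => i.
have e : sin (x 0 i / L) = sin (y 0 i / L).
  by have := uxy i; rewrite /u /sine_coord; lra.
have := congr1 asin e; rewrite !sinK; [|exact: scaled..].
exact: (mulIf (invr_neq0 (lt0r_neq0 L_gt0))).
Qed.

Let u_cont i : continuous (u i).
Proof.
move=> x; have Fx : Filter (nbhs x) by exact: nbhs_filter.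
rewrite /u /sine_coord; apply: cvgM; last exact: cvg_cst.
apply: cvgD; first exact: cvg_cst.
apply: continuous_cvg; first exact: continuous_sin.
by apply: cvgM; [exact: coord_continuous|exact: cvg_cst].
Qed.

Let cube_compact : compact cube.
Proof.
apply: (@rV_compact R r (fun=> `[- K, K]%classic)) => i.
exact: segment_compact.
Qed.

Let dist (p : 'rV[R]_r * 'rV[R]_r) : R := \sum_i (u i p.1 - u i p.2) ^+ 2.

Let dist_cont : continuous dist.
Proof.
move=> p; have Fp : Filter (nbhs p) by exact: nbhs_filter.
rewrite /dist; apply: cvg_big => [|i _]; first exact: add_continuous.
have c : (u i q.1 - u i q.2) @[q --> p] --> u i p.1 - u i p.2.
  apply: cvgB.
    by apply: (@cvg_comp _ _ _ fst (u i) _ (nbhs p.1)); [exact: cvg_fst|exact: u_cont].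
  by apply: (@cvg_comp _ _ _ snd (u i) _ (nbhs p.2)); [exact: cvg_snd|exact: u_cont].
by rewrite expr2; under eq_fun do rewrite expr2; exact: cvgM.
Qed.

(** Uniform continuity of [h] on the cube, with distances measured by the coordinates
[u i].  The pairs of points where [h] varies by at least [e] form a compact set, on
which the sum of squares has a positive minimum because the [u i] separate points;
there a large multiple of it exceeds [2 * M]. *)
Lemma sine_modulus (e : R) : 0 < e -> exists2 c : R, 0 <= c &
  forall x y, cube x -> cube y ->
    `|h x - h y| <= e + c * \sum_i (u i x - u i y) ^+ 2.
Proof.
move=> e0.
pose F := [set p : 'rV[R]_r * 'rV[R]_r | (cube `*` cube) p /\ e <= `|h p.1 - h p.2|].
have dh_cont : continuous (fun p : 'rV[R]_r * 'rV[R]_r => `|h p.1 - h p.2|).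
  move=> p; apply: cvg_norm; apply: cvgB.
    by apply: (@cvg_comp _ _ _ fst h _ (nbhs p.1)); [exact: cvg_fst|exact: h_cont].
  by apply: (@cvg_comp _ _ _ snd h _ (nbhs p.2)); [exact: cvg_snd|exact: h_cont].
have cF : compact F.
  have -> : F = (cube `*` cube) `&` ((fun p => `|h p.1 - h p.2|) @^-1` [set y | e <= y]) by [].
  apply: compact_closedI; first exact: compact_setX.
  by apply: preimage_closed; [move=> p _; exact: dh_cont|exact: closed_ge].
have [F0|Fn0] := pselect (F !=set0); last first.
  exists 0 => // x y cx cy; rewrite mul0r addr0 leNgt; apply/negP => lt.
  by apply: Fn0; exists (x, y); split => //=; exact: ltW.
have [p /set_mem[[cp1 cp2] ep] minp] := compact_EVT_min F0 cF
  (continuous_subspaceT dist_cont).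
have d0 : 0 < dist p.
  have d_ge0 : 0 <= dist p by apply: sumr_ge0 => i _; exact: sqr_ge0.
  rewrite lt_neqAle d_ge0 andbT; apply/negP => /eqP/esym/eqP.
  rewrite psumr_eq0 => [/allP d0|i _]; last exact: sqr_ge0.
  have E : p.1 = p.2.
    apply: u_inj => // i; apply/eqP; rewrite -subr_eq0 -(sqrf_eq0 (_ - _)).
    by have := d0 i; rewrite mem_index_enum; apply.
  by move: ep; rewrite E subrr normr0 leNgt e0.
have q0 : 0 <= 2 * M / dist p by rewrite divr_ge0 ?(ltW d0)// mulr_ge0.
exists (2 * M / dist p) => // x y cx cy.
have s0 : 0 <= \sum_i (u i x - u i y) ^+ 2 by apply: sumr_ge0 => i _; exact: sqr_ge0.
have [xe|xe] := leP e `|h x - h y|; last first.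
  by rewrite (le_trans (ltW xe))// lerDl mulr_ge0.
have dm : dist p <= \sum_i (u i x - u i y) ^+ 2.
  by apply: (minp (x, y)); rewrite inE.
apply: (@le_trans _ _ (2 * M)).
  by apply: (le_trans (ler_normB _ _)); rewrite mulr_natl mulr2n lerD.
by rewrite ler_wpDl ?(ltW e0)// mulrAC ler_pdivlMr// ler_wpM2l// mulr_ge0.
Qed.

(** The Bernstein operator in the variables [u i].  It is a trigonometric polynomial in
[x]; it is bounded by [M] everywhere because it averages values of [h]; and on the
cube the binomial mean of the bound in [sine_modulus] is at most
[e / 2 + c * r / N]. *)
Lemma trig_poly_approx (e : R) : 0 < e -> exists2 g : 'rV[R]_r -> R, trig_poly g &
  (forall x, `|g x| <= M) /\ forall x, cube x -> `|h x - g x| <= e.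
Proof.
move=> e0; have e20 : 0 < e / 2 by rewrite divr_gt0.
have [c c0 Hc] := sine_modulus e20.
have [n nbig] : exists n : nat, c * r%:R / n.+1%:R <= e / 2.
  exists (Num.bound (c * r%:R / (e / 2))).
  have b := archi_boundP (divr_ge0 (mulr_ge0 c0 (ler0n R r)) (ltW e20)).
  rewrite ler_pdivrMr// [leRHS]mulrC -ler_pdivrMr//; apply: (le_trans (ltW b)).
  by rewrite ler_nat.
set N := n.+1 in nbig.
have N0 : 0 < N%:R :> R by [].
(* The truncation at [N], which binomial variables never exceed, keeps all the knots
   in the cube. *)
pose frac (k : nat) : R := (minn k N)%:R / N%:R.
pose knot (kap : {ffun 'I_r -> nat}) : 'rV[R]_r := \row_i (L * asin (2 * frac (kap i) - 1)).
have knot01 k : -1 <= 2 * frac k - 1 <= 1.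
  have m0 : 0 <= frac k by rewrite divr_ge0.
  have m1 : frac k <= 1 by rewrite ler_pdivrMr// mul1r ler_nat geq_minr.
  lra.
have knot_cube kap : cube (knot kap).
  move=> i; rewrite mxE in_itv/=.
  have [/andP[a b] _] := asin_def (knot01 (kap i)).
  have KE : K = L * (pi / 2) by rewrite -KL mulrC divfK// gt_eqF.
  by rewrite KE -mulrN !ler_pM2l// a b.
have knot_u kap i : u i (knot kap) = frac (kap i).
  have [_ sE] := asin_def (knot01 (kap i)).
  rewrite /u /sine_coord mxE mulrAC divff ?mul1r ?gt_eqF// sE.
  by field.
pose l := enum 'I_r.
pose g x := mbern N l (fun kap => h (knot kap)) (fun i => u i x).
have u01' x i : 0 <= u i x <= 1 by exact: u01.
exists g; first by apply: trig_poly_mbern => i; exact: trig_poly_sine_coord.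
split => x.
  rewrite ler_norml; apply/andP; split.
    rewrite -(mbern_cst N l (- M) (fun i => u i x)); apply: mbern_le => // kap.
    by have := h_bound (knot kap); rewrite ler_norml => /andP[].
  rewrite -(mbern_cst N l M (fun i => u i x)); apply: mbern_le => // kap.
  exact: le_trans (ler_norm _) (h_bound _).
move=> cx.
pose W kap := e / 2 + c * \sum_i ((kap i)%:R / N%:R - u i x) ^+ 2.
have hW kap : `|h x - h (knot kap)| <= W kap.
  apply: (le_trans (Hc _ _ cx (knot_cube kap))); rewrite lerD2l ler_wpM2l//.
  apply: ler_sum => i _; rewrite knot_u /frac.
  have /andP[ui0 ui1] := u01 i x.
  have [kN|Nk] := leqP (kap i) N; first by rewrite -sqrrN opprB.
  rewrite divff ?gt_eqF//.
  have k1 : 1 <= (kap i)%:R / N%:R :> R by rewrite ler_pdivlMr// mul1r ler_nat ltnW.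
  move: k1 ui1; move: (_ / _) (u i x) => y v y1 v1; nra.
have WE : mbern N l W (fun i => u i x) <= e.
  have -> : W = (fun kap => c * (\sum_i ((kap i)%:R / N%:R - u i x) ^+ 2) + e / 2).
    by apply/funext => kap; rewrite /W addrC.
  rewrite mbern_lin mbern_cst mbern_sum.
  rewrite -lerBrDr (_ : e - e / 2 = e / 2); last by field.
  apply: le_trans nbig; rewrite -mulrA ler_wpM2l//.
  apply: (@le_trans _ _ (\sum_(i < r) N%:R^-1)); last first.
    by rewrite sumr_const card_ord -[leLHS]mulr_natl.
  apply: ler_sum => i _.
  have -> : (fun kap : {ffun 'I_r -> nat} => ((kap i)%:R / N%:R - u i x) ^+ 2) =
    (fun kap => (N%:R^-1) ^+ 2 * ((kap i)%:R - N%:R * u i x) ^+ 2 + 0).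
    apply/funext => kap; rewrite addr0 -exprMn; congr (_ ^+ 2).
    by field; rewrite gt_eqF.
  rewrite mbern_lin mbern_cst addr0.
  rewrite (@mbern_coord _ _ _ _ (fun k => (k%:R - N%:R * u i x) ^+ 2)) ?mem_enum//.
  rewrite bern_sqr subrr expr0n add0r.
  have /andP[ui0 ui1] := u01 i x.
  have -> : N%:R^-1 ^+ 2 * (N%:R * u i x * (1 - u i x)) = N%:R^-1 * (u i x * (1 - u i x)).
    by field; rewrite gt_eqF.
  by rewrite ler_piMr ?invr_ge0//; nra.
have diff sg : `|sg| <= 1 -> mbern N l (fun kap => sg * (h x - h (knot kap))) (fun i => u i x) <= e.
  move=> sg1; apply: le_trans WE; apply: mbern_le => // kap.
  apply: (le_trans (ler_norm _)); rewrite normrM; apply: le_trans (hW kap).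
  by rewrite ler_piMl.
have gE sg : mbern N l (fun kap => sg * (h x - h (knot kap))) (fun i => u i x) = sg * (h x - g x).
  have -> : (fun kap => sg * (h x - h (knot kap))) = (fun kap => (- sg) * h (knot kap) + sg * h x).
    by apply/funext => kap; ring.
  by rewrite mbern_lin mbern_cst -/(g x); ring.
have d1 := diff 1; have d2 := diff (-1); rewrite !gE in d1 d2.
rewrite ler_norml lerNl; apply/andP; split.
  by rewrite -mulN1r; apply: d2; rewrite normrN1.
by rewrite -[_ - _]mul1r; apply: d1; rewrite normr1.
Qed.

End TrigonometricApproximation.

Section ContinuityTheorem.
Variables (R : realType) (r : nat) (S : eqType).
Variables (law : nat -> seq (R * S)) (X : nat -> S -> 'rV[R]_r).
Variable mu : probability (borel_rV R r) R.
Local Notation V := (borel_rV R r).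
Hypothesis law_pmf : forall n, is_pmf (law n).
Hypothesis cvg_cos : forall t a,
  expect (law n) (fun x => cos (dot t (X n x) + a)) @[n --> \oo] -->
  mean mu (fun x : V => cos (dot t x + a)).
Variable B : R.
Hypothesis second_moment_bound : forall n i, expect (law n) (fun x => X n x 0 i ^+ 2) <= B.

Lemma norm1_continuous : continuous (@norm1 R r).
Proof.
move=> x; have Fx : Filter (nbhs x) by exact: nbhs_filter.
rewrite /norm1; apply: cvg_big => [|i _]; first exact: add_continuous.
by apply: cvg_norm; exact: coord_continuous.
Qed.

Let outside (n : nat) : set V := [set x | n%:R < norm1 x].

Let measurable_outside n : measurable (outside n).
Proof.
apply: sub_sigma_algebra.
rewrite (_ : outside n = (@norm1 R r) @^-1` [set y | n%:R < y]) //.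
move/continuousP : norm1_continuous; apply; exact: open_gt.
Qed.

Lemma mean_outside_small (e : R) : 0 < e -> exists n : nat, mean mu \1_(outside n) <= e.
Proof.
move=> e0.
have h : (mu \o outside) n @[n --> \oo] --> mu (\bigcap_n outside n).
  apply: nonincreasing_cvg_mu => //.
  - by rewrite (le_lt_trans (probability_le1 mu _))// ltry.
  - exact: bigcapT_measurable.
  - move=> m n mn; apply/subsetPset => x; rewrite /outside/=.
    by apply: le_lt_trans; rewrite ler_nat.
have E0 : \bigcap_n outside n = set0.
  apply/seteqP; split => // x /(_ (Num.bound (norm1 x)) I).
  by rewrite /outside/= ltNge ltW// archi_boundP// norm1_ge0.
rewrite E0 measure0 in h.
have hr : mean mu \1_(outside n) @[n --> \oo] --> (0 : R).
  under eq_fun do rewrite mean_indic//.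
  by apply: (fine_cvg h).
move/cvgr0Pnorm_le : hr => /(_ e e0)[N _ HN].
exists N; exact: le_trans (ler_norm _) (HN N (leqnn N)).
Qed.

Lemma cvg_trig_poly g : trig_poly g ->
  expect (law n) (fun x => g (X n x)) @[n --> \oo] --> mean mu (g : V -> R).
Proof.
move=> [s gs].
have -> : mean mu (g : V -> R) = \sum_(c <- s) c.1 * mean mu (fun x : V => cos (dot c.2.1 x + c.2.2)).
  rewrite (_ : g = fun x => \sum_(c <- s) c.1 * cos (dot c.2.1 x + c.2.2)); last exact/funext.
  have bc c : bounded_measurable (fun x : V => cos (dot c.2.1 x + c.2.2)).
    by apply: bounded_measurable_cos; apply: measurable_funD => //; exact: measurable_dot.
  rewrite mean_sum => [|c]; last exact: bounded_measurableZ.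
  by apply: eq_bigr => c _; rewrite meanZ.
have -> : (fun n => expect (law n) (fun x => g (X n x))) = (fun n =>
    \sum_(c <- s) c.1 * expect (law n) (fun x => cos (dot c.2.1 (X n x) + c.2.2))).
  apply/funext => n; under [X in expect _ X]eq_fun do rewrite gs.
  by rewrite expect_sum; apply: eq_bigr => c _; rewrite expectZ.
apply: cvg_big => [|c _]; first exact: add_continuous.
by apply: cvgM; [exact: cvg_cst|exact: cvg_cos].
Qed.

(** The convergence extends from cosines to trigonometric polynomials.  The one that
approximates [h] does so on a cube only, but it is bounded by [M] like [h]; so it is
enough that little mass escapes the cube, uniformly in [n] by Chebyshev's inequality
for the laws of the [X n], and by continuity from above for [mu]. *)
Lemma cvg_expect_continuous (h : 'rV[R]_r -> R) : continuous h ->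
  (exists M, forall x, `|h x| <= M) ->
  expect (law n) (fun x => h (X n x)) @[n --> \oo] --> mean mu (h : V -> R).
Proof.
move=> hc hb; have [M hM] := hb.
have M0 : 0 <= M by exact: le_trans (normr_ge0 _) (hM 0).
have B0 : (0 < r)%N -> 0 <= B.
  move=> r0; apply: le_trans (second_moment_bound 0 (Ordinal r0)).
  by apply: expect_ge0 => // x _; exact: sqr_ge0.
have rB0 : 0 <= r%:R * B by case: (r) B0 => [_|k H]; rewrite ?mul0r// mulr_ge0// H.
apply/cvgrPdist_le => e e0.
pose d := e / 6; have d0 : 0 < d by rewrite divr_gt0.
have d2 : 0 < d / (2 * M + 1) by rewrite divr_gt0// ltr_wpDl// mulr_ge0.
have [n0 Hn0] := mean_outside_small d2.
(* The term [n0] deals with the mass of [mu] outside the cube, and the last one with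
   the mass of the laws. *)
pose K : R := n0%:R + 1 + 2 * M * (r%:R * B) / d.
have K1 : 1 <= K.
  by rewrite /K addrAC addrC lerDl addr_ge0// divr_ge0 ?(ltW d0)// mulr_ge0// mulr_ge0.
have K0 : 0 < K by exact: lt_le_trans K1.
have [g tg [gM gh]] := trig_poly_approx hc hM K0 d0.
have hgM x : `|h x - g x| <= 2 * M.
  by apply: (le_trans (ler_normB _ _)); rewrite mulr_natl mulr2n lerD.
have bh : bounded_measurable (h : V -> R) by exact: bounded_measurable_continuous.
have bg : bounded_measurable (g : V -> R) by exact: bounded_measurable_trig_poly.
have mu_part : `|mean mu (h : V -> R) - mean mu (g : V -> R)| <= 2 * d.
  have bhg : bounded_measurable (fun x : V => h x - g x).
    have := bounded_measurableD bh (bounded_measurableZ (-1) bg).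
    by under eq_fun do rewrite mulN1r.
  have -> : mean mu (h : V -> R) - mean mu (g : V -> R) = mean mu (fun x : V => h x - g x).
    rewrite -[mean mu g]mul1r -mulNr -meanZ// -meanD//; last exact: bounded_measurableZ.
    by congr mean; apply/funext => x; rewrite mulN1r.
  have bi := bounded_measurable_indic R (measurable_outside n0).
  have bb : bounded_measurable (fun x : V => d + 2 * M * \1_(outside n0) x).
    by apply: bounded_measurableD; [exact: bounded_measurable_cst|exact: bounded_measurableZ].
  apply: (le_trans (mean_norm_le mu bhg bb _)).
    move=> x; rewrite indicE; have [xo|xo] := boolP (x \in outside n0).
      by rewrite mulr1 (le_trans (hgM x))// lerDr ltW.
    rewrite mulr0 addr0; apply: gh => i; rewrite in_itv/= -ler_norml.
    rewrite notin_setE /outside/= in xo; move/negP : xo; rewrite -leNgt => xo.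
    apply: (le_trans (norm1_ge x i)); apply: (le_trans xo).
    by rewrite /K -addrA lerDl addr_ge0// divr_ge0 ?(ltW d0)// mulr_ge0// mulr_ge0.
  rewrite (meanD mu (bounded_measurable_cst _ d) (bounded_measurableZ (2 * M) bi)).
  rewrite mean_cst (meanZ mu _ bi).
  rewrite (_ : 2 * d = d + d) ?lerD2l; last by ring.
  apply: (le_trans (ler_wpM2l _ Hn0)); first exact: mulr_ge0.
  rewrite mulrCA ler_piMr ?(ltW d0)// ler_pdivrMr ?mul1r ?lerDl//.
  by rewrite ltr_wpDl// mulr_ge0.
have law_part n : `|expect (law n) (fun x => h (X n x)) - expect (law n) (fun x => g (X n x))| <= 2 * d.
  rewrite -expectB.
  apply: (@le_trans _ _ (expect (law n) (fun x => d + 2 * M / K ^+ 2 * \sum_i X n x 0 i ^+ 2))).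
    apply: expect_norm_le => // x _.
    have s0 : 0 <= \sum_i X n x 0 i ^+ 2 by apply: sumr_ge0 => i _; exact: sqr_ge0.
    have k0 : 0 <= 2 * M / K ^+ 2 by rewrite divr_ge0 ?sqr_ge0// mulr_ge0.
    have [/existsP[i Ki]|/existsPn nK] := boolP [exists i, K < `|X n x 0 i|].
      apply: (le_trans (hgM _)); rewrite ler_wpDl ?(ltW d0)//.
      rewrite mulrAC ler_pdivlMr ?exprn_gt0// ler_wpM2l ?mulr_ge0//.
      rewrite (bigD1 i)//= ler_wpDr ?sumr_ge0// => [j _|]; first exact: sqr_ge0.
      by rewrite -(real_normK (num_real (X n x 0 i))) lerXn2r ?nnegrE// ltW.
    rewrite ler_wpDr ?(mulr_ge0 k0 s0)//; apply: gh => i.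
    by rewrite in_itv/= -ler_norml leNgt nK.
  rewrite expectD (expect_cst _ (law_pmf n)) expectZ expect_sum.
  rewrite (_ : 2 * d = d + d) ?lerD2l; last by ring.
  have sB : \sum_(i < r) expect (law n) (fun x => X n x 0 i ^+ 2) <= r%:R * B.
    apply: (@le_trans _ _ (\sum_(i < r) B)); first exact: ler_sum.
    by rewrite sumr_const card_ord -[leLHS]mulr_natl.
  have k0 : 0 <= 2 * M / K ^+ 2 by rewrite divr_ge0 ?sqr_ge0// mulr_ge0.
  apply: (le_trans (ler_wpM2l k0 sB)).
  rewrite mulrAC ler_pdivrMr ?exprn_gt0// [leRHS]mulrC -ler_pdivrMr//.
  apply: (@le_trans _ _ K); last by rewrite expr2 ler_peMr// (le_trans ler01).
  by rewrite /K lerDr addr_ge0.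
move/cvgrPdist_le : (cvg_trig_poly tg) => /(_ d d0); apply: filterS => n hn.
have l := law_part n.
have -> : mean mu (h : V -> R) - expect (law n) (fun x => h (X n x)) =
  (mean mu (h : V -> R) - mean mu (g : V -> R)) +
  (mean mu (g : V -> R) - expect (law n) (fun x => g (X n x))) +
  (expect (law n) (fun x => g (X n x)) - expect (law n) (fun x => h (X n x))) by ring.
rewrite distrC in l.
apply: (le_trans (ler_normD _ _)); apply: (le_trans (lerD (ler_normD _ _) l)).
apply: (le_trans (lerD (lerD mu_part hn) (lexx _))).
rewrite /d; lra.
Qed.

End ContinuityTheorem.

(** * Outdegrees in a growing network *)

Section Graphs.

Definition tail_of (G : digraph) (a : 'I_(size (arcs G))) := (arc_ends a).1.

(** This property passes from the blocks to all the networks; it ensures that every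
possible latch has an outgoing arc. *)
Definition sink_only_south (G : digraph) : Prop :=
  forall v : 'I_(nvert G), (outdeg v == 0%N) = (v == south G).

Lemma bipolar_sink G : bipolar G -> sink_only_south G.
Proof.
move=> [_ _ h _] v; apply/idP/idP => /eqP; first by move/h => ->.
by move=> e; apply/eqP/h.
Qed.

Lemma outdeg_north_gt0 G : bipolar G -> (0 < outdeg (north G))%N.
Proof. by move=> bG; rewrite lt0n bipolar_sink//; have [] := bG. Qed.

Lemma outdeg_tail_gt0 G (a : 'I_(size (arcs G))) : (0 < outdeg (tail_of a))%N.
Proof.
rewrite /outdeg -has_count; apply/hasP; exists (arc_ends a); first exact: mem_tnth.
exact: eqxx.
Qed.

Lemma count_tail G (v : 'I_(nvert G)) : #|[pred a | tail_of (G := G) a == v]| = outdeg v.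
Proof.
rewrite /outdeg -sum1_card -sum1_count (big_tnth _ _ (arcs G)).
by apply: eq_bigl => a.
Qed.

Section Grow.
Variables (G H : digraph) (a : 'I_(size (arcs G))).
Hypothesis H_bipolar : bipolar H.

Let eq_ll (u v : 'I_(nvert G)) :
  ((lshift #|internal H| u : 'I_(nvert (grow H a))) == lshift #|internal H| v) = (u == v).
Proof. exact: (inj_eq (@lshift_inj _ _)). Qed.

Let eq_rr (i j : 'I_#|internal H|) :
  ((rshift (nvert G) i : 'I_(nvert (grow H a))) == rshift (nvert G) j) = (i == j).
Proof. exact: (inj_eq (@rshift_inj _ _)). Qed.

Let eq_lr (u : 'I_(nvert G)) (j : 'I_#|internal H|) :
  ((lshift #|internal H| u : 'I_(nvert (grow H a))) == rshift (nvert G) j) = false.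
Proof. exact: eq_lrshift. Qed.

Let eq_rl (u : 'I_(nvert G)) (j : 'I_#|internal H|) :
  ((rshift (nvert G) j : 'I_(nvert (grow H a))) == lshift #|internal H| u) = false.
Proof. exact: eq_rlshift. Qed.

Lemma fuse_north : fuse a (north H) = lshift _ (tail_of a).
Proof.
rewrite /fuse; case: pickP => [i /eqP E|_]; last by rewrite eqxx.
by have := enum_valP i; rewrite E inE eqxx.
Qed.

Lemma fuse_internal (i : 'I_#|internal H|) : fuse a (enum_val i) = rshift (nvert G) i.
Proof.
rewrite /fuse; case: pickP => [j /eqP /enum_val_inj -> //|/(_ i)].
by rewrite eqxx.
Qed.

Lemma poles_or_internal (w : 'I_(nvert H)) :
  [\/ w = north H, w = south H | exists i : 'I_#|internal H|, w = enum_val i].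
Proof.
have [->|wn] := eqVneq w (north H); first by constructor 1.
have [->|ws] := eqVneq w (south H); first by constructor 2.
have wi : w \in internal H by rewrite inE wn ws.
by constructor 3; exists (enum_rank_in wi w); rewrite enum_rankK_in.
Qed.

Lemma arc_not_from_south e : e \in arcs H -> e.1 != south H.
Proof.
move=> eH; rewrite -bipolar_sink// -lt0n /outdeg -has_count.
by apply/hasP; exists e.
Qed.

Lemma count_remaining (P : pred ('I_(nvert G) * 'I_(nvert G))) :
  (count P (take a (arcs G) ++ drop a.+1 (arcs G)) + P (arc_ends a) = count P (arcs G))%N.
Proof.
have aG := ltn_ord a.
rewrite -[in RHS](cat_take_drop a (arcs G)) (drop_nth (arc_ends a) aG) !count_cat /=.
have -> : nth (arc_ends a) (arcs G) a = arc_ends a.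
  by rewrite [RHS](tnth_nth (arc_ends a)).
by rewrite -addnA [(P _ + _)%N]addnC.
Qed.

Lemma outdeg_grow_lshift (v : 'I_(nvert G)) :
  outdeg (G := grow H a) (lshift _ v) =
  (if v == tail_of a then (outdeg v).-1 + outdeg (north H) else outdeg v)%N.
Proof.
rewrite /outdeg /= count_cat !count_map.
have -> : count (preim (fun e => (lshift #|internal H| e.1, lshift #|internal H| e.2))
    (fun e => e.1 == lshift #|internal H| v)) (take a (arcs G) ++ drop a.+1 (arcs G)) =
  count (fun e => e.1 == v) (take a (arcs G) ++ drop a.+1 (arcs G)).
  by apply: eq_count => e /=; rewrite eq_ll.
have -> : count (preim (fun e => (fuse a e.1, fuse a e.2))
    (fun e => e.1 == lshift #|internal H| v)) (arcs H) =
  (if v == tail_of a then outdeg (north H) else 0)%N.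
  have -> : count (preim (fun e => (fuse a e.1, fuse a e.2))
    (fun e => e.1 == lshift #|internal H| v)) (arcs H) =
    count (fun e => (v == tail_of a) && (e.1 == north H)) (arcs H).
    apply: eq_in_count => e eH /=.
    have := arc_not_from_south eH.
    case: (poles_or_internal e.1) => [->|->|[i ->]] ns.
    - by rewrite fuse_north eqxx andbT eq_ll eq_sym.
    - by rewrite eqxx in ns.
    - rewrite fuse_internal eq_rl.
      have := enum_valP i; rewrite inE => /andP[/negbTE -> _].
      by rewrite andbF.
  by case: (v == tail_of a) => //=; rewrite count_pred0.
have := count_remaining (fun e => e.1 == v); rewrite -/(outdeg v).
rewrite -/(tail_of a) [tail_of a == v]eq_sym.
case: (v == tail_of a) => /=; last by rewrite !addn0.
by move=> <-; rewrite addn1.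
Qed.

Lemma outdeg_grow_rshift (i : 'I_#|internal H|) :
  outdeg (G := grow H a) (rshift _ i) = outdeg (enum_val i).
Proof.
rewrite /outdeg /= count_cat !count_map.
rewrite (@eq_count _ _ pred0) ?count_pred0 ?add0n => [|e /=].
  apply: eq_in_count => e eH /=; have := arc_not_from_south eH.
  have := enum_valP i; rewrite inE => /andP[/negbTE ni /negbTE si].
  case: (poles_or_internal e.1) => [->|->|[j ->]] ns.
  - by rewrite fuse_north eq_lr eq_sym ni.
  - by rewrite eqxx in ns.
  - by rewrite fuse_internal eq_rr (inj_eq enum_val_inj).
by rewrite eq_lr.
Qed.

Lemma grow_sink : sink_only_south G -> sink_only_south (grow H a).
Proof.
move=> sG w; case: (splitP w) => [v wv|i wi].
  have -> : w = lshift _ v by apply: val_inj.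
  rewrite outdeg_grow_lshift /= eq_ll.
  case: (eqVneq v (tail_of a)) => [->|_]; last exact: sG.
  rewrite addn_eq0 [outdeg (north H) == 0%N]eqn0Ngt outdeg_north_gt0// andbF.
  by rewrite -sG eqn0Ngt outdeg_tail_gt0.
have -> : w = rshift _ i by apply: val_inj.
rewrite outdeg_grow_rshift bipolar_sink// /= eq_rl.
by have := enum_valP i; rewrite inE => /andP[_ /negbTE ->].
Qed.

End Grow.

Section VertexSums.
Variable R : realType.

(** The total weight and the numbers of vertices of given outdegrees are all sums of
this kind, which [vsum_grow] updates at once. *)
Definition vsum (G : digraph) (F : nat -> R) : R := \sum_(v : 'I_(nvert G)) F (outdeg v).

Definition isum (H : digraph) (F : nat -> R) : R := \sum_(v in internal H) F (outdeg v).

(** Only the tail of the replaced arc changes its outdegree among the old vertices: it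
loses that arc and gains those of the north pole of [H].  The head keeps its
outdegree since the south pole of [H] has no outgoing arc, and the internal vertices
of [H] keep theirs. *)
Lemma vsum_grow G H (a : 'I_(size (arcs G))) F : bipolar H ->
  vsum (grow H a) F = vsum G F
    + (F ((outdeg (tail_of a)).-1 + outdeg (north H))%N - F (outdeg (tail_of a)))
    + isum H F.
Proof.
move=> bH; rewrite /vsum /= big_split_ord/=; congr (_ + _).
  rewrite (bigD1 (tail_of a))//= [in RHS](bigD1 (tail_of a))//=.
  rewrite outdeg_grow_lshift// eqxx.
  under eq_bigr => v va do rewrite outdeg_grow_lshift// (negbTE va).
  by ring.
rewrite /isum [RHS]big_enum_val/=; apply: eq_bigr => i _.
by rewrite outdeg_grow_rshift.
Qed.

Lemma outdeg_countE G k : (outdeg_count G k)%:R = vsum G (fun d => (d == k)%:R) :> R.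
Proof.
rewrite /outdeg_count -sum1_card /vsum natr_sum big_mkcond/=; apply: eq_bigr => v _.
by rewrite inE; case: ifP.
Qed.

Lemma vsum_split G F (n : nat) : (forall d, (n < d)%N -> F d = 0) ->
  vsum G F = \sum_(d < n.+1) F d * (outdeg_count G d)%:R.
Proof.
move=> F0; under [RHS]eq_bigr do rewrite outdeg_countE /vsum mulr_sumr.
rewrite exchange_big/=; apply: eq_bigr => v _.
have [vn|nv] := leqP (outdeg v) n.
  rewrite (bigD1 (Ordinal (vn : (outdeg v < n.+1)%N)))//= eqxx mulr1 big1 ?addr0// => i iv.
  have /negbTE -> : outdeg v != i; last by rewrite mulr0.
  by apply: contra iv => /eqP e; apply/eqP/val_inj.
rewrite F0// big1// => i _; have /negbTE -> : outdeg v != i; last by rewrite mulr0.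
by rewrite neq_ltn orbC (leq_ltn_trans _ nv)// -ltnS.
Qed.

Lemma vsumD G F F' : vsum G (fun d => F d + F' d) = vsum G F + vsum G F'.
Proof. exact: big_split. Qed.

Lemma vsumZ G c F : vsum G (fun d => c * F d) = c * vsum G F.
Proof. by rewrite /vsum mulr_sumr. Qed.

Lemma vsum_le G F F' : (forall d, F d <= F' d) -> vsum G F <= vsum G F'.
Proof. by move=> FF; apply: ler_sum => v _. Qed.

End VertexSums.
End Graphs.

(** * One step of the growth *)

Section StepLaw.
Variables (R : realType) (chi rho : R) (m : nat) (C : 'I_m -> digraph) (p : 'I_m -> R).
Hypotheses (chi_ge0 : 0 <= chi) (chi_rho_gt0 : 0 < chi + rho).
Hypothesis C_bipolar : forall i, bipolar (C i).
Hypotheses (p_gt0 : forall i, 0 < p i) (p_sum1 : \sum_(i < m) p i = 1).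

(** The value at outdegree [0] accounts for the south pole, which is never a latch. *)
Definition latch_weight (d : nat) : R := if d == 0%N then 0 else weight chi rho d.

Definition total_weight (G : digraph) : R := vsum G latch_weight.

(** What the induction along the growth retains of bipolarity. *)
Definition network (G : digraph) : Prop := sink_only_south G /\ north G != south G.

Lemma weight_ge1 d : (0 < d)%N -> weight chi rho 1 <= weight chi rho d.
Proof. by move=> d0; rewrite /weight lerD2r ler_wpM2l// ler_nat. Qed.

Lemma weight1_gt0 : 0 < weight chi rho 1.
Proof. by rewrite /weight mulr1. Qed.

Lemma weight_gt0 d : (0 < d)%N -> 0 < weight chi rho d.
Proof. by move=> d0; exact: lt_le_trans weight1_gt0 (weight_ge1 d0). Qed.

Lemma latch_weight_ge0 d : 0 <= latch_weight d.
Proof. by case: d => [|d]; rewrite /latch_weight//= ltW// weight_gt0. Qed.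

Lemma total_weight_ge1 G : network G -> weight chi rho 1 <= total_weight G.
Proof.
move=> [sG ns]; rewrite /total_weight /vsum (bigD1 (north G))//=.
rewrite ler_wpDr ?sumr_ge0// => [v _|]; first exact: latch_weight_ge0.
have d0 : (0 < outdeg (north G))%N by rewrite lt0n sG.
by rewrite /latch_weight -[outdeg _ == 0%N]negbK -lt0n d0 /= weight_ge1.
Qed.

Lemma total_weight_gt0 G : network G -> 0 < total_weight G.
Proof. by move=> nG; exact: lt_le_trans weight1_gt0 (total_weight_ge1 nG). Qed.

Lemma total_weightE G : sink_only_south G ->
  \sum_(u : 'I_(nvert G) | u != south G) weight chi rho (outdeg u) = total_weight G.
Proof.
move=> sG; rewrite /total_weight /vsum big_mkcond/=; apply: eq_bigr => v _.
by rewrite /latch_weight sG; case: (v == south G).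
Qed.

Lemma network_block i : network (C i).
Proof. by split; [exact: bipolar_sink|have [] := C_bipolar i]. Qed.

Lemma network_grow G i (a : 'I_(size (arcs G))) : network G -> network (grow (C i) a).
Proof.
move=> [sG ns]; split; first exact: grow_sink.
by rewrite /= (inj_eq (@lshift_inj _ _)).
Qed.

Definition step_law (G : digraph) : seq (R * digraph) :=
  flatten [seq flatten [seq
     [seq (latch_prob chi rho v * ((outdeg v)%:R^-1 * p i), grow (C i) a)
     | i <- enum 'I_m]
     | a <- [seq a <- enum 'I_(size (arcs G)) | tail_of a == v]]
     | v <- [seq v <- enum 'I_(nvert G) | v != south G]].

Lemma expect_step_law G F : expect (step_law G) F =
  \sum_(v : 'I_(nvert G) | v != south G) latch_prob chi rho v *
    \sum_(a : 'I_(size (arcs G)) | tail_of a == v) (outdeg v)%:R^-1 *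
      \sum_(i < m) p i * F (grow (C i) a).
Proof.
rewrite /expect /step_law big_flatten big_map big_filter big_enum_cond/=.
apply: eq_bigr => v _; rewrite mulr_sumr big_flatten big_map big_filter big_enum_cond/=.
apply: eq_bigr => a _; rewrite big_map big_enum/= !mulr_sumr.
by apply: eq_bigr => i _; rewrite /= -!mulrA.
Qed.

Lemma step_probE G G' : step_prob chi rho C p G G' =
  expect (step_law G) (fun x => (x == G')%:R).
Proof.
rewrite expect_step_law; apply: eq_bigr => v _; congr (_ * _).
apply: eq_bigr => a _; congr (_ * _); rewrite big_mkcond/=.
by apply: eq_bigr => i _; case: eqP; rewrite ?mulr1 ?mulr0.
Qed.

(** The arc is uniform among those that leave the latch, hence immaterial for a quantity
that depends on the outdegree of the latch and on the block only. *)
Lemma expect_step_latch G F (phi : nat -> 'I_m -> R) : network G ->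
  (forall i a, F (grow (C i) a) = phi (outdeg (tail_of (G := G) a)) i) ->
  expect (step_law G) F =
  (total_weight G)^-1 * vsum G (fun d => latch_weight d * \sum_(i < m) p i * phi d i).
Proof.
move=> [sG ns] Fphi; rewrite expect_step_law /vsum mulr_sumr big_mkcond/=.
apply: eq_bigr => v _; rewrite /latch_weight sG; case: eqVneq => [_|vs] /=.
  by rewrite mul0r mulr0.
have dv : (outdeg v)%:R != 0 :> R by rewrite pnatr_eq0 sG.
have -> : \sum_(a : 'I_(size (arcs G)) | tail_of a == v)
    (outdeg v)%:R^-1 * \sum_(i < m) p i * F (grow (C i) a) =
    \sum_(i < m) p i * phi (outdeg v) i.
  rewrite (eq_bigr (fun=> (outdeg v)%:R^-1 * \sum_(i < m) p i * phi (outdeg v) i)).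
    by rewrite sumr_const count_tail -[LHS]mulr_natl mulrA divff// mul1r.
  move=> a /eqP av; congr (_ * _); apply: eq_bigr => i _.
  by rewrite Fphi av.
by rewrite /latch_prob total_weightE// mulrA [_ / _]mulrC.
Qed.

Lemma step_law_pmf G : network G -> is_pmf (step_law G).
Proof.
move=> nG; have [sG ns] := nG; split.
  move=> z /flatten_mapP[v]; rewrite mem_filter => /andP[vs _].
  move=> /flatten_mapP[a _ /mapP[i _ ->]] /=.
  have w0 u : u != south G -> 0 <= weight chi rho (outdeg u).
    by move=> us; rewrite ltW// weight_gt0// lt0n sG.
  have p0 := ltW (p_gt0 i).
  apply: mulr_ge0; last by rewrite mulr_ge0// invr_ge0.
  by rewrite /latch_prob total_weightE// divr_ge0 ?w0// ltW// total_weight_gt0.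
have := expect_step_latch (F := fun=> 1) (phi := fun _ _ => 1) nG (fun _ _ => erefl).
rewrite {1}/expect; under eq_bigr do rewrite mulr1.
move=> ->; under [X in vsum _ X]eq_fun => d.
  under eq_bigr do rewrite mulr1. rewrite p_sum1 mulr1. over.
by rewrite mulVf// gt_eqF// total_weight_gt0.
Qed.

Lemma charged_step G y : charged (step_law G) y ->
  exists i (a : 'I_(size (arcs G))), y = grow (C i) a.
Proof.
move=> [z _ /flatten_mapP[v _ /flatten_mapP[a _ /mapP[i _ [_ ->]]]]].
by exists i, a.
Qed.

End StepLaw.

(** * Discrete random variables *)

Section DiscreteVariable.
Context d (T : measurableType d) (R : realType) (P : probability T R).
Variables (S : countType) (X : T -> S).
Hypothesis measurable_fiber : forall x, measurable [set w | X w = x].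

Lemma measurable_discrete (Phi : S -> R) : measurable_fun [set: T] (Phi \o X).
Proof.
move=> _ A mA; rewrite setTI.
have -> : (Phi \o X) @^-1` A = \bigcup_(i in [set: nat])
    [set w | pickle (X w) = i /\ A (Phi (X w))].
  by apply/seteqP; split => [w /= Aw|w [i _ [_ ?]]//]; exists (pickle (X w)).
apply: bigcup_measurable => i _.
case E : (@pickle_inv S i) => [x|].
  have [Ax|nAx] := pselect (A (Phi x)).
    rewrite (_ : [set w | _] = [set w | X w = x]) //.
    apply/seteqP; split => w /=.
      by move=> [wi _]; move: E; rewrite -wi pickleK_inv => -[].
    by move=> ->; split => //; have := @pickle_invK S i; rewrite E /= => ->.
  rewrite (_ : [set w | _] = set0) //.
  apply/seteqP; split => w //= [wi Aw].
  by apply: nAx; move: E; rewrite -wi pickleK_inv => -[<-].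
rewrite (_ : [set w | _] = set0) //.
by apply/seteqP; split => w //= [wi Aw]; move: E; rewrite -wi pickleK_inv.
Qed.

Lemma bounded_measurable_discrete (Phi : S -> R) (M : R) :
  (forall x, `|Phi x| <= M) -> bounded_measurable (Phi \o X).
Proof. by move=> PhiM; split; [exact: measurable_discrete|exists M => w; exact: PhiM]. Qed.

(** Sigma-additivity over the countably many fibers of [X].  It serves to sum a
coordinate out of the law of a trajectory. *)
Lemma prob_scale_fibers (E F : set T) (c : R) : measurable E -> measurable F ->
  (forall x, P (E `&` [set w | X w = x]) = (P (F `&` [set w | X w = x]) * c%:E)%E) ->
  P E = (P F * c%:E)%E.
Proof.
move=> mE mF EF.
pose fiber i := [set w | pickle (X w) = i].
have fiberE i : fiber i = set0 \/ exists x, fiber i = [set w | X w = x].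
  case E' : (@pickle_inv S i) => [x|]; [right; exists x|left]; apply/seteqP; split => w //=.
  - by move=> wi; move: E'; rewrite -wi pickleK_inv => -[].
  - by move=> wx; rewrite /fiber /= wx; have := @pickle_invK S i; rewrite E' /= => ->.
  - by move=> wi; move: E'; rewrite -wi pickleK_inv.
have split_fibers A : measurable A -> P A = (\sum_(i <oo) P (A `&` fiber i))%E.
  move=> mA; rewrite -[in LHS](_ : \bigcup_i (A `&` fiber i) = A); last first.
    by apply/seteqP; split => [w [i _ []]//|w Aw]; exists (pickle (X w)).
  rewrite measure_bigcup//.
  - by apply: eq_eseriesl => i; rewrite in_setT.
  - move=> i _; apply: measurableI => //.
    by have [->|[x ->]] := fiberE i.
  - by move=> i j _ _ [w [[_ <-] [_ <-]]].
rewrite (split_fibers _ mE) (split_fibers _ mF) muleC -nneseriesZl//.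
apply: eq_eseriesr => i _; rewrite muleC.
have [->|[x ->]] := fiberE i; last exact: EF.
by rewrite !setI0 measure0 mul0e.
Qed.

(** The event that [X] is not in [s] is negligible, and on its complement [g] is the sum
of its restrictions to the fibers over [s]. *)
Lemma mean_fibers (s : seq S) (g : T -> R) : uniq s ->
  P [set w | X w \in s] = 1%E -> bounded_measurable g ->
  mean P g = \sum_(x <- s) mean P (fun w => g w * \1_[set w | X w = x] w).
Proof.
move=> us Xs bg; have [mg [M gM]] := bg.
have mXs : measurable [set w | X w \in s].
  rewrite (_ : [set w | _] = \bigcup_(x in [set` s]) [set w | X w = x]).
    by apply: fin_bigcup_measurable.
  by apply/seteqP; split => [w /= ws|w [x /= xs ->]//]; exists (X w).
pose N := ~` [set w | X w \in s].
have mN : measurable N by exact: measurableC.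
have bI x : bounded_measurable (fun w => g w * \1_[set w | X w = x] w).
  by apply: bounded_measurableM => //; exact: bounded_measurable_indic.
have bN : bounded_measurable (fun w => g w * \1_N w).
  by apply: bounded_measurableM => //; exact: bounded_measurable_indic.
rewrite -mean_sum//.
have -> : mean P g = mean P (fun w => (\sum_(x <- s) g w * \1_[set w | X w = x] w)
    + g w * \1_N w).
  congr (mean P _); apply/funext => w; rewrite -mulr_sumr -mulrDr -[LHS]mulr1.
  congr (_ * _); have [ws|nws] := boolP (X w \in s).
    rewrite (bigD1_seq (X w))//= big1 => [|x xw].
      rewrite !indicE mem_set// memNset ?addr0 ?mulr0//; exact/contrapT.
    by rewrite indicE memNset//= => e; rewrite e eqxx in xw.
  rewrite big_seq big1 => [|x xs].
    by rewrite indicE mem_set ?add0r//; exact/negP.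
  by rewrite indicE memNset//= => e; rewrite e xs in nws.
rewrite meanD//; last exact: bounded_measurable_sum.
rewrite [X in _ + X](_ : _ = 0) ?addr0//.
apply/eqP; rewrite -normr_le0.
have -> : 0 = mean P (fun w => `|M| * \1_N w).
  rewrite meanZ ?mean_indic//; last exact: bounded_measurable_indic.
  by rewrite probability_setC// Xs subee// mulr0.
apply: mean_norm_le => // [|w].
  by apply: bounded_measurableZ; exact: bounded_measurable_indic.
rewrite normrM; apply: ler_pM => //; first exact: le_trans (gM w) (ler_norm _).
by rewrite indicE; case: (_ \in _); rewrite ?normr1 ?normr0.
Qed.

Lemma prob_mem_seq (s : seq S) : uniq s ->
  fine (P [set w | X w \in s]) = \sum_(x <- s) fine (P [set w | X w = x]).
Proof.
move=> us; have mXs : measurable [set w | X w \in s].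
  rewrite (_ : [set w | _] = \bigcup_(x in [set` s]) [set w | X w = x]).
    by apply: fin_bigcup_measurable.
  by apply/seteqP; split => [w /= ws|w [x /= xs ->]//]; exists (X w).
rewrite -mean_indic//; under [RHS]eq_bigr do rewrite -mean_indic//.
rewrite -mean_sum => [|x]; last exact: bounded_measurable_indic.
congr (mean P _); apply/funext => w; have [ws|nws] := boolP (X w \in s).
  rewrite (bigD1_seq (X w))//= big1 => [|x xw]; first by rewrite !indicE !mem_set ?addr0.
  by rewrite indicE memNset//= => e; rewrite e eqxx in xw.
rewrite big_seq big1 => [|x xs]; first by rewrite indicE memNset//=; exact/negP.
by rewrite indicE memNset//= => e; rewrite e xs in nws.
Qed.

End DiscreteVariable.

(** The pairs of [l] that share a point are gathered. *)
Lemma expect_atoms (R : realType) (S : eqType) (l : seq (R * S)) (F : S -> R) :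
  expect l F =
  \sum_(x <- undup [seq z.2 | z <- l]) F x * expect l (fun y => (y == x)%:R).
Proof.
under eq_bigr do rewrite -expectZ; rewrite -expect_sum /expect.
rewrite big_seq [RHS]big_seq; apply: eq_bigr => z zl; congr (_ * _).
have zs : z.2 \in undup [seq z.2 | z <- l] by rewrite mem_undup; exact: map_f.
rewrite (bigD1_seq z.2)//= ?undup_uniq// eqxx mulr1 big1 ?addr0// => x xz.
by rewrite eq_sym (negbTE xz) mulr0.
Qed.

(** * The law of the network process *)

Section ProcessLaw.
Context d (T : measurableType d) (R : realType) (P : probability T R).
Variables (chi rho : R) (m : nat) (C : 'I_m -> digraph) (p : 'I_m -> R).
Variable B : nat -> T -> digraph.
Hypotheses (chi_ge0 : 0 <= chi) (chi_rho_gt0 : 0 < chi + rho).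
Hypothesis C_bipolar : forall i, bipolar (C i).
Hypotheses (p_gt0 : forall i, 0 < p i) (p_sum1 : \sum_(i < m) p i = 1).
Hypothesis B_process : bipolar_network_process chi rho C p P B.

Let measurable_B n G : measurable [set w | B n w = G].
Proof. by have [] := B_process. Qed.

Let trajectory (j n : nat) (G : nat -> digraph) : set T :=
  [set w | forall k, (j <= k <= n)%N -> B k w = G k].

Let measurable_trajectory j n G : measurable (trajectory j n G).
Proof.
rewrite (_ : trajectory j n G =
  \bigcap_(k in [set k | (j <= k <= n)%N]) [set w | B k w = G k]) //.
by apply: bigcap_measurableType => k _.
Qed.

Let trajectory_fiber j n G x : (j <= n)%N ->
  trajectory j.+1 n G `&` [set w | B j w = x] =
  trajectory j n (fun k => if k == j then x else G k).
Proof.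
move=> jn; apply/seteqP; split => w /= => [[wG wx] k /andP[jk kn]|wG].
  case: eqVneq => [->//|kj]; apply: wG.
  by rewrite kn andbT ltn_neqAle eq_sym kj.
split => [k /andP[jk kn]|]; last by rewrite wG ?leqnn// eqxx.
by rewrite wG ?kn ?andbT ?(ltnW jk)// gtn_eqF.
Qed.

(** Induction on [j], summing out the coordinate [j]: it is not among the last two
coordinates, on which alone the transition depends. *)
Let markov j n G : (j <= n)%N ->
  P (trajectory j n.+1 G) =
  (P (trajectory j n G) * (step_prob chi rho C p (G n) (G n.+1))%:E)%E.
Proof.
elim: j G => [|j IH] G jn.
  by have [_ _ /(_ n G)] := B_process.
apply: (@prob_scale_fibers _ _ _ P _ (B j)) => // x.
rewrite !trajectory_fiber ?(ltnW jn)//; last by rewrite ltnW// ltnS ltnW.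
rewrite IH ?(ltnW jn)//.
by rewrite !gtn_eqF// ltnW.
Qed.

Lemma prob_transition n G G' :
  P ([set w | B n.+1 w = G'] `&` [set w | B n w = G]) =
  (P [set w | B n w = G] * (step_prob chi rho C p G G')%:E)%E.
Proof.
have := @markov n n (fun k => if k == n then G else G') (leqnn n).
rewrite eqxx gtn_eqF//.
have -> : trajectory n n (fun k => if k == n then G else G') = [set w | B n w = G].
  apply/seteqP; split => w /= => [/(_ n)|wG k]; first by rewrite leqnn eqxx; exact.
  by rewrite -eqn_leq => /eqP <-; rewrite eqxx.
move=> <-; congr (P _).
have -> : [set w | B n w = G] = trajectory n n (fun k => if k == n then G else G').
  apply/seteqP; split => w /= => [wG k|/(_ n)]; last by rewrite leqnn eqxx; exact.
  by rewrite -eqn_leq => /eqP <-; rewrite eqxx.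
apply/seteqP; split => w /= => [[wG' wG] k /andP[nk]|wG].
  rewrite leq_eqVlt ltnS => /predU1P[->|kn]; first by rewrite gtn_eqF.
  by apply: wG; rewrite nk.
split => [|k /andP[nk kn]]; last by apply: wG; rewrite nk leqW.
by have := wG n.+1; rewrite leqnSn leqnn gtn_eqF//; exact.
Qed.

Definition initial_law : seq (R * digraph) :=
  [seq (fine (P [set w | B 0%N w = G]), G) | G <- undup (codom C)].

Fixpoint network_law n : seq (R * digraph) :=
  if n is n'.+1 then bind (network_law n') (step_law chi rho C p) else initial_law.

Lemma initial_law_pmf : is_pmf initial_law.
Proof.
split; first by move=> z /mapP[G _ ->]; exact: fine_ge0.
rewrite big_map/= -prob_mem_seq ?undup_uniq//.
have [_ B0 _] := B_process; rewrite -[RHS]/(fine 1%E) -B0; congr (fine (P _)).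
apply/seteqP; split => w /=; rewrite mem_undup; first by move/codomP.
by move=> [i ->]; exact: codom_f.
Qed.

Lemma charged_network n G : charged (network_law n) G -> network G.
Proof.
suff: is_pmf (network_law n) /\ (forall G, charged (network_law n) G -> network G).
  by move=> [_]; exact.
elim: n => [|n [IHp IHn]].
  split; first exact: initial_law_pmf.
  move=> {}G [q _ /mapP[H]]; rewrite mem_undup => /codomP[i ->] [_ ->].
  exact: network_block.
split; first by apply: pmf_bind => // x /IHn; exact: step_law_pmf.
move=> {}G /(charged_bind IHp)[H /IHn nH /charged_step[i [a ->]]].
exact: network_grow.
Qed.

Lemma network_law_pmf n : is_pmf (network_law n).
Proof.
elim: n => [|n IH]; first exact: initial_law_pmf.
by apply: pmf_bind => // x /charged_network; exact: step_law_pmf.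
Qed.

Lemma network_law_seq n :
  (forall G, fine (P [set w | B n w = G]) =
             expect (network_law n) (fun x => (x == G)%:R)) ->
  P [set w | B n w \in undup [seq z.2 | z <- network_law n]] = 1%E.
Proof.
move=> lawE; apply/eqP; rewrite -[X in X == _]fineK ?fin_num_measure//; last first.
  rewrite (_ : [set w | _] = \bigcup_(x in [set` undup [seq z.2 | z <- network_law n]])
     [set w | B n w = x]); first by apply: fin_bigcup_measurable.
  by apply/seteqP; split => [w /= ws|w [x /= xs ->]//]; exists (B n w).
rewrite prob_mem_seq ?undup_uniq//; apply/eqP; congr (_%:E).
under eq_bigr do rewrite lawE -[expect _ _]mul1r.
by rewrite -(expect_atoms _ (fun=> 1)) expect_cst//; exact: network_law_pmf.
Qed.

(** Only finitely many networks are possible at time [n], and summing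
[prob_transition] over them is one step of the chain of finitely supported laws. *)
Lemma network_lawE n G : fine (P [set w | B n w = G]) =
  expect (network_law n) (fun x => (x == G)%:R).
Proof.
elim: n G => [|n IH] G.
  rewrite /expect big_map/=; have [Gs|Gs] := boolP (G \in undup (codom C)).
    rewrite (bigD1_seq G)//= ?undup_uniq// eqxx mulr1 big1 ?addr0// => x /negbTE ->.
    by rewrite mulr0.
  rewrite big_seq big1 => [|x xs]; last first.
    by case: eqVneq => [xG|_]; rewrite ?mulr0//; rewrite -xG xs in Gs.
  suff -> : P [set w | B 0%N w = G] = 0%E by [].
  apply/eqP; rewrite eq_le measure_ge0 andbT.
  have [_ B0 _] := B_process.
  have m0 : measurable [set w | exists i, B 0%N w = C i].
    rewrite (_ : [set w | _] = \bigcup_i [set w | B 0%N w = C i]).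
      by apply: fin_bigcup_measurable.
    by apply/seteqP; split => [w [i wi]|w [i _ wi]]; exists i.
  have <- : P (~` [set w | exists i, B 0%N w = C i]) = 0%E.
    by rewrite probability_setC// B0 subee.
  apply: le_measure; rewrite ?inE//; first exact: measurableC.
  move=> w /= wG [i wi]; move: Gs; rewrite mem_undup -wG wi.
  by rewrite codom_f.
rewrite /= expect_bind expect_atoms -mean_indic//.
rewrite (@mean_fibers _ _ _ P _ (B n) (measurable_B n)
  (undup [seq z.2 | z <- network_law n])) ?undup_uniq//; last 2 first.
- exact: network_law_seq.
- exact: bounded_measurable_indic.
apply: eq_bigr => x _; rewrite -IH -step_probE.
transitivity (mean P (\1_([set w | B n.+1 w = G] `&` [set w | B n w = x]))).
  by congr (mean P _); apply/funext => w; rewrite indicI.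
rewrite mean_indic; last exact: measurableI.
rewrite prob_transition -[X in fine (X * _)%E]fineK ?fin_num_measure//.
by rewrite -EFinM; exact: mulrC.
Qed.

Lemma mean_network n (Phi : digraph -> R) (M : R) : (forall x, `|Phi x| <= M) ->
  mean P (Phi \o B n) = expect (network_law n) Phi.
Proof.
move=> PhiM; rewrite expect_atoms.
rewrite (@mean_fibers _ _ _ P _ (B n) (measurable_B n)
  (undup [seq z.2 | z <- network_law n])) ?undup_uniq//; last 2 first.
- by apply: network_law_seq => G; exact: network_lawE.
- exact: (bounded_measurable_discrete _ PhiM).
apply: eq_bigr => x _; rewrite -network_lawE -mean_indic// -meanZ; last first.
  exact: bounded_measurable_indic.
congr (mean P _); apply/funext => w /=; rewrite indicE.
by case: (boolP (w \in _)) => [|_]; rewrite ?mulr0// inE /= => ->.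
Qed.

Lemma charged_prob n G : charged (network_law n) G -> (0 < P [set w | B n w = G])%E.
Proof.
move=> [q q0 qG]; rewrite lt0e measure_ge0 andbT; apply/eqP => P0.
have := network_lawE n G; rewrite P0 /= => /esym E0.
suff : 0 < expect (network_law n) (fun x => (x == G)%:R) by rewrite E0 ltxx.
have [l0 _] := network_law_pmf n.
rewrite /expect (big_rem _ qG)/= eqxx mulr1 ltr_wpDr// big_seq.
by rewrite sumr_ge0// => z /mem_rem/l0 z0; rewrite mulr_ge0.
Qed.

(** A charged network has positive probability, so two vertices of outdegree [j] in it
would make [j] essential. *)
Lemma nonessential_count n G j : charged (network_law n) G -> (0 < j)%N ->
  ~ essential P B j -> (outdeg_count G j <= 1)%N.
Proof.
move=> /charged_prob PG j0 nej; rewrite leqNgt; apply/negP => cj.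
apply: nej; split=> //; apply: lt_le_trans PG _.
apply: le_measure; rewrite ?inE//; last by move=> w /= wG; exists n; rewrite wG.
rewrite (_ : [set w | _] = \bigcup_n [set w | (2 <= outdeg_count (B n w) j)%N]).
  apply: bigcupT_measurable => k.
  have /= := measurable_discrete (measurable_B k)
    (fun G => ((2 <= outdeg_count G j)%N)%:R : R).
  move=> /(_ measurableT [set 1] (measurable_set1 _)); rewrite setTI.
  rewrite (_ : _ @^-1` _ = [set w | (2 <= outdeg_count (B k w) j)%N])//.
  apply/seteqP; split => w /=; last by move=> ->.
  by case: (2 <= _)%N => // /esym/eqP; rewrite oner_eq0.
by apply/seteqP; split => [w [k wk]|w [k _ wk]]; exists k.
Qed.

End ProcessLaw.

(** * Ratios to the total weight *)

Section RatioBounds.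
Variables (R : realType) (lam w1 M : R).
Hypotheses (lam_gt0 : 0 < lam) (w1_gt0 : 0 < w1).

(** The constant of all the bounds for [Y / W - psi], where [M] bounds [psi].  Here [W] is
the total weight and [Y] a number of vertices of some outdegree after [N] steps,
and [V] and [Z] are their deviations from [lam * N] and [lam * N * psi]. *)
Definition ratio_const : R := 2 / lam * (1 + M + w1^-1).

Variables (N W Y psi : R).
Hypotheses (N_gt0 : 0 < N) (W_ge : w1 <= W) (Y_ge0 : 0 <= Y) (Y_le : w1 * Y <= W).
Hypothesis psi_le : `|psi| <= M.
Let V := W - lam * N.
Let Z := Y - lam * N * psi.

Let W_gt0 : 0 < W. Proof. exact: lt_le_trans W_ge. Qed.
Let M_ge0 : 0 <= M. Proof. exact: le_trans psi_le. Qed.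
Let lamN_gt0 : 0 < lam * N. Proof. exact: mulr_gt0. Qed.

Lemma ratio_const_ge0 : 0 <= ratio_const.
Proof.
by rewrite /ratio_const mulr_ge0// ?divr_ge0 ?(ltW lam_gt0)// !addr_ge0// invr_ge0 ltW.
Qed.

Lemma ratioE : Y / W - psi = (Z - psi * V) / W.
Proof. by rewrite /Z /V; field; rewrite gt_eqF. Qed.

(** Either the total weight is at least half of its typical size, and dividing by it
costs a factor [2 / (lam * N)], or it is so far from typical that its deviation [V]
alone exceeds [lam * N / 2]. *)
Lemma weight_dichotomy :
  W^-1 <= 2 / (lam * N) \/ 1 <= 2 / (lam * N) * `|V|.
Proof.
have [h|h] := leP (lam * N / 2) W; [left|right].
  by rewrite -[leRHS]invrK lef_pV2 ?posrE ?invr_gt0 ?divr_gt0// invf_div.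
rewrite mulrAC ler_pdivlMr// mul1r.
have : - V <= `|V| by rewrite -normrN ler_norm.
by rewrite /V; move: h; set b := `|_|; set l := lam * N; lra.
Qed.

Let ratio_le : `|Y / W - psi| <= M + w1^-1.
Proof.
rewrite [leRHS]addrC (le_trans (ler_normB _ _))// lerD//.
by rewrite ger0_norm ?divr_ge0 ?(ltW W_gt0)// ler_pdivrMr// ler_pdivlMl.
Qed.

Lemma ratio_norm : `|Y / W - psi| <= ratio_const * (`|Z| + `|V|) / N.
Proof.
have w0 : 0 <= w1^-1 by rewrite invr_ge0 ltW.
have E : ratio_const * (`|Z| + `|V|) / N =
  2 / (lam * N) * ((1 + M + w1^-1) * (`|Z| + `|V|)).
  by rewrite /ratio_const; field; rewrite !gt_eqF.
have k0 : 0 <= 2 / (lam * N) by rewrite divr_ge0// ltW.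
rewrite E; case: weight_dichotomy => [h|h].
  rewrite ratioE normrM [`|W^-1|]gtr0_norm ?invr_gt0// mulrC.
  apply: ler_pM => //; first by rewrite invr_ge0 ltW.
  apply: (le_trans (ler_normB _ _)); rewrite normrM.
  have : `|psi| * `|V| <= M * `|V| by rewrite ler_wpM2r.
  have : 0 <= M * `|Z| by rewrite mulr_ge0.
  have : 0 <= w1^-1 * (`|Z| + `|V|) by rewrite mulr_ge0// addr_ge0.
  by have := normr_ge0 V; nra.
apply: (le_trans ratio_le).
have : (M + w1^-1) * 1 <= (M + w1^-1) * (2 / (lam * N) * `|V|).
  by rewrite ler_wpM2l// addr_ge0.
rewrite mulr1 => /le_trans; apply.
rewrite mulrCA ler_wpM2l//.
have : 0 <= M * `|Z| by rewrite mulr_ge0.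
have : 0 <= w1^-1 * `|Z| by rewrite mulr_ge0.
by have := normr_ge0 V; have := normr_ge0 Z; nra.
Qed.

(** The difference is exactly [(Y / W - psi) * (- V / (lam * N))], to which
[ratio_norm] applies. *)
Lemma ratio_linear :
  `|Y / W - psi - (Z - psi * V) / (lam * N)| <= 2 / lam * ratio_const * (Z ^+ 2 + V ^+ 2) / N ^+ 2.
Proof.
have -> : Y / W - psi - (Z - psi * V) / (lam * N) = (Y / W - psi) * (- V / (lam * N)).
  by rewrite ratioE /V; field; rewrite !gt_eqF.
rewrite normrM normrM normrN [`|(lam * N)^-1|]gtr0_norm ?invr_gt0//.
have h : `|Y / W - psi| * (`|V| / (lam * N)) <=
    ratio_const * (`|Z| + `|V|) / N * (`|V| / (lam * N)).
  by rewrite ler_wpM2r ?ratio_norm// divr_ge0// ltW.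
apply: (le_trans h).
have -> : ratio_const * (`|Z| + `|V|) / N * (`|V| / (lam * N)) =
   (ratio_const / lam / N ^+ 2) * ((`|Z| + `|V|) * `|V|).
  by field; rewrite !gt_eqF.
have -> : 2 / lam * ratio_const * (Z ^+ 2 + V ^+ 2) / N ^+ 2 =
  (ratio_const / lam / N ^+ 2) * (2 * (Z ^+ 2 + V ^+ 2)).
  by field; rewrite !gt_eqF.
rewrite ler_wpM2l ?divr_ge0 ?ratio_const_ge0 ?sqr_ge0 ?(ltW lam_gt0)//.
rewrite -[Z ^+ 2]real_normK ?num_real// -[V ^+ 2]real_normK ?num_real//.
move: (normr_ge0 Z) (normr_ge0 V); set z := `|Z|; set v := `|V|; nra.
Qed.

(** By [ratioE], the contribution of [Z] itself to the product is [Z ^ 2 / W >= 0]; only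
that of [V] can be negative. *)
Lemma ratio_restoring : - (ratio_const * (`|Z| * `|V|) / N) <= Z * (Y / W - psi).
Proof.
have w0 : 0 <= w1^-1 by rewrite invr_ge0 ltW.
have E : ratio_const * (`|Z| * `|V|) / N =
  2 / (lam * N) * ((1 + M + w1^-1) * (`|Z| * `|V|)).
  by rewrite /ratio_const; field; rewrite !gt_eqF.
have k0 : 0 <= 2 / (lam * N) by rewrite divr_ge0// ltW.
have zv0 : 0 <= `|Z| * `|V| by rewrite mulr_ge0.
rewrite E lerNl; case: weight_dichotomy => [h|h].
  have -> : - (Z * (Y / W - psi)) = (psi * (Z * V)) / W - Z ^+ 2 / W.
    by rewrite ratioE; field; rewrite gt_eqF.
  have : 0 <= Z ^+ 2 / W by rewrite divr_ge0 ?sqr_ge0// ltW.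
  have : psi * (Z * V) / W <= M * (`|Z| * `|V|) * (2 / (lam * N)).
    apply: (le_trans (ler_norm _)); rewrite !normrM.
    apply: ler_pM => //.
      by rewrite ler_wpM2r.
    by rewrite gtr0_norm ?invr_gt0.
  have : 0 <= 2 / (lam * N) * ((1 + w1^-1) * (`|Z| * `|V|)).
    by rewrite mulr_ge0// mulr_ge0// addr_ge0.
  move: (`|Z| * `|V|) (2 / (lam * N)) (psi * (Z * V) / W) (Z ^+ 2 / W) => a b c e.
  by move: (w1^-1) => u; nra.
apply: (le_trans (ler_norm _)); rewrite normrN normrM.
have : `|Z| * `|Y / W - psi| <= `|Z| * (M + w1^-1) by rewrite ler_wpM2l.
move=> /le_trans; apply.
have : `|Z| * (M + w1^-1) * 1 <= `|Z| * (M + w1^-1) * (2 / (lam * N) * `|V|).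
  by rewrite ler_wpM2l// mulr_ge0// addr_ge0.
rewrite mulr1 => /le_trans; apply.
have : 0 <= 2 / (lam * N) * (`|Z| * `|V|) by rewrite mulr_ge0.
by move: (`|Z|) (`|V|) (2 / (lam * N)) (w1^-1) => a b c e; nra.
Qed.

Lemma inv_weight_le : W^-1 <= 2 / lam * (1 + w1^-1) * (1 + `|V|) / N.
Proof.
have w0 : 0 <= w1^-1 by rewrite invr_ge0 ltW.
have -> : 2 / lam * (1 + w1^-1) * (1 + `|V|) / N =
  2 / (lam * N) * ((1 + w1^-1) * (1 + `|V|)) by field; rewrite !gt_eqF.
have k0 : 0 <= 2 / (lam * N) by rewrite divr_ge0// ltW.
have := normr_ge0 V; case: weight_dichotomy => [h|h] v0.
  apply: (le_trans h); rewrite ler_peMr//.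
  by have := mulr_ge0 w0 v0; nra.
have : W^-1 <= w1^-1 by rewrite lef_pV2 ?posrE.
have := ler_wpM2l w0 h; rewrite mulr1.
move: (2 / (lam * N)) k0 (`|V|) v0 => b b0 v v0 h1 h2.
apply: (le_trans h2); apply: (le_trans h1).
rewrite mulrCA ler_wpM2l//.
by have := mulr_ge0 w0 v0; nra.
Qed.

Lemma inv_weight_le_sqr :
  W^-1 <= (2 / lam + 4 / (lam ^+ 2 * w1)) * (N + V ^+ 2) / N ^+ 2.
Proof.
have w0 : 0 <= w1^-1 by rewrite invr_ge0 ltW.
have -> : (2 / lam + 4 / (lam ^+ 2 * w1)) * (N + V ^+ 2) / N ^+ 2 =
  2 / (lam * N) + (2 / lam * (V / N) ^+ 2 + 4 / (lam ^+ 2 * w1) / N)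
  + w1^-1 * (2 / (lam * N) * V) ^+ 2.
  by field; rewrite !gt_eqF.
have a0 : 0 <= 2 / lam * (V / N) ^+ 2 + 4 / (lam ^+ 2 * w1) / N.
  rewrite addr_ge0//; first by rewrite mulr_ge0 ?sqr_ge0// divr_ge0// ltW.
  by rewrite divr_ge0 ?(ltW N_gt0)// divr_ge0// mulr_ge0 ?sqr_ge0// ltW.
have b0 : 0 <= w1^-1 * (2 / (lam * N) * V) ^+ 2 by rewrite mulr_ge0 ?sqr_ge0.
have k0 : 0 <= 2 / (lam * N) by rewrite divr_ge0// ltW.
case: weight_dichotomy => [h|h]; first by apply: (le_trans h); rewrite -addrA lerDl addr_ge0.
have hw : W^-1 <= w1^-1 by rewrite lef_pV2 ?posrE.
have h2 : 1 <= (2 / (lam * N) * V) ^+ 2.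
  rewrite -[leRHS]real_normK ?num_real// normrM [`|2 / _|]ger0_norm//.
  by rewrite -[leLHS](expr1n _ 2) ler_pXn2r ?nnegrE// mulr_ge0.
have := ler_wpM2l w0 h2; rewrite mulr1 => h3.
apply: (le_trans hw); apply: (le_trans h3); rewrite lerDr addr_ge0//.
Qed.

End RatioBounds.

(** * Increments of the total weight and of the degree counts *)

Section Increments.
Variables (R : realType) (chi rho : R) (m : nat) (C : 'I_m -> digraph) (p : 'I_m -> R).
Hypotheses (chi_ge0 : 0 <= chi) (chi_rho_gt0 : 0 < chi + rho).
Hypothesis C_bipolar : forall i, bipolar (C i).
Hypotheses (p_gt0 : forall i, 0 < p i) (p_sum1 : \sum_(i < m) p i = 1).
Variables (r : nat) (k : 'I_r -> nat) (K : nat).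
Hypothesis k_gt0 : forall l, (0 < k l)%N.
Hypothesis k_lt : forall i j : 'I_r, (i < j)%N -> (k i < k j)%N.
Hypothesis k_le : forall l, (k l <= K)%N.

Notation lw := (latch_weight chi rho).

Definition attach_degree i : nat := outdeg (north (C i)).

(** The weight of the new vertices, plus that of the arcs which the latch gains in excess
of the one it loses. *)
Definition weight_gain i : R := isum (C i) lw + chi * ((attach_degree i)%:R - 1).

(** The weight added by one step depends on the block only, so that the total weight is a
random walk of mean increment [growth_rate]. *)
Definition growth_rate : R := \sum_i p i * weight_gain i.

Definition count_gain (l : 'I_r) (d : nat) i : R :=
  ((d.-1 + attach_degree i == k l)%:R - (d == k l)%:R)
  + isum (C i) (fun e => (e == k l)%:R).

(** The outdegrees up to [K] other than the [k l] will be nonessential. *)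
Definition sparse (G : digraph) : Prop :=
  forall j, (0 < j <= K)%N -> (forall l, k l != j) -> (outdeg_count G j <= 1)%N.

Lemma attach_gt0 i : (0 < attach_degree i)%N.
Proof. exact: outdeg_north_gt0. Qed.

Lemma total_weight_grow G i (a : 'I_(size (arcs G))) :
  total_weight chi rho (grow (C i) a) = total_weight chi rho G + weight_gain i.
Proof.
rewrite /total_weight vsum_grow// -addrA; congr (_ + _); rewrite addrC; congr (_ + _).
have o0 := attach_gt0 i; rewrite -/(attach_degree i).
have := outdeg_tail_gt0 a; case: (outdeg (tail_of a)) => // d _.
move: o0; rewrite /latch_weight; case: (attach_degree i) => // o _ /=.
have e q : q.+1%:R = q%:R + 1 :> R by rewrite natr1.
by rewrite addnS /= /weight !e natrD; ring.
Qed.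

Lemma count_grow G i (a : 'I_(size (arcs G))) l :
  (outdeg_count (grow (C i) a) (k l))%:R =
  (outdeg_count G (k l))%:R + count_gain l (outdeg (tail_of a)) i :> R.
Proof. by rewrite !outdeg_countE vsum_grow// -addrA. Qed.

Definition average (phi : nat -> 'I_m -> R) d : R := \sum_i p i * phi d i.

(** How much each vertex of outdegree [d], compared with one of large outdegree,
changes the mean of [phi] over the choice of the latch, before normalization by the
total weight. *)
Definition excess (phi : nat -> 'I_m -> R) d : R :=
  lw d * (average phi d - average phi K.+1).

(** Bounds the joint effect of the nonessential outdegrees up to [K]. *)
Definition slack (phi : nat -> 'I_m -> R) : R := \sum_(d < K.+1) `|excess phi d|.

Lemma slack_ge0 phi : 0 <= slack phi.
Proof. by apply: sumr_ge0. Qed.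

Lemma k_inj : injective k.
Proof.
move=> i j kij; apply: val_inj; apply/eqP; rewrite eqn_leq.
by apply/andP; split; rewrite leqNgt; apply/negP => /k_lt; rewrite kij ltnn.
Qed.

(** A latch of outdegree [d > K] contributes the same average as one of outdegree
[K.+1]; among the others only those of the outdegrees [k l] can be numerous. *)
Lemma expect_step_expansion (phi : nat -> 'I_m -> R) (psi : 'I_r -> R) G F :
  (forall d i, (K < d)%N -> phi d i = phi K.+1 i) ->
  network G -> sparse G ->
  (forall i a, F (grow (C i) a) = phi (outdeg (tail_of (G := G) a)) i) ->
  `|expect (step_law chi rho C p G) F
    - (average phi K.+1 + \sum_l excess phi (k l) * psi l)
    - \sum_l excess phi (k l) *
        ((outdeg_count G (k l))%:R / total_weight chi rho G - psi l)|
  <= slack phi / total_weight chi rho G.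
Proof.
move=> phiK nG sG FE; set W := total_weight chi rho G.
have W0 : 0 < W by exact: total_weight_gt0.
rewrite (expect_step_latch chi rho p nG FE) -/W.
have -> : vsum G (fun d => lw d * \sum_(i < m) p i * phi d i) =
    average phi K.+1 * W + \sum_(d < K.+1) excess phi d * (outdeg_count G d)%:R.
  rewrite -vsum_split => [|d Kd]; last first.
    rewrite /excess /average; under eq_bigr do rewrite phiK//.
    by rewrite subrr mulr0.
  rewrite /W /total_weight -vsumZ -vsumD; congr (vsum G _); apply/funext => d.
  by rewrite /excess /average; ring.
have -> : W^-1 * (average phi K.+1 * W + \sum_(d < K.+1) excess phi d * (outdeg_count G d)%:R)
  - (average phi K.+1 + \sum_l excess phi (k l) * psi l)
  - \sum_l excess phi (k l) * ((outdeg_count G (k l))%:R / W - psi l) =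
  (\sum_(d < K.+1) excess phi d * (outdeg_count G d)%:R
   - \sum_l excess phi (k l) * (outdeg_count G (k l))%:R) / W.
  have -> : \sum_l excess phi (k l) * ((outdeg_count G (k l))%:R / W - psi l) =
    (\sum_l excess phi (k l) * (outdeg_count G (k l))%:R) / W
    - \sum_l excess phi (k l) * psi l.
    rewrite mulr_suml -sumrB; apply: eq_bigr => l _; ring.
  by move: (\sum_(d < _) _) (\sum_l _) (\sum_l _) => x y z; field; rewrite gt_eqF.
rewrite normrM [`|W^-1|]gtr0_norm ?invr_gt0// ler_wpM2r ?invr_ge0 ?(ltW W0)//.
have -> : \sum_l excess phi (k l) * (outdeg_count G (k l))%:R =
  \sum_(d < K.+1) (\sum_l (k l == d)%:R) * (excess phi d * (outdeg_count G d)%:R) :> R.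
  under [RHS]eq_bigr do rewrite mulr_suml.
  rewrite exchange_big/=; apply: eq_bigr => l _.
  have kK : (k l < K.+1)%N by rewrite ltnS.
  rewrite (bigD1 (Ordinal kK))//= eqxx mul1r big1 ?addr0// => d dk.
  have /negbTE -> : k l != d; last by rewrite mul0r.
  by apply: contra dk => /eqP e; apply/eqP/val_inj.
rewrite -sumrB; apply: (le_trans (ler_norm_sum _ _ _)); apply: ler_sum => d _.
have [[l kl]|nk] := pselect (exists l, k l = d).
  rewrite (bigD1 l)//= kl eqxx big1 => [|j jl].
    by rewrite addr0 mul1r subrr normr0.
  have /negbTE -> // : k j != d.
  by apply: contra jl => /eqP; rewrite -kl => /k_inj ->.
rewrite big1 => [|l _]; last by case: eqP => // kl; case: nk; exists l.
rewrite mul0r subr0 normrM.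
have [->|d0] := posnP d.
  by rewrite /excess /latch_weight eqxx !mul0r normr0 mul0r.
rewrite ler_piMr// normr_nat lern1; apply: sG; first by rewrite d0 -ltnS ltn_ord.
by move=> l; apply/eqP => kl; apply: nk; exists l.
Qed.

Variable psi : 'I_r -> R.

(** The total weight comes first because it enters the drift of all the numbers of
vertices, whose own order makes the drift triangular. *)
Definition deviation n G : 'rV[R]_r.+1 :=
  \row_x if unlift ord0 x is Some l
         then (outdeg_count G (k l))%:R - growth_rate * n.+1%:R * psi l
         else total_weight chi rho G - growth_rate * n.+1%:R.

Definition step_gain (x : 'I_r.+1) (d : nat) i : R :=
  if unlift ord0 x is Some l then count_gain l d i - growth_rate * psi l
  else weight_gain i - growth_rate.

Lemma deviation0 n G :
  deviation n G 0 ord0 = total_weight chi rho G - growth_rate * n.+1%:R.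
Proof. by rewrite mxE unlift_none. Qed.

Lemma deviationS n G l : deviation n G 0 (lift ord0 l) =
  (outdeg_count G (k l))%:R - growth_rate * n.+1%:R * psi l.
Proof. by rewrite mxE liftK. Qed.

Lemma step_gain0 d i : step_gain ord0 d i = weight_gain i - growth_rate.
Proof. by rewrite /step_gain unlift_none. Qed.

Lemma step_gainS l d i : step_gain (lift ord0 l) d i = count_gain l d i - growth_rate * psi l.
Proof. by rewrite /step_gain liftK. Qed.

Lemma deviation_grow n G i (a : 'I_(size (arcs G))) x :
  deviation n.+1 (grow (C i) a) 0 x - deviation n G 0 x = step_gain x (outdeg (tail_of a)) i.
Proof.
rewrite !mxE /step_gain; case: (unlift ord0 x) => [l|].
  by rewrite count_grow -natr1; ring.
by rewrite total_weight_grow -natr1; ring.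
Qed.

Lemma g_coef_le1 n : g_coef C p n <= 1.
Proof.
rewrite -p_sum1 /g_coef big_mkcond/=; apply: ler_sum => i _.
by case: ifP => // _; exact: ltW.
Qed.

Lemma count_gain_far l d i : (K < d)%N ->
  count_gain l d i = isum (C i) (fun e => (e == k l)%:R).
Proof.
move=> Kd; have kd := leq_ltn_trans (k_le l) Kd.
rewrite /count_gain [d == k l]gtn_eqF//.
have /negbTE -> : (d.-1 + attach_degree i)%N != k l.
  have := attach_gt0 i; case: d kd Kd => // d kd _; case: (attach_degree i) => // o _.
  by rewrite gtn_eqF//= addnS ltnS; rewrite ltnS in kd; rewrite (leq_trans kd) ?leq_addr.
by rewrite subrr add0r.
Qed.

Lemma step_gain_far x d i : (K < d)%N -> step_gain x d i = step_gain x K.+1 i.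
Proof.
by move=> Kd; rewrite /step_gain; case: unlift => // l; rewrite !count_gain_far.
Qed.

Lemma average_block l d : average (fun _ i => isum (C i) (fun e => (e == k l)%:R)) d
  = f_coef C p (k l).
Proof.
apply: eq_bigr => i _; congr (_ * _); rewrite -sum1_card natr_sum [RHS]big_mkcond/=.
rewrite /isum big_mkcond; apply: eq_bigr => v _.
by rewrite !inE; case: (_ && _); case: (_ == k l).
Qed.

Lemma excess_gain0 d : excess (step_gain ord0) d = 0.
Proof.
rewrite /excess /average; under eq_bigr do rewrite step_gain0.
by under [X in _ - X]eq_bigr do rewrite step_gain0; rewrite subrr mulr0.
Qed.

Lemma average_gain0 d : average (step_gain ord0) d = 0.
Proof.
rewrite /average; under eq_bigr do rewrite step_gain0 mulrBr.
by rewrite sumrB -mulr_suml p_sum1 mul1r subrr.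
Qed.

Lemma average_gainS l : average (step_gain (lift ord0 l)) K.+1 =
  f_coef C p (k l) - growth_rate * psi l.
Proof.
rewrite /average; under eq_bigr do rewrite step_gainS count_gain_far// mulrBr.
by rewrite sumrB -mulr_suml p_sum1 mul1r -(average_block l 0).
Qed.

(** A latch of outdegree [k j] becomes a vertex of outdegree [k l] only if
[k j <= k l], since the north poles have outgoing arcs.  This is what makes the drift
triangular. *)
Lemma excess_gainS l j : excess (step_gain (lift ord0 l)) (k j) =
  weight chi rho (k j) *
  ((if (j <= l)%N then g_coef C p (k l - k j)%N else 0) - (j == l)%:R).
Proof.
rewrite /excess /latch_weight gtn_eqF//; congr (_ * _).
rewrite /average -sumrB.
have E i : p i * step_gain (lift ord0 l) (k j) i - p i * step_gain (lift ord0 l) K.+1 i =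
    p i * ((k j).-1 + attach_degree i == k l)%:R - p i * (k j == k l)%:R.
  by rewrite !step_gainS (@count_gain_far l K.+1)// /count_gain; ring.
under eq_bigr do rewrite E; rewrite sumrB -mulr_suml p_sum1 mul1r.
rewrite (inj_eq k_inj); congr (_ - _).
have kj0 := k_gt0 j.
have hE i : ((k j).-1 + attach_degree i == k l)%N =
   (k j <= k l)%N && (attach_degree i == (k l - k j).+1)%N.
  have := attach_gt0 i; move: kj0; case: (k j) => // kj _; case: (attach_degree i) => // o _ /=.
  rewrite addnS -addSn eqSS; apply/eqP/andP => [<-|[h /eqP ->]].
    by rewrite leq_addr addKn eqxx.
  by rewrite subnKC.
under eq_bigr do rewrite hE.
have [jl|lj] := leqP j l.
  have -> : (k j <= k l)%N.
    by move: jl; rewrite leq_eqVlt => /predU1P[/val_inj ->//|/k_lt/ltnW].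
  rewrite /g_coef [RHS]big_mkcond/=; apply: eq_bigr => i _.
  by rewrite -/(attach_degree i); case: eqP; rewrite ?mulr1 ?mulr0.
rewrite big1// => i _; rewrite leqNgt k_lt//= mulr0//.
Qed.

Lemma step_gain_bounded : exists2 Q : R, 0 <= Q &
  forall x d i, `|step_gain x d i| <= Q.
Proof.
pose q i : R := `|weight_gain i - growth_rate| +
  \sum_l (2 + `|isum (C i) (fun e => (e == k l)%:R)| + `|growth_rate * psi l|).
have q0 i : 0 <= q i by rewrite addr_ge0// sumr_ge0// => l _; rewrite !addr_ge0.
exists (\sum_i q i); first by apply: sumr_ge0.
move=> x d i; apply: (@le_trans _ _ (q i)); last first.
  by rewrite (bigD1 i)//= lerDl sumr_ge0.
rewrite /step_gain; case: unlift => [l|]; last first.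
  by rewrite lerDl sumr_ge0// => l _; rewrite !addr_ge0.
apply: (@le_trans _ _ (2 + `|isum (C i) (fun e => (e == k l)%:R)| + `|growth_rate * psi l|)).
  rewrite /count_gain; apply: (le_trans (ler_normB _ _)); rewrite lerD2r.
  apply: (le_trans (ler_normD _ _)); rewrite lerD2r.
  apply: (le_trans (ler_normB _ _)); rewrite !normr_nat -natrD ler_nat.
  by do 2 case: eqP.
by rewrite /q (bigD1 l)//= addrCA lerDl addr_ge0// sumr_ge0.
Qed.

End Increments.

(** * Fluctuations of the network *)

Section NetworkCLT.
Variables (R : realType) (chi rho : R) (m : nat) (C : 'I_m -> digraph) (p : 'I_m -> R).
Hypotheses (chi_ge0 : 0 <= chi) (chi_rho_gt0 : 0 < chi + rho).
Hypothesis C_bipolar : forall i, bipolar (C i).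
Hypotheses (p_gt0 : forall i, 0 < p i) (p_sum1 : \sum_(i < m) p i = 1).
Variables (r : nat) (k : 'I_r -> nat) (K : nat).
Hypothesis k_gt0 : forall l, (0 < k l)%N.
Hypothesis k_lt : forall i j : 'I_r, (i < j)%N -> (k i < k j)%N.
Hypothesis k_le : forall l, (k l <= K)%N.
Variable psi : 'I_r -> R.

Variable lam : R.
Hypothesis lamE : lam = growth_rate chi rho C p.
Notation w1 := (weight chi rho 1).
Notation step_gain := (step_gain chi rho C p k psi).
Notation U := (deviation chi rho C p k psi).
Notation excess := (excess chi rho p K).
Notation slack := (slack chi rho p K).
Notation average := (average p).
Notation W := (total_weight chi rho).

Hypothesis lam_gt0 : 0 < lam.
Hypothesis psi_fixed : forall l, f_coef C p (k l) - lam * psi l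
  + \sum_j excess (step_gain (lift ord0 l)) (k j) * psi j = 0.

Variable law : nat -> seq (R * digraph).
Hypothesis law0_pmf : is_pmf (law 0).
Hypothesis lawS : forall n, law n.+1 = bind (law n) (step_law chi rho C p).
Hypothesis law_network : forall n G, charged (law n) G -> network G.
Hypothesis law_sparse : forall n G, charged (law n) G -> sparse k K G.

Let step_gain2 x y d i := step_gain x d i * step_gain y d i.

Let M : R := \sum_l `|psi l|.
Let A : R := \sum_x \sum_l `|excess (step_gain x) (k l)|
  + \sum_x \sum_y \sum_l `|excess (step_gain2 x y) (k l)|.
Let B : R := \sum_x slack (step_gain x) + \sum_x \sum_y slack (step_gain2 x y).
Let q1 : R := ratio_const lam w1 M.
Let q2 : R := 2 / lam * q1.
Let q4 : R := 2 / lam * (1 + w1^-1).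
Let q5 : R := 2 / lam + 4 / (lam ^+ 2 * w1).

Let M_ge l : `|psi l| <= M.
Proof. by rewrite /M (bigD1 l)//= lerDl sumr_ge0. Qed.

Let M_ge0 : 0 <= M. Proof. exact: sumr_ge0. Qed.

Let w1_gt0 : 0 < w1. Proof. exact: weight1_gt0. Qed.

Let q1_ge0 : 0 <= q1.
Proof. by rewrite mulr_ge0 ?divr_ge0 ?(ltW lam_gt0)// !addr_ge0// invr_ge0 ltW. Qed.

Let q2_ge0 : 0 <= q2.
Proof. by rewrite mulr_ge0 ?divr_ge0 ?(ltW lam_gt0). Qed.

Let q4_ge0 : 0 <= q4.
Proof. by rewrite mulr_ge0 ?divr_ge0 ?(ltW lam_gt0)// !addr_ge0// invr_ge0 ltW. Qed.

Let q5_ge0 : 0 <= q5.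
Proof.
by rewrite addr_ge0// ?divr_ge0 ?(ltW lam_gt0)// mulr_ge0 ?sqr_ge0// ltW.
Qed.

Let A1_ge x : \sum_l `|excess (step_gain x) (k l)| <= A.
Proof.
rewrite /A (bigD1 x)//= -addrA lerDl addr_ge0// ?sumr_ge0// => y _.
  by rewrite sumr_ge0.
by rewrite sumr_ge0// => z _; rewrite sumr_ge0.
Qed.

Let A2_ge x y : \sum_l `|excess (step_gain2 x y) (k l)| <= A.
Proof.
rewrite /A addrC (bigD1 x)//= (bigD1 y)//= -!addrA lerDl !addr_ge0// ?sumr_ge0// => z _.
- by rewrite sumr_ge0.
- by rewrite sumr_ge0// => z' _; rewrite sumr_ge0.
- by rewrite sumr_ge0.
Qed.

Let B1_ge x : slack (step_gain x) <= B.
Proof.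
rewrite /B (bigD1 x)//= -addrA lerDl addr_ge0// ?sumr_ge0// => y _; first exact: slack_ge0.
by rewrite sumr_ge0// => z _; exact: slack_ge0.
Qed.

Let B2_ge x y : slack (step_gain2 x y) <= B.
Proof.
rewrite /B addrC (bigD1 x)//= (bigD1 y)//= -!addrA lerDl !addr_ge0// ?sumr_ge0// => z _.
- exact: slack_ge0.
- by rewrite sumr_ge0// => z' _; exact: slack_ge0.
- exact: slack_ge0.
Qed.

Let A_ge0 : 0 <= A.
Proof. by apply: (le_trans _ (A1_ge ord0)); rewrite sumr_ge0. Qed.

Let B_ge0 : 0 <= B.
Proof. exact: (le_trans (slack_ge0 _ _ _ _ _) (B1_ge ord0)). Qed.

Section OneNetwork.
Variables (n : nat) (G : digraph).
Hypothesis G_charged : charged (law n) G.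
Let nG : network G := law_network G_charged.
Let N : R := n.+1%:R.
Let Y l : R := (outdeg_count G (k l))%:R.

Let N_gt0 : 0 < N. Proof. by rewrite ltr0n. Qed.
Let W_ge : w1 <= W G. Proof. exact: total_weight_ge1. Qed.
Let W_gt0 : 0 < W G. Proof. exact: lt_le_trans W_ge. Qed.
Let Y_ge0 l : 0 <= Y l. Proof. exact: ler0n. Qed.

Let Y_le l : w1 * Y l <= W G.
Proof.
rewrite /Y outdeg_countE -vsumZ; apply: vsum_le => d.
have [->|_] := eqVneq d (k l); last by rewrite mulr0 latch_weight_ge0.
by rewrite mulr1 /latch_weight gtn_eqF// weight_ge1.
Qed.

Let VE : U n G 0 ord0 = W G - lam * N. Proof. by rewrite lamE deviation0. Qed.
Let ZE l : U n G 0 (lift ord0 l) = Y l - lam * N * psi l. Proof. by rewrite lamE deviationS. Qed.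

Let sum_ratio_norm (e : 'I_r -> R) b : (forall l, `|U n G 0 (lift ord0 l)| + `|U n G 0 ord0| <= b) ->
  `|\sum_l e l * (Y l / W G - psi l)| <= (\sum_l `|e l|) * q1 * b / N.
Proof.
move=> Ub; apply: (le_trans (ler_norm_sum _ _ _)).
rewrite !mulr_suml; apply: ler_sum => l _; rewrite normrM.
rewrite (_ : _ * q1 * b / N = `|e l| * (q1 * b / N)); last by ring.
rewrite ler_wpM2l//; have := ratio_norm lam_gt0 w1_gt0 N_gt0 W_ge (Y_ge0 l) (Y_le l) (M_ge l).
rewrite -VE -ZE => /le_trans; apply.
by rewrite ler_wpM2r ?ler_wpM2l// invr_ge0 ltW.
Qed.

Let sum_ratio_linear (e : 'I_r -> R) :
  `|\sum_l e l * (Y l / W G - psi l)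
    - (\sum_l e l * (U n G 0 (lift ord0 l) - psi l * U n G 0 ord0)) / (lam * N)| <=
  (\sum_l `|e l|) * q2 * (N + norm2sq (U n G)) / N ^+ 2.
Proof.
rewrite mulr_suml -sumrB; apply: (le_trans (ler_norm_sum _ _ _)).
rewrite !mulr_suml; apply: ler_sum => l _.
rewrite -mulrA -mulrBr normrM.
rewrite (_ : _ * q2 * (N + norm2sq (U n G)) / N ^+ 2 =
  `|e l| * (q2 * (N + norm2sq (U n G)) / N ^+ 2)); last by ring.
rewrite ler_wpM2l//.
have := ratio_linear lam_gt0 w1_gt0 N_gt0 W_ge (Y_ge0 l) (Y_le l) (M_ge l).
rewrite -VE -ZE => /le_trans; apply.
rewrite ler_wpM2r ?invr_ge0 ?sqr_ge0// ler_wpM2l//.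
rewrite /norm2sq big_ord_recl/= (bigD1 l)//=.
have := ltW N_gt0; have : 0 <= \sum_(j < r | j != l) U n G 0 (lift ord0 j) ^+ 2.
  by rewrite sumr_ge0// => j _; exact: sqr_ge0.
by move: (\sum_(j < r | _) _) (_ ^+ 2) (_ ^+ 2) => x y z; lra.
Qed.

Let slack_norm s : s <= B -> s / W G <= B * q4 * (1 + `|U n G 0 ord0|) / N.
Proof.
move=> sB; rewrite (_ : _ * _ * _ / N = B * (q4 * (1 + `|U n G 0 ord0|) / N)); last by ring.
apply: (le_trans (ler_wpM2r _ sB)); first by rewrite invr_ge0 ltW.
by rewrite ler_wpM2l// VE; exact: inv_weight_le.
Qed.

Let slack_sqr s : s <= B -> s / W G <= B * q5 * (N + norm2sq (U n G)) / N ^+ 2.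
Proof.
move=> sB; rewrite (_ : _ * _ * _ / N ^+ 2 = B * (q5 * (N + norm2sq (U n G)) / N ^+ 2)); last by ring.
apply: (le_trans (ler_wpM2r _ sB)); first by rewrite invr_ge0 ltW.
rewrite ler_wpM2l//; have := inv_weight_le_sqr lam_gt0 w1_gt0 N_gt0 W_ge.
move=> /le_trans; apply; rewrite -VE ler_wpM2r ?invr_ge0 ?sqr_ge0// ler_wpM2l//.
by rewrite lerD2l /norm2sq big_ord_recl/= lerDl sumr_ge0// => j _; exact: sqr_ge0.
Qed.

(** The equations for [psi] say that the drift vanishes when the proportions are exactly
[psi]. *)
Let drift_fixed x : average (step_gain x) K.+1 + \sum_l excess (step_gain x) (k l) * psi l = 0.
Proof.
case: (unliftP ord0 x) => [l|] ->; first by rewrite average_gainS// -lamE.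
by rewrite average_gain0// add0r big1// => l _; rewrite excess_gain0// mul0r.
Qed.

Let drift_expansion x :
  `|drift (step_law chi rho C p) U n G x
    - \sum_l excess (step_gain x) (k l) * (Y l / W G - psi l)| <= slack (step_gain x) / W G.
Proof.
have := @expect_step_expansion R chi rho m C p chi_ge0 chi_rho_gt0 r k K k_lt k_le
  (step_gain x) psi G (fun y => U n.+1 y 0 x - U n G 0 x).
rewrite drift_fixed subr0; apply.
- by move=> d i Kd; exact: step_gain_far.
- exact: nG.
- exact: law_sparse G_charged.
- by move=> i a; exact: deviation_grow.
Qed.

Let sum_before l : \sum_(y < r.+1 | (y < (lift ord0 l : 'I_r.+1))%N) `|U n G 0 y| =
  `|U n G 0 ord0| + \sum_(j < r | (j < l)%N) `|U n G 0 (lift ord0 j)|.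
Proof.
by rewrite big_mkcond big_ord_recl/= [in RHS]big_mkcond.
Qed.

Lemma excess_diag_le0 (l : 'I_r) : excess (step_gain (lift ord0 l)) (k l) <= 0.
Proof.
rewrite excess_gainS// leqnn subnn eqxx pmulr_rle0 ?weight_gt0//.
by rewrite subr_le0 g_coef_le1.
Qed.

Lemma excess_upper0 (l j : 'I_r) : (l < j)%N -> excess (step_gain (lift ord0 l)) (k j) = 0.
Proof.
move=> lj; rewrite excess_gainS// leqNgt lj /=.
have /negbTE -> : j != l by apply: contraTneq lj => ->; rewrite ltnn.
by rewrite subr0 mulr0.
Qed.

(** The number of vertices of outdegree [k l] is pulled back to its typical value by
[excess_diag_le0] and [ratio_restoring]; the later coordinates do not enter, and the
earlier ones enter at most linearly. *)
Lemma deviation_drift_stable x : U n G 0 x * drift (step_law chi rho C p) U n G x <=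
  (A * q1 + B * q4) * `|U n G 0 x| * (1 + \sum_(y < r.+1 | (y < x)%N) `|U n G 0 y|) / N.
Proof.
have C0 : 0 <= A * q1 + B * q4 by rewrite addr_ge0// mulr_ge0.
have := drift_expansion x; have := A1_ge x; have := @slack_norm _ (B1_ge x).
set D := drift _ _ _ _ _.
case: (unliftP ord0 x) => [l|] -> sW eA H; last first.
  have -> : D = 0.
    move: H; rewrite big1 ?subr0 => [|l _]; last by rewrite excess_gain0 mul0r.
    rewrite (_ : slack _ = 0) ?mul0r ?normr_le0 => [/eqP//|].
    by rewrite /slack big1// => d _; rewrite excess_gain0 normr0.
  rewrite mulr0 divr_ge0 ?(ltW N_gt0)// mulr_ge0 ?mulr_ge0//.
  by rewrite addr_ge0// sumr_ge0.
rewrite sum_before.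
pose e j := excess (step_gain (lift ord0 l)) (k j).
pose S := \sum_j e j * (Y j / W G - psi j).
have {}eA : \sum_j `|e j| <= A := eA.
have {}H : `|D - S| <= slack (step_gain (lift ord0 l)) / W G := H.
set V := `|U n G 0 ord0|; set Z := U n G 0 (lift ord0 l).
set T := \sum_(j < r | (j < l)%N) _.
have T0 : 0 <= T by rewrite sumr_ge0.
have V0 : 0 <= V by exact: normr_ge0.
have ZS : Z * S <= (\sum_j `|e j|) * (`|Z| * (q1 * (V + T) / N)).
  rewrite /S mulr_sumr mulr_suml; apply: ler_sum => j _.
  have rho0 := ratio_norm lam_gt0 w1_gt0 N_gt0 W_ge (Y_ge0 j) (Y_le j) (M_ge j).
  have [jl|lj|jl] := ltngtP j l.
  - apply: (le_trans (ler_norm _)); rewrite normrM normrM mulrCA.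
    rewrite ler_wpM2l// ler_wpM2l//; apply: (le_trans rho0).
    rewrite -VE -ZE ler_wpM2r ?invr_ge0 ?(ltW N_gt0)// ler_wpM2l// addrC lerD2l.
    by rewrite /T (bigD1 j)//= lerDl sumr_ge0.
  - by rewrite /e excess_upper0// mul0r mulr0 normr0 mul0r.
  - have -> : j = l by exact: val_inj.
    have el := excess_diag_le0 l; rewrite -/(e l) in el *; rewrite (ler0_norm el).
    have := ratio_restoring lam_gt0 w1_gt0 N_gt0 W_ge (Y_ge0 l) (Y_le l) (M_ge l).
    rewrite -VE -ZE -/q1 -/Z -/V => /(ler_wnM2l el) h.
    have -> : Z * (e l * (Y l / W G - psi l)) = e l * (Z * (Y l / W G - psi l)) by ring.
    apply: (le_trans h); rewrite mulrN mulNr lerN2.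
    rewrite ler_wnM2l//.
    have -> : `|Z| * (q1 * (V + T) / N) = q1 * (`|Z| * (V + T)) / N by ring.
    by rewrite ler_wpM2r ?invr_ge0 ?(ltW N_gt0)// ler_wpM2l// ler_wpM2l// lerDl.
have ZD : Z * (D - S) <= `|Z| * (B * q4 * (1 + V) / N).
  apply: (le_trans (ler_norm _)); rewrite normrM ler_wpM2l//.
  exact: le_trans H sW.
have -> : Z * D = Z * S + Z * (D - S) by ring.
apply: (le_trans (lerD ZS ZD)).
have -> : (A * q1 + B * q4) * `|Z| * (1 + (V + T)) / N =
  A * (`|Z| * (q1 * (1 + (V + T)) / N)) + `|Z| * (B * q4 * (1 + (V + T)) / N) by ring.
apply: lerD.
  apply: ler_pM => //.
  - by rewrite sumr_ge0.
  - by rewrite mulr_ge0// divr_ge0 ?(ltW N_gt0)// mulr_ge0// addr_ge0.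
  - by rewrite ler_wpM2l// ler_wpM2r ?invr_ge0 ?(ltW N_gt0)// ler_wpM2l// lerDr.
rewrite ler_wpM2l// ler_wpM2r ?invr_ge0 ?(ltW N_gt0)// ler_wpM2l ?(mulr_ge0 B_ge0 q4_ge0)//.
by rewrite lerD2l lerDl.
Qed.

(** The coefficients of the linearization of the ratios [Y l / W] given by
[ratio_linear]. *)
Definition drift_matrix : 'M[R]_r.+1 := \matrix_(x, y)
  if unlift ord0 y is Some j then excess (step_gain x) (k j) / lam
  else - (\sum_j excess (step_gain x) (k j) * psi j) / lam.

Lemma deviation_drift_linear x :
  `|drift (step_law chi rho C p) U n G x - (\sum_y drift_matrix x y * U n G 0 y) / N| <=
  (A * q2 + B * q5) * (N + norm2sq (U n G)) / N ^+ 2.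
Proof.
have := drift_expansion x; have := @slack_sqr _ (B1_ge x).
have := sum_ratio_linear (fun j => excess (step_gain x) (k j)).
set D := drift _ _ _ _ _; set S := \sum_l _ * (_ / _ - _).
have -> : (\sum_l excess (step_gain x) (k l) *
   (U n G 0 (lift ord0 l) - psi l * U n G 0 ord0)) / (lam * N) =
   (\sum_y drift_matrix x y * U n G 0 y) / N.
  have D0 : drift_matrix x ord0 = - (\sum_j excess (step_gain x) (k j) * psi j) / lam.
    by rewrite mxE unlift_none.
  have DS j : drift_matrix x (lift ord0 j) = excess (step_gain x) (k j) / lam.
    by rewrite mxE liftK.
  rewrite big_ord_recl/= D0; under [in RHS]eq_bigr do rewrite DS mulrAC.
  rewrite -mulr_suml; under eq_bigr do rewrite mulrBr mulrA.
  rewrite sumrB -mulr_suml.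
  move: (\sum_l _) (\sum_l _) (U n G 0 ord0) => a b c.
  by field; rewrite !gt_eqF.
set L := (\sum_y _) / N => h1 h2 h3.
have -> : D - L = (D - S) + (S - L) by ring.
apply: (le_trans (ler_normD _ _)).
have -> : (A * q2 + B * q5) * (N + norm2sq (U n G)) / N ^+ 2 =
  B * q5 * (N + norm2sq (U n G)) / N ^+ 2 + A * q2 * (N + norm2sq (U n G)) / N ^+ 2.
  by ring.
apply: lerD; first exact: le_trans h3 h2.
apply: (le_trans h1); rewrite ler_wpM2r ?invr_ge0 ?sqr_ge0//.
rewrite ler_wpM2r ?ler_wpM2r ?A1_ge//.
by rewrite addr_ge0// ?(ltW N_gt0)// sumr_ge0// => y _; exact: sqr_ge0.
Qed.

Definition covariance_rate : 'M[R]_r.+1 := \matrix_(x, y)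
  (average (step_gain2 x y) K.+1 + \sum_l excess (step_gain2 x y) (k l) * psi l).

Lemma deviation_covariance x y :
  `|expect (step_law chi rho C p G)
      (fun H => (U n.+1 H 0 x - U n G 0 x) * (U n.+1 H 0 y - U n G 0 y))
    - covariance_rate x y| <= (A * q1 + B * q4) * (1 + norm1 (U n G)) / N.
Proof.
have := @expect_step_expansion R chi rho m C p chi_ge0 chi_rho_gt0 r k K k_lt k_le
  (step_gain2 x y) psi G (fun H => (U n.+1 H 0 x - U n G 0 x) * (U n.+1 H 0 y - U n G 0 y)).
set c := average _ _ + _; set E := expect _ _.
rewrite (_ : covariance_rate x y = c); last by rewrite mxE.
have V1 : `|U n G 0 ord0| <= norm1 (U n G).
  by rewrite /norm1 (bigD1 ord0)//= lerDl sumr_ge0.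
have Z1 l : `|U n G 0 (lift ord0 l)| + `|U n G 0 ord0| <= norm1 (U n G).
  rewrite /norm1 big_ord_recl/= addrC lerD2l (bigD1 l)//= lerDl sumr_ge0//.
have := sum_ratio_norm (fun j => excess (step_gain2 x y) (k j)) Z1.
set S := \sum_l _ * (_ / _ - _) => h1 /(_ _ _ _ _) h2.
have -> : E - c = (E - c - S) + S by ring.
apply: (le_trans (ler_normD _ _)).
have -> : (A * q1 + B * q4) * (1 + norm1 (U n G)) / N =
  B * q4 * (1 + norm1 (U n G)) / N + A * q1 * (1 + norm1 (U n G)) / N by ring.
have U0 : 0 <= norm1 (U n G) by rewrite sumr_ge0.
apply: lerD.
  apply: (le_trans (h2 _ _ _ _)).
  - move=> d i Kd; rewrite /step_gain2.
    have g z : step_gain z d i = step_gain z K.+1 i by exact: step_gain_far.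
    by rewrite !g.
  - exact: nG.
  - exact: law_sparse G_charged.
  - by move=> i a; rewrite /step_gain2 !deviation_grow.
  apply: (le_trans (slack_norm (B2_ge x y))).
  by rewrite ler_wpM2r ?invr_ge0 ?(ltW N_gt0)// ler_wpM2l ?(mulr_ge0 B_ge0 q4_ge0)// lerD2l.
apply: (le_trans h1); rewrite ler_wpM2r ?invr_ge0 ?(ltW N_gt0)//.
apply: ler_pM => //; first by rewrite mulr_ge0// sumr_ge0.
  by rewrite ler_wpM2r// A2_ge.
by rewrite lerDr.
Qed.

End OneNetwork.

Let drift_const : R := A * q1 + B * q4 + (A * q2 + B * q5).

Let const1_ge0 : 0 <= A * q1 + B * q4. Proof. by rewrite addr_ge0// mulr_ge0. Qed.
Let const2_ge0 : 0 <= A * q2 + B * q5. Proof. by rewrite addr_ge0// mulr_ge0. Qed.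

Let drift_stable n G x : charged (law n) G ->
  U n G 0 x * drift (step_law chi rho C p) U n G x <=
  drift_const * `|U n G 0 x| * (1 + \sum_(y < r.+1 | (y < x)%N) `|U n G 0 y|) / n.+1%:R.
Proof.
move=> cG; apply: (le_trans (deviation_drift_stable cG x)).
rewrite ler_wpM2r ?invr_ge0// ler_wpM2r ?addr_ge0 ?sumr_ge0//.
by rewrite ler_wpM2r// lerDl.
Qed.

Let step_pmf n G : charged (law n) G -> is_pmf (step_law chi rho C p G).
Proof. by move=> /law_network; exact: step_law_pmf. Qed.

Let increment_bound : exists2 Q : R, 0 <= Q & forall n G H x,
  charged (law n) G -> charged (step_law chi rho C p G) H ->
  `|U n.+1 H 0 x - U n G 0 x| <= Q.
Proof.
have [Q Q0 hQ] := step_gain_bounded chi rho C p k psi; exists Q => // n G H x _.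
by move=> /charged_step[i [a ->]]; rewrite deviation_grow.
Qed.

Lemma deviation_second_moment : exists2 b : R, 0 <= b & forall n x,
  expect (law n) (fun G => U n G 0 x ^+ 2) <= b * n.+1%:R.
Proof.
have [Q Q0 hQ] := increment_bound.
have C0 : 0 <= drift_const by rewrite addr_ge0.
exact: (second_moment Q0 C0 law0_pmf lawS step_pmf hQ drift_stable).
Qed.

Lemma deviation_clt : exists Sigma : 'M[R]_r.+1,
  [/\ Sigma^T = Sigma, forall s, 0 <= quad Sigma s
    & forall s a, expect (law n) (fun G => cos (dot s (U n G) / Num.sqrt n.+1%:R + a))
        @[n --> \oo] --> cos a * expR (- (quad Sigma s / 2))].
Proof.
have [Q Q0 hQ] := increment_bound.
have C0 : 0 <= drift_const by rewrite addr_ge0.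
have D_trig (x y : 'I_r.+1) : (x < y)%N -> drift_matrix x y = 0.
  rewrite mxE; case: (unliftP ord0 y) => [j|] ->; last by rewrite ltn0.
  case: (unliftP ord0 x) => [l|] ->; last by rewrite excess_gain0 mul0r.
  by rewrite !lift0 ltnS => lj; rewrite excess_upper0// mul0r.
have D_diag (x : 'I_r.+1) : drift_matrix x x <= 0.
  rewrite mxE; case: (unliftP ord0 x) => [j|] ->.
    by rewrite pmulr_lle0 ?invr_gt0// excess_diag_le0.
  by rewrite big1 ?oppr0 ?mul0r// => j _; rewrite excess_gain0 mul0r.
have G_sym : covariance_rate^T = covariance_rate.
  apply/matrixP => x y; rewrite !mxE.
  have -> // : step_gain2 y x = step_gain2 x y.
  by apply/funext => d; apply/funext => i; rewrite /step_gain2 mulrC.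
apply: (triangular_clt Q0 C0 law0_pmf lawS step_pmf D_trig D_diag G_sym hQ drift_stable).
  move=> n G x cG; apply: (le_trans (deviation_drift_linear cG x)).
  rewrite ler_wpM2r ?invr_ge0 ?sqr_ge0// ler_wpM2r ?lerDr//.
  by rewrite addr_ge0// sumr_ge0// => y _; exact: sqr_ge0.
move=> n G x y cG; apply: (le_trans (deviation_covariance cG x y)).
by rewrite ler_wpM2r ?invr_ge0// ler_wpM2r ?lerDl// addr_ge0// sumr_ge0.
Qed.

End NetworkCLT.

(** * The growth rate and the limiting proportions *)

Section GrowthRate.
Variables (R : realType) (chi rho : R) (m : nat) (C : 'I_m -> digraph) (p : 'I_m -> R).
Hypotheses (chi_ge0 : 0 <= chi) (chi_rho_gt0 : 0 < chi + rho).
Hypothesis C_bipolar : forall i, bipolar (C i).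
Hypotheses (p_gt0 : forall i, 0 < p i) (p_sum1 : \sum_(i < m) p i = 1).

Let outdeg_internal i (v : 'I_(nvert (C i))) : v \in internal (C i) -> (0 < outdeg v)%N.
Proof. by rewrite inE lt0n bipolar_sink// => /andP[]. Qed.

Let sum_iota_delta (F : nat -> R) n K : (0 < n <= K)%N ->
  \sum_(d <- iota 1 K) F d * (n == d)%:R = F n.
Proof.
move=> nK; rewrite (bigD1_seq n)/= ?iota_uniq ?mem_iota ?add1n ?ltnS//.
by rewrite eqxx mulr1 big1 ?addr0// => d; rewrite eq_sym => /negbTE ->; rewrite mulr0.
Qed.

(** Both sides are the mean weight added by a step: the sum over the outdegrees has
finite support and is exchanged with the sum over the blocks. *)
Lemma lambda1E : lambda1 chi rho C p = growth_rate chi rho C p.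
Proof.
pose K := (\max_i size (arcs (C i)))%N.
have degK i (v : 'I_(nvert (C i))) : (outdeg v <= K)%N.
  by apply: leq_trans (count_size _ _) _; exact: leq_bigmax.
have termE d : weight chi rho d * f_coef C p d + chi * d%:R * g_coef C p d =
  \sum_i p i * (weight chi rho d * isum (C i) (fun e => (e == d)%:R)
    + chi * (d%:R * (attach_degree C i == d.+1)%:R)).
  rewrite /f_coef /g_coef [X in _ + _ * X]big_mkcond/= !mulr_sumr -big_split/=.
  apply: eq_bigr => i _; rewrite -/(attach_degree C i).
  have -> : #|[set v in internal (C i) | outdeg v == d]%SET|%:R =
      isum (C i) (fun e => (e == d)%:R) :> R.
    rewrite -sum1_card natr_sum /isum big_mkcond/= [RHS]big_mkcond/=.
    by apply: eq_bigr => v _; rewrite !inE; case: ((v != _) && _); case: (_ == d).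
  by case: (_ == d.+1); rewrite /= ?mulr1 ?mulr0; ring.
rewrite /lambda1 -(@fsbig_widen _ _ _ _ [set` iota 1 K])/=; last 2 first.
- by move=> d /=; rewrite mem_iota => /andP[].
- move=> d [/= d1 /negP]; rewrite mem_iota d1 add1n ltnS -ltnNge => Kd.
  rewrite termE big1// => i _.
  have -> : attach_degree C i == d.+1 = false.
    by rewrite ltn_eqF// ltnS (leq_trans (degK _ _))// ltnW.
  rewrite /isum big1 => [|v _]; first by rewrite !mulr0 addr0 mulr0.
  by rewrite ltn_eqF// (leq_ltn_trans (degK _ _)).
rewrite -fsbig_seq ?iota_uniq// (eq_bigr _ (fun d _ => termE d)) exchange_big/=.
apply: eq_bigr => i _; rewrite -mulr_sumr; congr (_ * _).
rewrite big_split/= /weight_gain; congr (_ + _).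
  under eq_bigr do rewrite /isum mulr_sumr.
  rewrite exchange_big/=; apply: eq_bigr => v vi.
  rewrite sum_iota_delta ?degK ?outdeg_internal//.
  by rewrite /latch_weight gtn_eqF ?outdeg_internal.
rewrite -mulr_sumr; congr (_ * _).
have := degK i (north (C i)); rewrite -/(attach_degree C i).
have := attach_gt0 C_bipolar i; case: (attach_degree C i) => // -[_ _|o _ oK].
  rewrite subrr big_seq big1// => d; rewrite mem_iota => /andP[d0 _].
  by rewrite eqSS ltn_eqF// mulr0.
under eq_bigr do rewrite eqSS.
by rewrite sum_iota_delta ?(ltnW oK)// -(natr1 o.+1) addrK.
Qed.

Lemma weight_gain_ge0 i : 0 <= weight_gain chi rho C i.
Proof.
rewrite addr_ge0 ?sumr_ge0// => [v _|]; first exact: latch_weight_ge0.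
by rewrite mulr_ge0// subr_ge0 ler1n attach_gt0.
Qed.

(** An internal vertex has an outgoing arc, hence a positive weight. *)
Lemma growth_rate_gt0 : (exists i, internal (C i) != finset.set0) ->
  0 < growth_rate chi rho C p.
Proof.
move=> [i /finset.set0Pn[v vi]]; rewrite /growth_rate (bigD1 i)//=.
apply: ltr_wpDr.
  by rewrite sumr_ge0// => j _; rewrite mulr_ge0 ?weight_gain_ge0// ltW.
rewrite mulr_gt0// /weight_gain ltr_wpDr//.
  by rewrite mulr_ge0// subr_ge0 ler1n attach_gt0.
rewrite /isum (bigD1 v)//= ltr_wpDr ?sumr_ge0// => [w _|].
  exact: latch_weight_ge0.
have v0 := outdeg_internal vi.
by rewrite /latch_weight gtn_eqF// weight_gt0.
Qed.

(** This is the recursion for [psi] multiplied by its denominator, which is positive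
because [g_coef C p 0 <= 1]. *)
Lemma psi_fixed r (k : 'I_r -> nat) K (psi : 'I_r -> R) :
  (forall l, (0 < k l)%N) -> (forall i j : 'I_r, (i < j)%N -> (k i < k j)%N) ->
  (forall l, (k l <= K)%N) -> 0 < growth_rate chi rho C p ->
  (forall i : 'I_r, psi i =
     (growth_rate chi rho C p + weight chi rho (k i) * (1 - g_coef C p 0))^-1 *
     (f_coef C p (k i) + \sum_(j < r | (j < i)%N)
        weight chi rho (k j) * g_coef C p (k i - k j)%N * psi j)) ->
  forall l, f_coef C p (k l) - growth_rate chi rho C p * psi l
    + \sum_j excess chi rho p K (step_gain chi rho C p k psi (lift ord0 l)) (k j) * psi j = 0.
Proof.
move=> k0 k_lt kK lam0 psi_rec l.
have g0 : g_coef C p 0 <= 1 by exact: g_coef_le1.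
have den0 : 0 < growth_rate chi rho C p + weight chi rho (k l) * (1 - g_coef C p 0).
  by rewrite ltr_wpDr// mulr_ge0 ?subr_ge0// ltW// weight_gt0.
have -> : \sum_j excess chi rho p K (step_gain chi rho C p k psi (lift ord0 l)) (k j) * psi j =
  weight chi rho (k l) * (g_coef C p 0 - 1) * psi l +
  \sum_(j < r | (j < l)%N) weight chi rho (k j) * g_coef C p (k l - k j)%N * psi j.
  rewrite (bigD1 l)//= excess_gainS// leqnn subnn eqxx; congr (_ + _).
  rewrite big_mkcond [RHS]big_mkcond/=; apply: eq_bigr => j _.
  rewrite excess_gainS//; have [jl|lj|/val_inj ->] := ltngtP j l.
  - have /negbTE -> : j != l by apply: contraTneq jl => ->; rewrite ltnn.
    by rewrite /= subr0.
  - have /negbTE -> : j != l by apply: contraTneq lj => ->; rewrite ltnn.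
    by rewrite /= subr0 mulr0 mul0r.
  - by rewrite eqxx.
have := psi_rec l; move: (\sum_(j < r | _) _) => s.
set D := _ + _ in den0 *; move=> /(congr1 (fun x => D * x)).
rewrite mulrA mulfV ?gt_eqF// mul1r => h.
rewrite -[RHS](subrr (D * psi l)) [X in _ = X - _]h /D; ring.
Qed.

End GrowthRate.

Section Essential.
Context d (T : measurableType d) (R : realType) (P : probability T R).
Variables (chi rho : R) (m : nat) (C : 'I_m -> digraph) (p : 'I_m -> R).
Variable B : nat -> T -> digraph.
Hypotheses (chi_ge0 : 0 <= chi) (chi_rho_gt0 : 0 < chi + rho).
Hypothesis C_bipolar : forall i, bipolar (C i).
Hypotheses (p_gt0 : forall i, 0 < p i) (p_sum1 : \sum_(i < m) p i = 1).
Hypothesis B_process : bipolar_network_process chi rho C p P B.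

Notation law := (network_law P chi rho C p B).

(** If all the charged networks had at most one vertex of outdegree [j], each of the
countably many events would be null. *)
Lemma essential_charged j : essential P B j ->
  exists n G, charged (law n) G /\ (2 <= outdeg_count G j)%N.
Proof.
move=> [j0 Pj]; apply: contrapT => none.
pose A n := [set w | (2 <= outdeg_count (B n w) j)%N].
pose ind G : R := (2 <= outdeg_count G j)%N%:R.
have indA n : ind \o B n = \1_(A n).
  by apply/funext => w; rewrite indicE /ind /= /A; case: (boolP (_ <= _)%N) => h;
    [rewrite mem_set|rewrite memNset//; exact/negP].
have mB n G : measurable [set w | B n w = G] by have [] := B_process.
have mA n : measurable (A n).
  have -> : A n = (ind \o B n) @^-1` [set 1].
    rewrite indA; apply/seteqP; split => w /=; first by move=> ?; rewrite indicE mem_set.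
    by rewrite indicE; case: (boolP (w \in A n)) => [/set_mem//|_ /esym/eqP]; rewrite oner_eq0.
  by rewrite -[X in measurable X]setTI; apply: (measurable_discrete (mB n)).
have PA n : P (A n) = 0%E.
  have : fine (P (A n)) = 0.
    rewrite -mean_indic// -indA (mean_network _ _ _ _ _ B_process n (M := 1))//.
      rewrite -[RHS](expect_cst 0 (network_law_pmf chi_ge0 chi_rho_gt0 C_bipolar p_gt0 p_sum1 B_process n)).
      apply: expect_eq; first exact: (network_law_pmf _ _ _ _ _ B_process).
      move=> G cG; rewrite /ind; case: (boolP (_ <= _)%N) => // h.
      by case: none; exists n, G.
    by move=> G; rewrite /ind; case: (_ <= _)%N; rewrite ?normr1 ?normr0.
  by move=> fA; rewrite -[LHS]fineK ?fin_num_measure// fA.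
have AU : [set w | exists n, (2 <= outdeg_count (B n w) j)%N] = \bigcup_n A n.
  by apply/seteqP; split => [w [n wn]|w [n _ wn]]; exists n.
have mU : measurable (\bigcup_n A n) by exact: bigcupT_measurable.
have : P.-negligible (\bigcup_n A n).
  by apply: negligible_bigcup => n; apply/negligibleP => //; exact: PA.
by move/(negligibleP P mU); move: Pj; rewrite -AU => /[swap] ->; rewrite ltxx.
Qed.

(** Without internal vertices in the blocks every network consists of its two poles, of
which the north pole alone has outgoing arcs. *)
Lemma essential_internal j : essential P B j -> exists i, internal (C i) != finset.set0.
Proof.
move=> ej; have [j0 _] := ej; have [n [G [cG c2]]] := essential_charged ej.
apply: contrapT => none.
have int0 i : internal (C i) = finset.set0.
  by apply/eqP/negPn/negP => h; apply: none; exists i.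
have net := charged_network chi_ge0 chi_rho_gt0 C_bipolar p_gt0 p_sum1 B_process.
have poles : forall v : 'I_(nvert G), v = north G \/ v = south G.
  elim: n G cG {c2} => [|n IH] G.
    move=> [q _ /mapP[H]]; rewrite mem_undup => /codomP[i ->] [_ ->] v.
    apply: contrapT => nv; have : v \in internal (C i).
      by rewrite inE; apply/andP; split; apply/eqP => e; apply: nv; [left|right].
    by rewrite int0 inE.
  move=> /charged_bind[|H cH /charged_step[i [a ->]] v].
    exact: (network_law_pmf chi_ge0 chi_rho_gt0 C_bipolar p_gt0 p_sum1 B_process).
  case: (splitP v) => [u vu|u _].
    have -> : v = lshift _ u by apply: val_inj.
    by case: (IH _ cH u) => ->; [left|right].
  have : (0 < #|internal (C i)|)%N by exact: leq_ltn_trans (leq0n _) (ltn_ord u).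
  by rewrite int0 finset.cards0.
have [sG _] := net _ _ cG.
move: c2; rewrite /outdeg_count ltnNge => /negP; apply.
rewrite -(cards1 (north G)); apply: subset_leq_card; apply/fintype.subsetP => v.
rewrite !inE; case: (poles v) => ->; first by rewrite eqxx.
by have := sG (south G); rewrite eqxx => /eqP ->; rewrite ltn_eqF.
Qed.

Lemma network_sparse r (k : 'I_r.+1 -> nat) n G : first_essentials P B k ->
  charged (law n) G -> sparse k (k ord_max) G.
Proof.
move=> [k_lt k_ess k_first] cG j /andP[j0 jK] kj.
apply: (nonessential_count chi_ge0 chi_rho_gt0 C_bipolar p_gt0 p_sum1 B_process cG j0).
move=> ej; have [|l lj] := k_first ord_max _ ej; last first.
  by have := kj l; rewrite lj eqxx.
rewrite ltn_neqAle jK andbT; apply/eqP => e.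
by have := kj ord_max; rewrite e eqxx.
Qed.

End Essential.

(** * Recentring, and the theorem *)

Section Recentering.
Variables (R : realType) (S : eqType) (r : nat).
Variables (law : nat -> seq (R * S)) (U : nat -> S -> 'rV[R]_r.+1) (c : 'I_r -> R).
Hypothesis law_pmf : forall n, is_pmf (law n).
Variable b : R.
Hypothesis b_ge0 : 0 <= b.
Hypothesis second_moment_U : forall n i, expect (law n) (fun x => U n x 0 i ^+ 2) <= b * n.+1%:R.

Definition extend (s : 'rV[R]_r) : 'rV[R]_r.+1 :=
  \row_x if unlift ord0 x is Some l then s 0 l else 0.

Definition marginal_cov (Sigma : 'M[R]_r.+1) : 'M[R]_r :=
  \matrix_(i, j) Sigma (lift ord0 i) (lift ord0 j).

(** The deviations at time [n] are centred at [n.+1] times the rates and are normalized by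
[sqrt n.+1]; the constants [c] and the new denominator turn them into the variables
normalized by [sqrt n]. *)
Definition recentered n x : 'rV[R]_r :=
  \row_i ((U n x 0 (lift ord0 i) + c i) / Num.sqrt n%:R).

Let extend0 s : extend s 0 ord0 = 0. Proof. by rewrite mxE unlift_none. Qed.
Let extendS s l : extend s 0 (lift ord0 l) = s 0 l. Proof. by rewrite mxE liftK. Qed.

Lemma quad_extend Sigma s : quad Sigma (extend s) = quad (marginal_cov Sigma) s.
Proof.
rewrite !quadE big_ord_recl/= big1 ?add0r => [|j _]; last by rewrite extend0 !mul0r.
apply: eq_bigr => i _; rewrite big_ord_recl/= extend0 mulr0 mul0r add0r.
by apply: eq_bigr => j _; rewrite !extendS mxE.
Qed.

Lemma dot_extend s u : dot (extend s) u = \sum_l s 0 l * u 0 (lift ord0 l).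
Proof.
rewrite /dot big_ord_recl/= extend0 mul0r add0r.
by apply: eq_bigr => l _; rewrite extendS.
Qed.

Lemma dot_recentered s n x :
  dot s (recentered n x) = (dot (extend s) (U n x) + \sum_l s 0 l * c l) / Num.sqrt n%:R.
Proof.
rewrite dot_extend -big_split/= mulr_suml; apply: eq_bigr => l _.
by rewrite mxE mulrA mulrDr.
Qed.

Lemma inv_sqrt_increment n : `|(Num.sqrt n.+1%:R)^-1 - (Num.sqrt n.+2%:R)^-1|
  <= (Num.sqrt n.+2%:R)^-1 / n.+1%:R :> R.
Proof.
have E : Num.sqrt n.+2%:R ^+ 2 = Num.sqrt n.+1%:R ^+ 2 + 1 :> R.
  by rewrite !sqr_sqrtr ?ler0n// natr1.
rewrite -[X in _ / X](sqr_sqrtr (ler0n R n.+1)).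
have : 0 < Num.sqrt n.+1%:R :> R by rewrite sqrtr_gt0.
have : 0 < Num.sqrt n.+2%:R :> R by rewrite sqrtr_gt0.
move: E; move: (Num.sqrt n.+2%:R) (Num.sqrt n.+1%:R) => t s E t0 s0.
have -> : s^-1 - t^-1 = (s * t * (s + t))^-1.
  have -> : s^-1 - t^-1 = (t ^+ 2 - s ^+ 2) * (s * t * (s + t))^-1.
    by field; rewrite !gt_eqF// addr_gt0.
  by rewrite E addrAC subrr add0r mul1r.
rewrite ger0_norm; last by rewrite invr_ge0 ltW// !mulr_gt0// addr_gt0.
rewrite -invfM lef_pV2 ?posrE ?mulr_gt0 ?addr_gt0 ?exprn_gt0//.
have -> : s * t * (s + t) = t * s ^+ 2 + s * t ^+ 2 by ring.
by rewrite lerDl mulr_ge0 ?sqr_ge0// ltW.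
Qed.

Let moment_le n l : expect (law n) (fun x => `|U n x 0 l| / Num.sqrt n.+1%:R) <= 1 + b.
Proof.
have s0 : 0 < Num.sqrt n.+1%:R :> R by rewrite sqrtr_gt0.
apply: (@le_trans _ _ (expect (law n) (fun x => 1 + n.+1%:R^-1 * U n x 0 l ^+ 2))).
  apply: expect_le => // x _.
  rewrite -[X in X^-1 * _](sqr_sqrtr (ler0n R n.+1)) -[U _ _ _ _ ^+ 2]real_normK ?num_real//.
  have -> : (Num.sqrt n.+1%:R ^+ 2)^-1 * `|U n x 0 l| ^+ 2 = (`|U n x 0 l| / Num.sqrt n.+1%:R) ^+ 2.
    by rewrite expr_div_n mulrC.
  by move: (_ / _) => z; nra.
rewrite expectD expect_cst// expectZ lerD2l.
by rewrite ler_pdivrMl// mulrC.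
Qed.

Let cos_error s a n :
  `|expect (law n.+1) (fun x => cos (dot s (recentered n.+1 x) + a))
    - expect (law n.+1) (fun x => cos (dot (extend s) (U n.+1 x) / Num.sqrt n.+2%:R + a))|
  <= (\sum_l `|s 0 l|) * (1 + b) / n.+1%:R + `|\sum_l s 0 l * c l| / Num.sqrt n.+1%:R.
Proof.
set k := \sum_l s 0 l * c l.
rewrite -expectB.
apply: (@le_trans _ _ (expect (law n.+1) (fun x =>
   n.+1%:R^-1 * (\sum_l `|s 0 l| * (`|U n.+1 x 0 (lift ord0 l)| / Num.sqrt n.+2%:R))
   + `|k| / Num.sqrt n.+1%:R))).
  apply: expect_norm_le => // x _; set u := dot (extend s) _.
  rewrite dot_recentered -/u -/k.
  (* The change of normalization and of centring is a shift [h] of the argument. *)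
  pose h := u * ((Num.sqrt n.+1%:R)^-1 - (Num.sqrt n.+2%:R)^-1) + k / Num.sqrt n.+1%:R.
  have -> : (u + k) / Num.sqrt n.+1%:R + a = u / Num.sqrt n.+2%:R + a + h.
    by rewrite /h; ring.
  apply: (le_trans (cos_lipschitz _ _)); apply: (le_trans (ler_normD _ _)).
  apply: lerD; last by rewrite normrM [`|_^-1|]ger0_norm// invr_ge0.
  rewrite normrM; apply: (@le_trans _ _ (`|u| * ((Num.sqrt n.+2%:R)^-1 / n.+1%:R))).
    by rewrite ler_wpM2l// inv_sqrt_increment.
  rewrite mulrA mulrC ler_wpM2l ?invr_ge0//.
  have -> : \sum_l `|s 0 l| * (`|U n.+1 x 0 (lift ord0 l)| / Num.sqrt n.+2%:R) =
      (\sum_l `|s 0 l * U n.+1 x 0 (lift ord0 l)|) / Num.sqrt n.+2%:R.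
    by rewrite mulr_suml; apply: eq_bigr => l _; rewrite normrM mulrA.
  by rewrite ler_wpM2r ?invr_ge0// /u dot_extend ler_norm_sum.
rewrite expectD expect_cst// lerD2r expectZ mulrC ler_wpM2r ?invr_ge0//.
rewrite expect_sum mulr_suml; apply: ler_sum => l _.
by rewrite expectZ ler_wpM2l.
Qed.

Lemma cvg_cos_recentered Sigma :
  (forall s a, expect (law n) (fun x => cos (dot s (U n x) / Num.sqrt n.+1%:R + a))
        @[n --> \oo] --> cos a * expR (- (quad Sigma s / 2))) ->
  forall s a, expect (law n) (fun x => cos (dot s (recentered n x) + a))
     @[n --> \oo] --> cos a * expR (- (quad (marginal_cov Sigma) s / 2)).
Proof.
move=> clt s a; rewrite -quad_extend; have := clt (extend s) a.
set f := fun n => expect (law n) (fun x => cos (dot (extend s) _ / _ + a)).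
set g := fun n => expect (law n) (fun x => cos (dot s _ + a)).
set l := cos a * _; move=> fl.
rewrite -(cvg_shiftS g); rewrite -(cvg_shiftS f) in fl.
set q1 := (\sum_l `|s 0 l|) * (1 + b); set q2 := `|\sum_l s 0 l * c l|.
have err0 : (q1 / n.+1%:R + q2 / Num.sqrt n.+1%:R) @[n --> \oo] --> (0 : R).
  rewrite -[X in _ --> X](_ : q1 * 0 + q2 * 0 = 0); last by rewrite !mulr0 addr0.
  apply: cvgD; first by apply: cvgM; [exact: cvg_cst|exact: cvg_invS].
  apply: cvgM; first exact: cvg_cst.
  rewrite (_ : (fun n => (Num.sqrt n.+1%:R)^-1) = (fun n => Num.sqrt n.+1%:R / n.+1%:R : R)).
    exact: cvg_sqrt_div.
  apply/funext => n; rewrite -[X in _ / X](sqr_sqrtr (ler0n R n.+1)).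
  by rewrite expr2 invfM mulrA divff ?mul1r// gt_eqF// sqrtr_gt0.
have d0 : (g n.+1 - f n.+1) @[n --> \oo] --> (0 : R).
  apply/cvgr0Pnorm_le => e e0; have /cvgr0Pnorm_le/(_ _ e0) := err0.
  apply: filterS => n; apply: le_trans; apply: le_trans (ler_norm _).
  exact: cos_error.
rewrite -[l]add0r (_ : [sequence _]_n = fun n => (g n.+1 - f n.+1) + f n.+1).
  exact: cvgD.
by apply/funext => n; rewrite /= subrK.
Qed.

Lemma second_moment_recentered : exists b' : R, forall n i,
  expect (law n) (fun x => recentered n x 0 i ^+ 2) <= b'.
Proof.
exists (4 * b + 2 * \sum_i c i ^+ 2) => n i.
have ci : c i ^+ 2 <= \sum_i c i ^+ 2.
  by rewrite (bigD1 i)//= lerDl sumr_ge0// => j _; exact: sqr_ge0.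
have c0 := sqr_ge0 (c i).
case: n => [|n].
  rewrite (@eq_expect _ _ _ _ (fun=> 0)) ?expect_cst//; last first.
    by move=> x; rewrite mxE sqrtr0 invr0 mulr0 expr0n.
  by move: b_ge0 ci c0; move: (\sum_i _) (_ ^+ 2) => x y; lra.
have n0 : (0 : R) < n.+1%:R by rewrite ltr0n.
apply: (@le_trans _ _ (expect (law n.+1) (fun x =>
  2 * c i ^+ 2 + 2 / n.+1%:R * U n.+1 x 0 (lift ord0 i) ^+ 2))).
  apply: expect_le => // x _; rewrite mxE expr_div_n sqr_sqrtr ?ler0n//.
  rewrite ler_pdivrMr// mulrDl [2 / _ * _ * _]mulrAC divfK ?gt_eqF//.
  have : 2 * c i ^+ 2 <= 2 * c i ^+ 2 * n.+1%:R.
    by rewrite ler_peMr ?ler1n// mulr_ge0.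
  move: (2 * c i ^+ 2 * n.+1%:R) (U _ _ _ _) (c i) => z y w wz.
  have -> : (y + w) ^+ 2 = 2 * w ^+ 2 + 2 * y ^+ 2 - (y - w) ^+ 2 by ring.
  by have := sqr_ge0 (y - w); move: wz; lra.
rewrite expectD expect_cst// expectZ.
have h : 2 / n.+1%:R * expect (law n.+1) (fun x => U n.+1 x 0 (lift ord0 i) ^+ 2) <= 4 * b.
  rewrite mulrAC ler_pdivrMr//.
  apply: (@le_trans _ _ (2 * (b * n.+2%:R))); first by rewrite ler_wpM2l.
  have : b * n.+2%:R <= b * (2 * n.+1%:R).
    by rewrite ler_wpM2l// -natrM ler_nat mulSn mul1n addSn addnS !ltnS leq_addr.
  by move: (b * n.+2%:R) => z; nra.
by move: ci h c0; move: (2 / _ * _) (\sum_i _) (_ ^+ 2) => x y z; lra.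
Qed.

End Recentering.

Theorem theorem1p7 (R : realType) (chi rho : R)
    (chi_ge0 : 0 <= chi) (chi_rho_gt0 : 0 < chi + rho)
    (m : nat) (C : 'I_m -> digraph) (p : 'I_m -> R)
    (C_bipolar : forall i, bipolar (C i))
    (p_gt0 : forall i, 0 < p i) (p_sum1 : \sum_(i < m) p i = 1)
    (d : measure_display) (T : measurableType d) (P : probability T R)
    (B : nat -> T -> digraph)
    (B_process : bipolar_network_process chi rho C p P B)
    (r : nat) (r_gt0 : (0 < r)%N) (k : 'I_r -> nat)
    (k_first : first_essentials P B k)
    (psi : 'I_r -> R)
    (psi_rec : forall i : 'I_r,
       psi i =
       (lambda1 chi rho C p + weight chi rho (k i) * (1 - g_coef C p 0))^-1 *
       (f_coef C p (k i) +
        \sum_(j < r | (j < i)%N)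
          weight chi rho (k j) * g_coef C p (k i - k j)%N * psi j)) :
  exists (Sigma : 'M[R]_r) (mu : probability (borel_rV R r) R),
    centered_mvnormal Sigma mu /\
    cvg_in_law P
      (fun n w => \row_(i < r)
         (((outdeg_count (B n w) (k i))%:R
           - n%:R * lambda1 chi rho C p * psi i) / Num.sqrt n%:R))
      mu.
Proof.
case: r r_gt0 k k_first psi psi_rec => // r _ k k_first psi psi_rec.
have [k_lt k_ess _] := k_first.
have k_gt0 l : (0 < k l)%N by have [] := k_ess l.
have k_le l : (k l <= k ord_max)%N.
  have := leq_ord l; rewrite leq_eqVlt => /predU1P[lr|lr].
    by rewrite (_ : l = ord_max)//; exact: val_inj.
  by rewrite ltnW// k_lt.
rewrite lambda1E// in psi_rec *; set lam := growth_rate chi rho C p.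
have lam_gt0 : 0 < lam.
  apply: growth_rate_gt0 => //.
  exact: (essential_internal chi_ge0 chi_rho_gt0 C_bipolar p_gt0 p_sum1 B_process (k_ess ord0)).
have fixed := psi_fixed chi_ge0 chi_rho_gt0 C_bipolar p_gt0 p_sum1 k_gt0 k_lt k_le lam_gt0 psi_rec.
pose law := network_law P chi rho C p B.
have law_pmf n : is_pmf (law n).
  exact: (network_law_pmf chi_ge0 chi_rho_gt0 C_bipolar p_gt0 p_sum1 B_process).
have net n G : charged (law n) G -> network G.
  exact: (charged_network chi_ge0 chi_rho_gt0 C_bipolar p_gt0 p_sum1 B_process).
have spa n G : charged (law n) G -> sparse k (k ord_max) G.
  exact: (network_sparse chi_ge0 chi_rho_gt0 C_bipolar p_gt0 p_sum1 B_process k_first).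
have [b b0 hb] := deviation_second_moment chi_ge0 chi_rho_gt0 C_bipolar p_gt0 p_sum1
  k_gt0 k_lt k_le (erefl lam) lam_gt0 fixed (law_pmf 0%N) (fun n => erefl) net spa.
have [Sigma0 [Sym Pos clt]] := deviation_clt chi_ge0 chi_rho_gt0 C_bipolar p_gt0 p_sum1
  k_gt0 k_lt k_le (erefl lam) lam_gt0 fixed (law_pmf 0%N) (fun n => erefl) net spa.
pose U := deviation chi rho C p k psi.
pose Sigma := marginal_cov Sigma0.
have SigmaT : Sigma^T = Sigma.
  by apply/matrixP => i j; rewrite !mxE -[in RHS]Sym mxE.
have Sigma_ge0 t : 0 <= quad Sigma t by rewrite -quad_extend.
have [mu mu_normal] := centered_mvnormal_exists SigmaT Sigma_ge0.
exists Sigma, mu; split => // h h_cont h_bounded.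
pose c l := lam * psi l.
have [b' hb'] := second_moment_recentered c law_pmf b0 hb.
have cos_cvg := cvg_cos_recentered c law_pmf hb clt.
have X_cvg : expect (law n) (fun G => h (recentered U c n G)) @[n --> \oo] --> mean mu h.
  apply: (cvg_expect_continuous law_pmf _ hb' h_cont h_bounded) => t a.
  by rewrite (mvnormal_cos mu_normal); exact: cos_cvg.
rewrite [X in _ --> X](_ : _ = (mean mu h)%:E); last first.
  by rewrite integral_mean//; exact: bounded_measurable_continuous.
rewrite (_ : (fun n => _) = fun n => (expect (law n) (fun G => h (recentered U c n G)))%:E).
  by apply: cvg_EFin => //; exact: nearW.
apply/funext => n; have [M hM] := h_bounded.
rewrite -(mean_network chi_ge0 chi_rho_gt0 C_bipolar p_gt0 p_sum1 B_process n
  (Phi := fun G => h (recentered U c n G)) (M := M))//.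
rewrite -integral_mean; last first.
  have mB G : measurable [set w | B n w = G] by have [] := B_process.
  exact: (bounded_measurable_discrete mB (Phi := fun G => h (recentered U c n G)) (fun G => hM _)).
apply: eq_integral => w _ /=; congr (h _)%:E; apply/rowP => i; rewrite !mxE liftK.
congr (_ / _); rewrite /c -/lam -natr1; ring.
Qed.
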